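(* For integers $d\geq 2$: $e_{\mathrm{HK}}(S_{3,d})<e_{\mathrm{HK}}(R_{2,d})$ if and only if either $d$ is even and $d\geq 8$, or $d$ is odd and $d\geq 13$.
   Context: For a Noetherian local ring $(R,\mathfrak{m})$ of prime characteristic $p$ and dimension $d$, let $\mathfrak{m}^{[p^e]}=(a^{p^e}:a\in\mathfrak{m})$, $\mathrm{HK}_e(R)=\operatorname{length}_R(R/\mathfrak{m}^{[p^e]})$, and $e_{\mathrm{HK}}(R)=\lim_{e\to\infty}\mathrm{HK}_e(R)/p^{ed}$ (the Hilbert–Kunz multiplicity; the limit exists). $R_{2,d}=\mathbb{F}_2[[x_0,\dots,x_d]]/(Q_d)$, where $Q_d=x_0x_1+x_2x_3+\dots+x_{d-1}x_d$ if $d$ is odd and $Q_d=x_0x_1+\dots+x_{d-2}x_{d-1}+x_d^2$ if $d$ is even. $S_{3,d}=\mathbb{F}_3[[x_0,\dots,x_d]]/(P_d)$, where $P_d=x_0x_1+\dots+x_{d-3}x_{d-2}+x_{d-1}^2+x_d^3$ if $d$ is odd and $P_d=x_0x_1+\dots+x_{d-2}x_{d-1}+x_d^3$ if $d$ is even. *)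

(* Defs.v *)
From HB Require Import structures.
From mathcomp Require Import all_boot all_order all_algebra.
From mathcomp Require Import generic_quotient ring_quotient.
From mathcomp Require Import boolp classical_sets reals topology.
From mathcomp Require Import normedtype sequences.
(* Without its notations, which clash with those of topology. *)
From mathcomp Require Import -(notations) mpoly.

Set Implicit Arguments.
Unset Strict Implicit.
Unset Printing Implicit Defensive.

Import Order.TTheory GRing.Theory Num.Theory numFieldNormedType.Exports.
Local Open Scope classical_set_scope.
Local Open Scope ring_scope.
Local Open Scope quotient_scope.

(** * Formal power series in n variables *)

(* The series sum_m (f m) x^m, m ranging over the multi-indices in nat^n. *)
Definition powser (n : nat) (k : comNzRingType) : Type := multinom n -> k.

Section PowerSeries.
Variables (n : nat) (k : comNzRingType).
Local Notation series := (powser n k).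
Local Notation mon := (multinom n).
Implicit Types (f g h : series) (m : mon).

HB.instance Definition _ := gen_eqMixin series.
HB.instance Definition _ := gen_choiceMixin series.

Definition ps_zero : series := fun=> 0.
Definition ps_opp f : series := fun m => - f m.
Definition ps_add f g : series := fun m => f m + g m.
Definition ps_const (c : k) : series := fun m => if m == mnm0 then c else 0.
Definition ps_var (i : 'I_n) : series := fun m => (m == mnm1 i)%:R.

(* Cauchy product; the bounded multi-indices only make the sum finite. *)
Definition ps_mul f g : series := fun m =>
  \sum_(ij : bmultinom n (mdeg m).+1 * bmultinom n (mdeg m).+1
        | m == mnm_add ij.1 ij.2)
    f ij.1 * g ij.2.

Fact ps_addA : associative ps_add.
Proof. by move=> f g h; apply/funext => m; rewrite /ps_add addrA. Qed.
Fact ps_addC : commutative ps_add.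
Proof. by move=> f g; apply/funext => m; rewrite /ps_add addrC. Qed.
Fact ps_add0 : left_id ps_zero ps_add.
Proof. by move=> f; apply/funext => m; rewrite /ps_add add0r. Qed.
Fact ps_addN : left_inverse ps_zero ps_opp ps_add.
Proof. by move=> f; apply/funext => m; rewrite /ps_add addNr. Qed.

HB.instance Definition _ :=
  GRing.isZmodule.Build series ps_addA ps_addC ps_add0 ps_addN.

Definition ps_trunc (D : nat) f : mpoly n k :=
  \sum_(m : bmultinom n D) f m *: mpolyX k m.

Lemma mcoeff_trunc D f m : (mdeg m < D)%N ->
  mcoeff m (ps_trunc D f) = f m.
Proof.
move=> mD; rewrite /ps_trunc raddf_sum /=.
rewrite (bigD1 (BMultinom mD)) //= big1 => [|i ne].
  by rewrite mcoeffZ mcoeffX eqxx mulr1 addr0.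
rewrite mcoeffZ mcoeffX.
case: eqP => [e|]; last by rewrite mulr0.
by case/eqP: ne; apply: val_inj.
Qed.

Lemma ps_mul_mcoeff D f g (f' g' : mpoly n k) m : (mdeg m < D)%N ->
  (forall i, (mdeg i < D)%N -> f i = mcoeff i f') ->
  (forall i, (mdeg i < D)%N -> g i = mcoeff i g') ->
  ps_mul f g m = mcoeff m (f' * g').
Proof.
move=> mD ff' gg'; rewrite (mcoeff_poly_mul _ _ (k := (mdeg m).+1)) // /ps_mul.
apply: eq_bigr => -[i j] _ /=.
by rewrite ff' ?gg' //; apply: leq_trans mD; apply: bmdeg.
Qed.

Lemma ps_mul_trunc D f g m : (mdeg m < D)%N ->
  ps_mul f g m = mcoeff m (ps_trunc D f * ps_trunc D g).
Proof. by move=> mD; apply: ps_mul_mcoeff mD _ _ => i iD; rewrite mcoeff_trunc. Qed.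

Fact ps_mulC : commutative ps_mul.
Proof.
move=> f g; apply/funext => m.
by rewrite !(@ps_mul_trunc (mdeg m).+1) // mulrC.
Qed.

Fact ps_mulA : associative ps_mul.
Proof.
move=> f g h; apply/funext => m; set D := (mdeg m).+1.
rewrite (@ps_mul_mcoeff D f _ (ps_trunc D f)
  (ps_trunc D g * ps_trunc D h)) //; last first.
- by move=> i iD; rewrite -ps_mul_trunc.
- by move=> i iD; rewrite mcoeff_trunc.
rewrite (@ps_mul_mcoeff D _ h (ps_trunc D f * ps_trunc D g)
  (ps_trunc D h)) ?mulrA //.
- by move=> i iD; rewrite -ps_mul_trunc.
- by move=> i iD; rewrite mcoeff_trunc.
Qed.

Fact ps_mul1 : left_id (ps_const 1) ps_mul.
Proof.
move=> f; apply/funext => m; set D := (mdeg m).+1.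
rewrite (@ps_mul_mcoeff D _ f 1 (ps_trunc D f)) //.
- by rewrite mul1r mcoeff_trunc.
- by move=> i _; rewrite mcoeff1 /ps_const; case: eqP.
- by move=> i iD; rewrite mcoeff_trunc.
Qed.

Fact ps_mulDl : left_distributive ps_mul ps_add.
Proof.
move=> f g h; apply/funext => m; rewrite /ps_mul /ps_add -big_split /=.
by apply: eq_bigr => ij _; rewrite -mulrDl.
Qed.

Fact ps_one_neq0 : ps_const 1 != 0 :> series.
Proof.
apply/eqP => /(congr1 (fun f : series => f mnm0)).
by rewrite /ps_const eqxx; apply/eqP/oner_neq0.
Qed.

HB.instance Definition _ := GRing.Zmodule_isComNzRing.Build series
  ps_mulA ps_mulC ps_mul1 ps_mulDl ps_one_neq0.

Lemma ps_addE f g m : (f + g) m = f m + g m.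
Proof. by []. Qed.

Lemma ps_mul0E f g : (f * g) mnm0 = f mnm0 * g mnm0.
Proof.
rewrite [LHS](@ps_mul_mcoeff 1 f g (mpolyC n (f mnm0))
  (mpolyC n (g mnm0))) ?mdeg0 //.
- by rewrite -mpolyCM mcoeffC eqxx mulr1.
- move=> i; rewrite ltnS leqn0 mdeg_eq0 => /eqP->.
  by rewrite mcoeffC eqxx mulr1.
- move=> i; rewrite ltnS leqn0 mdeg_eq0 => /eqP->.
  by rewrite mcoeffC eqxx mulr1.
Qed.

Lemma ps_var0E i : ps_var i mnm0 = 0.
Proof. by rewrite /ps_var eq_sym mnm1_eq0. Qed.

End PowerSeries.

(** * Ideals and quotients *)

Section Ideals.
Variable A : comNzRingType.

Definition is_ideal (I : set A) : Prop :=
  [/\ I 0, forall x y, I x -> I y -> I (x + y) & forall a x, I x -> I (a * x)].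

Definition is_prime_ideal (P : set A) : Prop :=
  [/\ is_ideal P, ~ P 1 & forall a b, P (a * b) -> P a \/ P b].

Definition is_maximal_ideal (M : set A) : Prop :=
  [/\ is_ideal M, ~ M 1
    & forall J, is_ideal J -> ~ J 1 -> M `<=` J -> J = M].

Definition ideal_gen (G : set A) : set A := smallest is_ideal G.

Lemma ideal_gen_ideal G : is_ideal (ideal_gen G).
Proof.
split=> [I [[]]//|x y Ix Iy I IG|a x Ix I IG].
  by case: (IG) => -[_ ID _] _; apply: ID; [apply: Ix|apply: Iy].
by case: (IG) => -[_ _ IM] _; apply: IM; apply: Ix.
Qed.

Definition ideal_pred (G : set A) : {pred A} := fun x => `[< ideal_gen G x >].

Fact ideal_pred_zmod G : zmod_closed (ideal_pred G).
Proof.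
have [I0 ID IM] := ideal_gen_ideal G.
split=> [|x y /asboolP xI /asboolP yI]; first exact/asboolP.
apply/asboolP; suff NyI : ideal_gen G (- y) by exact: (ID x (- y) xI NyI).
by rewrite -mulN1r; exact: (IM (-1) y yI).
Qed.
HB.instance Definition _ G :=
  GRing.isZmodClosed.Build A (ideal_pred G) (ideal_pred_zmod G).

(* The A-module A / (G). *)
Definition quot_module (G : set A) : Type := Quotient.quot (ideal_pred G).

Section QuotModule.
Variable G : set A.
Local Notation Q := (quot_module G).

HB.instance Definition _ := GRing.Zmodule.on Q.

Definition quot_scale (a : A) (x : Q) : Q := \pi_Q (a * repr x).

Lemma quot_scale_pi a (x : A) : quot_scale a (\pi_Q x) = \pi_Q (a * x).
Proof.
have [_ _ IM] := ideal_gen_ideal G.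
have xI : x - repr (\pi_Q x) \in ideal_pred G.
  by rewrite Quotient.idealrBE; apply/eqP/esym; exact: (reprK (\pi_Q x)).
apply/esym/eqP; rewrite -Quotient.idealrBE -mulrBr.
by apply/asboolP; move/asboolP: xI => xI; exact: (IM a _ xI).
Qed.

Fact quot_scaleA a b x : quot_scale a (quot_scale b x) = quot_scale (a * b) x.
Proof. by elim/quotW: x => x; rewrite (quot_scale_pi b x) !quot_scale_pi mulrA. Qed.
Fact quot_scale1 : left_id 1 quot_scale.
Proof. by elim/quotW => x; rewrite quot_scale_pi mul1r. Qed.
Fact quot_scaleDr : right_distributive quot_scale +%R.
Proof.
move=> a; elim/quotW => x; elim/quotW => y.
by rewrite -raddfD !quot_scale_pi mulrDr raddfD.
Qed.
Fact quot_scaleDl x : {morph quot_scale^~ x : a b / a + b}.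
Proof. by move=> a b; elim/quotW: x => x; rewrite !quot_scale_pi mulrDl raddfD. Qed.

HB.instance Definition _ := GRing.Zmodule_isLmodule.Build A Q
  quot_scaleA quot_scale1 quot_scaleDr quot_scaleDl.

End QuotModule.

(* The same ideal, with a proof that it is proper: {ideal_quot _} then is a
   ring. *)
Definition proper_ideal_pred (G : set A) of ~ ideal_gen G 1 : {pred A} :=
  ideal_pred G.

Fact proper_ideal_pred_closed G (G1 : ~ ideal_gen G 1) :
  idealr_closed (proper_ideal_pred G1).
Proof.
have [I0 ID IM] := ideal_gen_ideal G.
split; [exact/asboolP | by apply/negP => /asboolP |].
move=> a x y /asboolP xI /asboolP yI; apply/asboolP.
exact: (ID _ _ (IM a x xI) yI).
Qed.
HB.instance Definition _ G (G1 : ~ ideal_gen G 1) :=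
  isIdealr.Build A (proper_ideal_pred G1) (proper_ideal_pred_closed G1).

End Ideals.

(** * Length, Krull dimension, Hilbert-Kunz multiplicity *)

(* The n such that C contains a strict chain c 0 < c 1 < ... < c n. *)
Definition chain_lengths (T : Type) (C : set (set T)) : set nat :=
  [set n | exists c : nat -> set T,
    (forall i, (i <= n)%N -> C (c i)) /\
    (forall i, (i < n)%N -> c i `<` c i.+1)].

Definition is_submodule (A : comNzRingType) (M : lmodType A) (N : set M) : Prop :=
  [/\ N 0, forall x y, N x -> N y -> N (x + y) & forall a x, N x -> N (a *: x)].

(* supremum takes the default value 0 on unbounded sets: the next two
   definitions are meant for finite length and finite dimension only. *)
Definition module_length (A : comNzRingType) (M : lmodType A) : nat :=
  supremum 0%N (chain_lengths (@is_submodule A M)).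

Definition krull_dim (A : comNzRingType) : nat :=
  supremum 0%N (chain_lengths (@is_prime_ideal A)).

(* The maximal ideal of a local ring A (an arbitrary one in general). *)
Definition max_ideal (A : comNzRingType) : set A := get (@is_maximal_ideal A).

(* m^[p^e] is generated by the following set. *)
Definition frob_gens (p : nat) (A : comNzRingType) (e : nat) : set A :=
  [set a ^+ (p ^ e) | a in @max_ideal A].

Definition HK (p : nat) (A : comNzRingType) (e : nat) : nat :=
  module_length (quot_module (@frob_gens p A e)).

(* For A a Noetherian local ring of prime characteristic p. *)
Definition eHK (K : realType) (p : nat) (A : comNzRingType) : K :=
  limn (fun e => (HK p A e)%:R / p%:R ^+ (e * krull_dim A) : K).

(** * Hypersurfaces *)

Section Hypersurface.
Variables (n : nat) (k : comNzRingType).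

Lemma ps_nonunit (f : powser n k) :
  f (@mnm0 n) = 0 -> ~ ideal_gen [set f] 1.
Proof.
pose I : set (powser n k) := [set g | g (@mnm0 n) = 0].
move=> f0 /(_ I) H; have : I 1.
  apply: H; split=> [|x -> //]; split=> //= [x y x0 y0|a x x0].
    by rewrite /I /= ps_addE x0 y0 addr0.
  by rewrite /I /= ps_mul0E x0 mulr0.
rewrite /I /= [X in X = _]/(ps_const 1 _) /ps_const eqxx.
exact/eqP/oner_neq0.
Qed.

(* k[[x_0, ..., x_(n-1)]] / (f) *)
Definition hypersurface (f : powser n k) (f0 : f (@mnm0 n) = 0) :
  comNzRingType := {ideal_quot (proper_ideal_pred (ps_nonunit f0))}.

End Hypersurface.

Section Equations.
Variables (k : comNzRingType) (d : nat).
Local Notation x := (fun i : nat => ps_var k (inord i : 'I_d.+1)).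

(* The sum of the first m of the products x_0 x_1, x_2 x_3, ... *)
Definition hyperbolic (m : nat) : powser d.+1 k :=
  \sum_(0 <= i < m) x i.*2 * x i.*2.+1.

Definition Qd : powser d.+1 k :=
  if odd d then hyperbolic d.+1./2 else hyperbolic d./2 + x d ^+ 2.

(* In both cases d./2 products: the last one is x_(d-3) x_(d-2) for d odd and
   x_(d-2) x_(d-1) for d even. *)
Definition Pd : powser d.+1 k :=
  if odd d then hyperbolic d./2 + x d.-1 ^+ 2 + x d ^+ 3
  else hyperbolic d./2 + x d ^+ 3.

Lemma x0E i j : (x i ^+ j.+1) (@mnm0 d.+1) = 0.
Proof. by rewrite exprS ps_mul0E ps_var0E mul0r. Qed.

Lemma hyperbolic0E m : hyperbolic m (@mnm0 d.+1) = 0.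
Proof.
elim: m => [|m IH]; first by rewrite /hyperbolic big_geq.
rewrite /hyperbolic big_nat_recr //= ps_addE [X in X + _]IH add0r.
by rewrite ps_mul0E ps_var0E mul0r.
Qed.

Fact Qd0E : Qd (@mnm0 d.+1) = 0.
Proof.
rewrite /Qd; case: ifP => _; first exact: hyperbolic0E.
by rewrite ps_addE hyperbolic0E x0E addr0.
Qed.

Fact Pd0E : Pd (@mnm0 d.+1) = 0.
Proof.
rewrite /Pd; case: ifP => _; last first.
  by rewrite ps_addE hyperbolic0E x0E addr0.
by rewrite !ps_addE hyperbolic0E !x0E !addr0.
Qed.

End Equations.

Definition R2 (d : nat) : comNzRingType := hypersurface (Qd0E 'F_2 d).
Definition S3 (d : nat) : comNzRingType := hypersurface (Pd0E 'F_3 d).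

(* Main.v *)
Require Import Defs.
From HB Require Import structures.
From mathcomp Require Import all_boot all_order all_algebra.
From mathcomp Require Import generic_quotient ring_quotient.
From mathcomp Require Import boolp classical_sets reals topology.
From mathcomp Require Import normedtype sequences.
From mathcomp Require Import -(notations) mpoly.
From mathcomp Require Import zify ring.

(** Since m^[q] is generated by the q-th powers of the variables, HK_e of a
    hypersurface k[[x_0, ..., x_d]]/(f) is, for q = p^e, the dimension of the
    cokernel, hence of the kernel, of multiplication by f on the space k[x_0,
    ..., x_d]/(x_0^q, ..., x_d^q) (HK_ker_dim). The forms at hand are sums of
    monomials in separate variables, so that this operator is built from zero
    by steps of two kinds: (M, T) is replaced by M[z]/(z^q) with T + z^r, or
    by M[x, y]/(x^q, y^q) with T + xy (model_add_power and model_add_product).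
    The numbers dim ker T^j are followed through these steps, by means of
    three facts.

    - Chains. On monomials, z^r and xy act by shifts along disjoint chains,
      and a chain of length c contributes dim ker T^c to the kernel of the
      operator (ker_dim_chains). For T + xy this gives a term for M[z]/(z^q)
      and twice a term for each M[z]/(z^c) with c < q, where T + z acts
      (ker_dim_xytensor).
    - Frobenius. A p^i-th power of T + xy is T^(p^i) + x^(p^i) y^(p^i), an
      operator of the same kind (xytensor_frob).
    - Reflection. If T^Q = 0 for a power Q of p, the kernel of (T + z)^j on
      M[z]/(z^b) and that of (T + z)^(Q - j) on M[z]/(z^(Q - b)) determine the
      dimension of each other (reflection).

    A summand x_d^p yields p chains of length q/p, and Frobenius reduces ker
    T^(q/p) to the case of operators with T^p = 0. There the chains, with
    reflection when p = 3, give linear recursions in the number m of pairs of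
    variables, solved up to a factor by 4^m + 2^m for p = 2 and by 9^m + 4^m
    for p = 3. The square in the odd-dimensional form in characteristic 3
    changes only the last step.

    The odd-dimensional form in characteristic 2 has no such summand. Here the
    number of Jordan blocks of odd size is multiplicative: by reflection and
    the Jordan decomposition, M[z]/(z^c) has as many of them as M if c is odd,
    and none if c is even (odd_blocks_jtensor). The number 2 dim ker T - dim
    ker T^2 of blocks of size one is computed from it (xytensor_ker_dim12).
    Applied to T, T^2, T^4, ... this determines dim ker T by a telescoping sum
    (ker_dim_Q_odd).

    To normalize HK_e, the Krull dimension must be d. It is at most d because
    k[[x_0, ..., x_d]]/(f) is finite over a power series ring in d variables
    (finite_over_powser), and nested primes of a finite extension do not
    become equal when restricted (integral_incomparable). It is at least d
    because f = x_0 x_1 + g with g of order at least two in the other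
    variables: the substitution x_1 = u_0, x_i = u_0 u_(i-1), x_0 = - g / u_0
    kills f, and the coordinate primes of k[[u_0, ..., u_(d-1)]] pull back to
    a chain of length d (hyperbolic_like_chain).

    With m = floor(d/2) the multiplicities are, for d even, 1 + (1/2)^m in
    characteristic 2 and 1 + (3/2) (4/9)^m in characteristic 3, and for d odd
    1 + 1/(2^(m+1) - 1) and 1 + (4/9)^m. So the inequality reads 3 * 8^m < 2 *
    9^m for d even, which holds exactly from m = 4 on, and 2 * 8^m < 9^m + 4^m
    for d odd, which holds exactly from m = 6 on. *)

Set Implicit Arguments.
Unset Strict Implicit.
Unset Printing Implicit Defensive.
Import Order.TTheory GRing.Theory Num.Theory numFieldNormedType.Exports.
Local Open Scope ring_scope.

(** * Endomorphisms and the kernels of their powers *)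

Section Dim.
Variable F : fieldType.

Lemma dimv_bij (V V' : vectType F) (f : 'Hom(V, V')) (U : {vspace V})
    (U' : {vspace V'}) :
  (forall v, v \in U -> f v = 0 -> v = 0) ->
  (forall v, v \in U -> f v \in U') ->
  (forall w, w \in U' -> exists2 v, v \in U & f v = w) -> \dim U = \dim U'.
Proof.
move=> inj into onto; suff -> : U' = (f @: U)%VS.
  rewrite limg_dim_eq //; apply/eqP; rewrite -subv0; apply/subvP => v.
  by rewrite memv_cap memv_ker memv0 => /andP[vU /eqP fv]; apply/eqP/inj.
apply/vspaceP => w; apply/idP/idP => [/onto[v vU <-]|/memv_imgP[v vU ->]].
  exact: memv_img.
exact: into.
Qed.

Lemma linear_hom (V V' : vectType F) (g : V -> V') : linear g ->
  exists f : 'Hom(V, V'), f =1 g.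
Proof.
move=> lg; pose gL := HB.pack_for {linear V -> V'} g
  (GRing.isLinear.Build F _ _ _ g lg).
by exists (linfun gL) => v; rewrite lfunE.
Qed.

Section Prod.
Variables (I : finType) (V : vectType F).

Definition ffdelta (i : I) (v : V) : {ffun I -> V} :=
  [ffun j => if j == i then v else 0].
Fact ffdelta_linear i : linear (ffdelta i).
Proof.
move=> a u v; apply/ffunP => j; rewrite !ffunE.
by case: ifP => _ //; rewrite scaler0 addr0.
Qed.
HB.instance Definition _ i :=
  GRing.isLinear.Build F V {ffun I -> V} _ (ffdelta i) (ffdelta_linear i).

Definition prodv (A : I -> {vspace V}) : {vspace {ffun I -> V}} :=
  (\sum_i linfun (ffdelta i) @: A i)%VS.

Lemma ffun_sum_delta (w : {ffun I -> V}) : w = \sum_i ffdelta i (w i).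
Proof.
apply/ffunP => j; rewrite sum_ffunE (bigD1 j) //= ffunE eqxx big1 ?addr0 //.
by move=> i ne; rewrite ffunE eq_sym (negPf ne).
Qed.

Lemma mem_prodv (A : I -> {vspace V}) (w : {ffun I -> V}) :
  reflect (forall i, w i \in A i) (w \in prodv A).
Proof.
apply: (iffP idP) => [/memv_sumP[us usA ->] i|wA].
  rewrite sum_ffunE; apply: memv_suml => j _.
  have /memv_imgP[v vA ->] := usA j isT.
  by rewrite lfunE ffunE; case: eqP => [->//|_]; exact: mem0v.
rewrite (ffun_sum_delta w); apply: memv_suml => i _.
apply: (subvP (sumv_sup i _ (subvv _))) => //.
by apply/memv_imgP; exists (w i); rewrite ?lfunE.
Qed.

Lemma dim_prodv (A : I -> {vspace V}) : \dim (prodv A) = (\sum_i \dim (A i))%N.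
Proof.
have dx : directv (\sum_i linfun (ffdelta i) @: A i)%VS.
  apply/directv_sum_independent => us usA us0 i _.
  have usE j : us j = ffdelta j (us j j).
    have /memv_imgP[v vA ->] := usA j isT.
    by rewrite lfunE /= ffunE eqxx.
  apply/ffunP => j; rewrite usE !ffunE; case: eqP => // _.
  have := congr1 (fun w : {ffun I -> V} => w i) us0.
  rewrite sum_ffunE (bigD1 i) //= big1 ?addr0 => [->|l ne]; first by rewrite ffunE.
  by rewrite usE ffunE eq_sym (negPf ne).
rewrite (directvP dx); apply: eq_bigr => i _ /=.
rewrite limg_dim_eq //; apply/eqP; rewrite -subv0; apply/subvP => v.
rewrite memv_cap memv_ker memv0 lfunE => /andP[_ /eqP/ffunP/(_ i)].
by rewrite !ffunE eqxx => ->.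
Qed.
End Prod.

End Dim.

Section OpSpace.
Variable F : fieldType.

(** The space is bundled with its endomorphism, so that constructions changing
    both can be iterated. *)
Record opspace := OpSpace { sp : vectType F; op : 'End(sp) }.
Implicit Type M : opspace.

Definition endo_pow (V : vectType F) (t : 'End(V)) j : 'End(V) :=
  iter j (fun u => (t \o u)%VF) \1%VF.

Lemma endo_powE (V : vectType F) (t : 'End(V)) j v : endo_pow t j v = iter j t v.
Proof.
elim: j v => [|j IH] v; first by rewrite lfunE.
by rewrite [LHS]comp_lfunE /= -IH.
Qed.

(** A nilpotent T is determined up to conjugation by these dimensions; all
    constructions are followed through them. *)
Definition ker_dim M j := \dim (lker (endo_pow (op M) j)).
Definition op_dim M := \dim (fullv : {vspace sp M}).

Lemma mem_ker_pow M j v : (v \in lker (endo_pow (op M) j)) = (iter j (op M) v == 0).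
Proof. by rewrite memv_ker endo_powE. Qed.

Definition op_power M r := OpSpace (endo_pow (op M) r).

Lemma op_powerE M r v : op (op_power M r) v = iter r (op M) v.
Proof. exact: endo_powE. Qed.

Lemma iter_op_powerE M r j v : iter j (op (op_power M r)) v = iter (r * j) (op M) v.
Proof.
elim: j => [|j IH]; first by rewrite muln0.
by rewrite iterS IH op_powerE -iterD mulnS.
Qed.

Lemma ker_dim_power M r j : ker_dim (op_power M r) j = ker_dim M (r * j).
Proof.
rewrite /ker_dim (_ : lker _ = lker (endo_pow (op M) (r * j))) //.
by apply/vspaceP => v; rewrite (@mem_ker_pow (op_power M r) j v) (@mem_ker_pow M)
  (@iter_op_powerE M r j v).
Qed.

Definition similar M M' := exists f : 'Hom(sp M, sp M'),
  [/\ injective f, forall w, exists v, f v = w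
    & forall v, f (op M v) = op M' (f v)].

Lemma similar_iter M M' (f : 'Hom(sp M, sp M')) :
  (forall v, f (op M v) = op M' (f v)) ->
  forall j v, f (iter j (op M) v) = iter j (op M') (f v).
Proof. by move=> fE; elim=> [//|j IH] v /=; rewrite fE IH. Qed.

Lemma similar_ker_dim M M' j : similar M M' -> ker_dim M j = ker_dim M' j.
Proof.
move=> [f [inj onto fE]]; apply: (@dimv_bij _ _ _ f).
- by move=> v _ fv; apply: inj; rewrite fv linear0.
- by move=> v; rewrite !mem_ker_pow -similar_iter // => /eqP->; rewrite linear0.
move=> w; have [v <-] := onto w; rewrite mem_ker_pow -similar_iter // => /eqP fv.
by exists v => //; rewrite mem_ker_pow; apply/eqP/inj; rewrite fv linear0.
Qed.

Lemma ker_dim0 M : ker_dim M 0 = 0%N.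
Proof.
apply/eqP; rewrite /ker_dim dimv_eq0 -subv0; apply/subvP => v.
by rewrite mem_ker_pow memv0.
Qed.

Lemma ker_dim_le M j : (ker_dim M j <= op_dim M)%N.
Proof. exact: dimvS (subvf _). Qed.

Lemma ker_dim_nilp M j : (forall v, iter j (op M) v = 0) -> ker_dim M j = op_dim M.
Proof.
move=> M0; rewrite /ker_dim (_ : lker _ = fullv) //.
by apply/vspaceP => v; rewrite mem_ker_pow M0 eqxx memvf.
Qed.

Section Ext.
Variables (I : finType) (prev : I -> option I) (M : opspace).

Definition add_shift_fun (v : {ffun I -> sp M}) : {ffun I -> sp M} :=
  [ffun i => op M (v i) + if prev i is Some j then v j else 0].
Fact add_shift_linear : linear add_shift_fun.
Proof.
move=> a u v; apply/ffunP => i; rewrite !ffunE linearP.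
by case: (prev i) => [j|]; rewrite ?ffunE ?addr0 // scalerDr addrACA.
Qed.
HB.instance Definition _ := GRing.isLinear.Build F {ffun I -> sp M}
  {ffun I -> sp M} _ add_shift_fun add_shift_linear.
(** Copies of M indexed by I, with T acting on each copy plus the map that moves
    copy j to copy i whenever prev i = Some j. With I = {0, ..., c-1} and prev i
    = i - r this is M[z]/(z^c) with T + z^r. *)
Definition add_shift := OpSpace (linfun add_shift_fun).

Lemma add_shiftE v i : op add_shift v i =
  op M (v i) + if prev i is Some j then v j else 0.
Proof. by rewrite lfunE ffunE. Qed.

Lemma op_dim_add_shift : op_dim add_shift = (#|I| * op_dim M)%N.
Proof.
rewrite /op_dim (_ : fullv = prodv (fun _ : I => (fullv : {vspace sp M}))).
  by rewrite dim_prodv sum_nat_const.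
by apply/vspaceP => v; rewrite memvf; apply/esym/mem_prodv => i; rewrite memvf.
Qed.
End Ext.

Lemma similar_add_shift (I : finType) (prev : I -> option I) M M' :
  similar M M' -> similar (add_shift prev M) (add_shift prev M').
Proof.
move=> [f [inj onto fE]].
have [|g gE] := @linear_hom _ {ffun I -> sp M} {ffun I -> sp M'}
    (fun v => [ffun i => f (v i)]).
  by move=> a u v; apply/ffunP => i; rewrite !ffunE linearP.
exists g; split.
- move=> u v; rewrite !gE => /ffunP uv; apply/ffunP => i; apply: inj.
  by have := uv i; rewrite !ffunE.
- move=> w; have [h hE] : exists h : I -> sp M, forall i, f (h i) = w i.
    exists (fun i => (f^-1)%VF (w i)) => i; apply: limg_lfunVK.
    by have [v <-] := onto (w i); rewrite memv_img ?memvf.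
  by exists [ffun i => h i]; rewrite gE; apply/ffunP => i; rewrite !ffunE.
move=> v; rewrite gE; apply/ffunP => i; rewrite ffunE !add_shiftE gE linearD /=.
by rewrite fE ffunE; case: (prev i) => [j|]; rewrite ?ffunE ?linear0.
Qed.

(** The shifts along the two indices commute: this is M[y][z] = M[z][y]. *)
Lemma add_shiftC (I J : finType) (pI : I -> option I) (pJ : J -> option J) M :
  similar (add_shift pI (add_shift pJ M)) (add_shift pJ (add_shift pI M)).
Proof.
have [|g gE] := @linear_hom _ {ffun I -> {ffun J -> sp M}}
    {ffun J -> {ffun I -> sp M}} (fun v => [ffun j => [ffun i => v i j]]).
  by move=> a u v; apply/ffunP => j; apply/ffunP => i; rewrite !ffunE.
exists g; split.
- move=> u v; rewrite !gE => /ffunP uv; apply/ffunP => i; apply/ffunP => j.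
  by have /ffunP/(_ i) := uv j; rewrite !ffunE.
- move=> w; exists [ffun i => [ffun j => w j i]]; rewrite gE.
  by apply/ffunP => i; apply/ffunP => j; rewrite !ffunE.
move=> v; rewrite gE; apply/ffunP => j; apply/ffunP => i.
rewrite !ffunE (@add_shiftE _ pJ (add_shift pI M)) ffunE.
rewrite (@add_shiftE _ pI (add_shift pJ M)) ffunE !add_shiftE gE !ffunE -!addrA;
  congr (_ + _).
by case: (pI i) => [i'|]; case: (pJ j) => [j'|];
  rewrite ?ffunE ?add0r ?addr0 // addrC.
Qed.

Section Chains.
Variables (I : finType) (prev : I -> option I) (M : opspace).
Variables (d h : I -> nat) (e : I -> I) (isend : pred I).
Hypothesis prev_end : forall i j, prev i = Some j ->
  [/\ ~~ isend j, h j = (h i).+1, e j = e i & d i = (d j).+1].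
Hypothesis prev_none : forall i, prev i = None -> d i = 1%N.
Hypothesis next : forall j, ~~ isend j -> exists i, prev i = Some j.
Hypothesis h_end : forall i, isend i -> h i = 0%N /\ e i = i.
Hypothesis e_end : forall i, isend (e i).
Hypothesis d_end : forall i, d (e i) = (d i + h i)%N.

Let u := op M.
Let T := add_shift prev M.

(** Suppose that prev cuts I into chains. A vector killed by T + shift satisfies
    v_(prev i) = - T v_i, so it is determined by its entries at the ends of the
    chains, and such an entry is subject to the single condition that T^c kills
    it, c being the length of the chain. Here d is the position counted from the
    start of the chain, e its end and h the distance to it. *)
Lemma ker_dim_chains : ker_dim T 1 = (\sum_(i | isend i) ker_dim M (d i))%N.
Proof.
(* the kernel of T + shift is compared with the product over the ends of the
   kernels of T^d *)
pose A (i : I) := if isend i then lker (endo_pow u (d i)) else 0%VS.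
have -> : (\sum_(i | isend i) ker_dim M (d i) = \dim (prodv A))%N.
  rewrite dim_prodv big_mkcond; apply: eq_bigr => i _.
  by rewrite /A; case: ifP; rewrite ?dimv0.
pose g (v : {ffun I -> sp M}) : {ffun I -> sp M} :=
  [ffun i => if isend i then v i else 0].
have lg : linear g.
  move=> a x y; apply/ffunP => i; rewrite !ffunE.
  by case: ifP; rewrite ?scaler0 ?addr0.
have [gL gLE] := linear_hom lg.
have kerP (v : {ffun I -> sp M}) : reflect (forall i, u (v i) =
    - (if prev i is Some j then v j else 0)) (v \in lker (endo_pow (op T) 1)).
  rewrite (@mem_ker_pow T) [iter _ _ _]/(op T v).
  apply: (iffP eqP) => [/ffunP v0 i|v0].
    by have := v0 i; rewrite add_shiftE ffunE => /eqP; rewrite addr_eq0 => /eqP.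
  by apply/ffunP => i; rewrite add_shiftE -/u v0 addNr ffunE.
apply: (@dimv_bij _ _ _ gL).
- move=> v /kerP v0; rewrite gLE => /ffunP gv.
  have: forall n i, h i = n -> v i = 0.
    elim=> [|n IH] i hi.
      have: isend i.
        apply/negPn/negP => /next[j /prev_end[_ hj _ _]].
        by rewrite hj in hi.
      by move=> ie; have := gv i; rewrite !ffunE ie.
    have ni : ~~ isend i by apply/negP => /h_end[hi0 _]; rewrite hi0 in hi.
    have [j ji] := next ni; have [_ hj _ _] := prev_end ji.
    have := v0 j; rewrite ji (IH j) ?linear0; last by move: hj; rewrite hi => -[].
    by move/eqP; rewrite eq_sym oppr_eq0 => /eqP.
  by move=> v00; apply/ffunP => i; rewrite (v00 _ i erefl) ffunE.
- move=> v /kerP v0; rewrite gLE; apply/mem_prodv => i.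
  rewrite ffunE /A; case: ifP => _; last exact: mem0v.
  rewrite mem_ker_pow; suff : forall n i, d i = n.+1 -> iter n.+1 u (v i) = 0.
    have [n dn] : exists n, d i = n.+1.
      case pi: (prev i) => [j|]; first by exists (d j); case/prev_end: pi.
      by exists 0%N; apply: prev_none.
    by move=> H; rewrite dn H.
  elim=> [|n IH] {}i di; rewrite iterSr v0.
    case pi: (prev i) => [j|]; last by rewrite oppr0.
    have [_ _ _ dj] := prev_end pi; move: dj; rewrite di => -[dj].
    case pj: (prev j) => [l|]; first by case/prev_end: pj => _ _ _; rewrite -dj.
    by move: dj; rewrite (prev_none pj).
  case pi: (prev i) => [j|].
    have [_ _ _ dj] := prev_end pi.
    have lN x m : iter m u (- x) = - iter m u x.
      by elim: m => [|m IHm] //=; rewrite IHm linearN.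
    by rewrite lN IH ?oppr0 //; move: dj; rewrite di => -[].
  by move: di; rewrite (prev_none pi).
move=> w /mem_prodv wA.
pose nu (x : sp M) := - u x.
have nu0 m : iter m nu 0 = 0 by elim: m => [|m IHm] //=; rewrite IHm /nu linear0 oppr0.
(* a vector is recovered from its ends by v_(prev i) = - T v_i *)
exists [ffun i => iter (h i) nu (w (e i))].
  apply/kerP => i; rewrite ffunE.
  case pi: (prev i) => [j|].
    have [_ hj ej _] := prev_end pi.
    by rewrite ffunE hj ej /= opprK.
  have := wA (e i); rewrite /A e_end mem_ker_pow d_end (prev_none pi) add1n => wi.
  have nuE m x : iter m nu x = (-1) ^+ m *: iter m u x.
    elim: m => [|m IHm]; first by rewrite scale1r.
    by rewrite /= IHm /nu linearZ exprS mulN1r scaleNr.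
  by move/eqP: wi => /= wi; rewrite nuE linearZ /= -/u wi scaler0 oppr0.
rewrite gLE; apply/ffunP => i; rewrite !ffunE; have := wA i; rewrite /A.
case: ifP => [ie _|_]; first by have [-> ->] := h_end ie.
by rewrite memv0 => /eqP.
Qed.
End Chains.

End OpSpace.

(** * Adjoining nilpotent variables *)

Section Shifts.
Variable F : fieldType.
Implicit Type M : opspace F.

Lemma similar_trans M M' M'' : similar M M' -> similar M' M'' -> similar M M''.
Proof.
move=> [f [fi fo fE]] [g [gi go gE]]; exists (g \o f)%VF; split.
- by move=> u v; rewrite !comp_lfunE => /gi /fi.
- move=> w; have [v <-] := go w; have [u <-] := fo v.
  by exists u; rewrite comp_lfunE.
by move=> v; rewrite !comp_lfunE fE gE.
Qed.

Lemma similar_eq (V : vectType F) (t t' : 'End(V)) :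
  t =1 t' -> similar (OpSpace t) (OpSpace t').
Proof.
move=> tt; exists \1%VF; split=> [u v|w|v].
- by rewrite !id_lfunE.
- by exists w; rewrite id_lfunE.
by rewrite !id_lfunE; exact: tt.
Qed.

(** Multiplication by z^r on the monomials 1, z, ..., z^(c-1). *)
Definition prev1 c r (i : 'I_c) : option 'I_c :=
  if (r <= i)%N then insub (i - r)%N else None.

Lemma prev1_some c r (i j : 'I_c) : prev1 r i = Some j <-> (i = j + r :> nat)%N.
Proof.
rewrite /prev1; split.
  case: ifP => // ri; case: insubP => // l _ li [<-].
  by rewrite li subnK.
move=> ij; rewrite ij leq_addl; case: insubP => [l _ li|].
  by congr Some; apply: val_inj; rewrite /= li addnK.
by rewrite addnK ltn_ord.
Qed.

Lemma prev1_none c r (i : 'I_c) : prev1 r i = None <-> (i < r)%N.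
Proof.
rewrite /prev1; split; last by rewrite ltnNge => /negPf->.
case: leqP => // ri; case: insubP => //.
by rewrite (leq_ltn_trans (leq_subr _ _) (ltn_ord i)).
Qed.

(** Multiplication by x^r y^r on the monomials of k[x, y]/(x^q, y^q). *)
Definition prev2 q r (i : 'I_q * 'I_q) : option ('I_q * 'I_q) :=
  if prev1 r i.1 is Some a then
    if prev1 r i.2 is Some b then Some (a, b) else None
  else None.

Lemma prev2_some q r (i j : 'I_q * 'I_q) : prev2 r i = Some j <->
  (i.1 = j.1 + r :> nat)%N /\ (i.2 = j.2 + r :> nat)%N.
Proof.
rewrite /prev2 -!prev1_some; case: (prev1 r i.1) => [a|]; last first.
  by split=> // -[].
case: (prev1 r i.2) => [b|]; last by split=> // -[].
by case: j => x y /=; split=> [[-> ->]|[[->] [->]]].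
Qed.

Lemma prev2_none q r (i : 'I_q * 'I_q) : prev2 r i = None <->
  (minn i.1 i.2 < r)%N.
Proof.
rewrite /prev2 gtn_min; case E1: (prev1 r i.1) => [a|]; last first.
  by move/prev1_none: E1 => ->.
move/prev1_some: E1 => E1; case E2: (prev1 r i.2) => [b|]; last first.
  by move/prev1_none: E2 => ->; rewrite orbT.
by move/prev1_some: E2 => E2; split=> // /orP[]; rewrite ?E1 ?E2; lia.
Qed.

Lemma ker_dim_prev1 c r M : (0 < r)%N ->
  ker_dim (add_shift (@prev1 c r) M) 1 =
  (\sum_(i < c | (c <= i + r)%N) ker_dim M (i %/ r).+1)%N.
Proof.
move=> r0; pose h (i : 'I_c) := ((c.-1 - i) %/ r)%N.
have hlt (i : 'I_c) : (i + r * h i < c)%N.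
  have := leq_trunc_div (c.-1 - i) r; have := ltn_ord i; rewrite /h; lia.
have hge (i : 'I_c) : (c <= i + r * h i + r)%N.
  have := ltn_ceil (c.-1 - i) r0; have := ltn_ord i; rewrite /h mulSn; lia.
have hS (i j : 'I_c) : (i = j + r :> nat)%N -> h j = (h i).+1.
  move=> ij; have := ltn_ord i; rewrite /h ij => ic.
  rewrite (_ : (c.-1 - j = c.-1 - (j + r) + r)%N); last lia.
  by rewrite divnDr // divnn r0 addn1.
apply: (@ker_dim_chains F 'I_c (@prev1 c r) M (fun i => (i %/ r).+1) h
  (fun i => Ordinal (hlt i)) (fun i => c <= i + r)%N).
- move=> i j /prev1_some ij; rewrite -ltnNge; split.
  + by have := ltn_ord i; lia.
  + exact: hS.
  + by apply: val_inj; rewrite /= (hS _ _ ij) ij mulnS; lia.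
  by rewrite ij divnDr // divnn r0 addn1.
- by move=> i /prev1_none ir; rewrite divn_small.
- move=> j; rewrite -ltnNge => jr; exists (Ordinal jr); exact/prev1_some.
- move=> i ic; have h0 : h i = 0%N by rewrite /h divn_small //; lia.
  by split=> //; apply: val_inj; rewrite /= h0; lia.
- by move=> i /=; apply: hge.
by move=> i /=; rewrite addSn addnC mulnC divnMDl // addnC.
Qed.

Lemma ker_dim_prev2 q r M : (0 < r)%N ->
  ker_dim (add_shift (@prev2 q r) M) 1 =
  (\sum_(i : 'I_q * 'I_q | (q <= maxn i.1 i.2 + r)%N)
     ker_dim M (minn i.1 i.2 %/ r).+1)%N.
Proof.
move=> r0; pose h (i : 'I_q * 'I_q) := ((q.-1 - maxn i.1 i.2) %/ r)%N.
have hlt (i : 'I_q * 'I_q) : (maxn i.1 i.2 + r * h i < q)%N.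
  have := leq_trunc_div (q.-1 - maxn i.1 i.2) r.
  by have := ltn_ord i.1; have := ltn_ord i.2; rewrite /h; lia.
have hge (i : 'I_q * 'I_q) : (q <= maxn i.1 i.2 + r * h i + r)%N.
  have := ltn_ceil (q.-1 - maxn i.1 i.2) r0.
  by have := ltn_ord i.1; have := ltn_ord i.2; rewrite /h mulSn; lia.
have hlt1 (i : 'I_q * 'I_q) :
  (i.1 + r * h i < q)%N by apply: leq_ltn_trans (hlt i); lia.
have hlt2 (i : 'I_q * 'I_q) :
  (i.2 + r * h i < q)%N by apply: leq_ltn_trans (hlt i); lia.
have hS (i j : 'I_q * 'I_q) : (i.1 = j.1 + r :> nat)%N /\ (i.2 = j.2 + r :> nat)%N ->
    h j = (h i).+1.
  move=> [e1 e2]; have := ltn_ord i.1; have := ltn_ord i.2.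
  rewrite /h e1 e2 => i1 i2.
  rewrite (_ : q.-1 - maxn j.1 j.2 = q.-1 - maxn (j.1 + r) (j.2 + r) + r)%N;
    last lia.
  by rewrite divnDr // divnn r0 addn1.
apply: (@ker_dim_chains F _ (@prev2 q r) M (fun i => (minn i.1 i.2 %/ r).+1) h
  (fun i => (Ordinal (hlt1 i), Ordinal (hlt2 i)))
  (fun i => q <= maxn i.1 i.2 + r)%N).
- move=> [i1 i2] [j1 j2] /prev2_some ij; have /= [e1 e2] := ij.
  rewrite -ltnNge; split.
  + by have := ltn_ord i1; have := ltn_ord i2; rewrite /=; lia.
  + exact: hS.
  + have hj := hS _ _ ij; move: (hlt1 _) (hlt2 _) (hlt1 _) (hlt2 _).
    rewrite hj /= mulnS => *; congr pair; apply: val_inj => /=; lia.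
  rewrite /= e1 e2 (_ : minn (j1 + r) (j2 + r) = minn j1 j2 + r)%N; last lia.
  by rewrite divnDr // divnn r0 addn1.
- by move=> i /prev2_none ir; rewrite divn_small.
- move=> [j1 j2]; rewrite -ltnNge /= => jr.
  have l1 : (j1 + r < q)%N by lia.
  have l2 : (j2 + r < q)%N by lia.
  by exists (Ordinal l1, Ordinal l2); apply/prev2_some.
- move=> [i1 i2] ic; have h0 : h (i1, i2) = 0%N.
    rewrite /h divn_small //; move: ic => /=.
    by have := ltn_ord i1; have := ltn_ord i2; lia.
  by split=> //; congr pair; apply: val_inj; rewrite /= h0; lia.
- by move=> [i1 i2] /=; have := hge (i1, i2); rewrite /=; lia.
move=> [i1 i2] /=; set hh := h _.
rewrite (_ : minn (i1 + r * hh) (i2 + r * hh) = hh * r + minn i1 i2)%N; last lia.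
by rewrite divnMDl // addSn addnC.
Qed.

(** M[z]/(z^c) with T + z, the tensor product of M with a nilpotent Jordan block
    of size c. *)
Definition jtensor c M := add_shift (@prev1 c 1) M.
(** M[x, y]/(x^q, y^q) with T + x^r y^r. *)
Definition xytensor q r M := add_shift (@prev2 q r) M.

(** There is a single chain, of length c. *)
Lemma ker_dim_jtensor1 c M : ker_dim (jtensor c M) 1 = ker_dim M c.
Proof.
rewrite ker_dim_prev1 //; case: c => [|c]; first by rewrite big_ord0 ker_dim0.
rewrite (bigD1 ord_max) /=; last by rewrite addn1.
rewrite divn1 big1 ?addn0 // => i /andP[ic ne]; case/eqP: ne.
by apply: val_inj => /=; have := ltn_ord i; lia.
Qed.

(** Both sides are the dimension of the kernel of T + y + z on M[y, z]/(y^j,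
    z^c). *)
Lemma ker_dim_jtensorC c j M : ker_dim (jtensor c M) j = ker_dim (jtensor j M) c.
Proof. by rewrite -ker_dim_jtensor1 (similar_ker_dim _ (add_shiftC _ _ _))
  ker_dim_jtensor1. Qed.

Lemma sum_ord_muln q r (f : nat -> nat) : (0 < r)%N ->
  (\sum_(i < q * r) f (i %/ r) = r * \sum_(i < q) f i)%N.
Proof.
move=> r0; elim: q => [|q IH]; first by rewrite mul0n !big_ord0 muln0.
rewrite big_ord_recr mulnDr -IH mulSn addnC big_split_ord /=; congr (_ + _)%N.
rewrite (eq_bigr (fun=> f q)) ?sum_nat_const ?card_ord // => i _.
by rewrite divnMDl // divn_small ?ltn_ord // addn0.
Qed.

(** The diagonals of a square of side q + 1, each listed by its end, the point
    where the larger coordinate is q: one is of full length, and there are two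
    of each smaller length. *)
Lemma sum_ends q (f : nat -> nat) : 
  (\sum_(i < q.+1) \sum_(j < q.+1 | maxn i j == q) f (minn i j)
   = f q + 2 * \sum_(i < q) f i)%N.
Proof.
have rowmax (i : 'I_q.+1) : i = q :> nat ->
    (\sum_(j < q.+1 | maxn i j == q) f (minn i j) = \sum_(j < q.+1) f j)%N.
  move=> iq; rewrite big_mkcond; apply: eq_bigr => j _; rewrite iq.
  by have := ltn_ord j; rewrite ltnS => /minn_idPr->;
    rewrite (maxn_idPl _) ?eqxx // -ltnS ltn_ord.
rewrite big_ord_recr /= (rowmax ord_max) // [X in (_ + X)%N]big_ord_recr /=.
rewrite addnA addnC; congr (_ + _)%N; rewrite mul2n -addnn; congr (_ + _)%N.
apply: eq_bigr => i _; rewrite (bigD1 ord_max) /=; last first.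
  by apply/eqP/maxn_idPr; rewrite ltnW.
rewrite big1 ?addn0 => [|j /andP[/eqP jq ne]]; first by congr f; apply/minn_idPl;
  rewrite ltnW.
case/eqP: ne; apply: val_inj => /=; have := ltn_ord i; lia.
Qed.

(** The residues modulo r of the two exponents split the square of side q r into
    r^2 squares of side q, each of which is cut by x^r y^r into diagonals. *)
Lemma ker_dim_xytensor1 q r M : (0 < q)%N -> (0 < r)%N ->
  ker_dim (xytensor (q * r) r M) 1 =
  (r ^ 2 * (ker_dim M q + 2 * \sum_(c < q) ker_dim M c))%N.
Proof.
case: q => // q _ r0; rewrite ker_dim_prev2 //.
transitivity (\sum_(i < q.+1 * r) \sum_(j < q.+1 * r |
    maxn (i %/ r) (j %/ r) == q) ker_dim M (minn (i %/ r) (j %/ r)).+1)%N.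
  rewrite pair_big_dep /=; apply: eq_big => [[i j]|[i j] _] /=.
    have -> : maxn (i %/ r) (j %/ r) = (maxn i j %/ r)%N.
      case/orP: (leq_total i j) => ij; have := leq_div2r r ij => ijr.
        by rewrite (maxn_idPr ij) (maxn_idPr ijr).
      by rewrite (maxn_idPl ij) (maxn_idPl ijr).
    have mlt : (maxn i j %/ r < q.+1)%N.
      by rewrite ltn_divLR // gtn_max !ltn_ord.
    by rewrite eqn_leq -[X in X && _]ltnS mlt /= leq_divRL //;
      move: (maxn i j) => m; rewrite mulSn addnC leq_add2r.
  congr (ker_dim M _.+1).
  case/orP: (leq_total i j) => ij; have := leq_div2r r ij => ijr.
    by rewrite (minn_idPl ij) (minn_idPl ijr).
  by rewrite (minn_idPr ij) (minn_idPr ijr).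
pose g i j := if maxn i j == q then ker_dim M (minn i j).+1 else 0%N.
transitivity (\sum_(i < q.+1 * r) \sum_(j < q.+1 * r) g (i %/ r) (j %/ r))%N.
  by apply: eq_bigr => i _; rewrite big_mkcond.
under eq_bigr => i _ do rewrite (sum_ord_muln _ (fun j => g (i %/ r)%N j)) //.
rewrite (sum_ord_muln _ (fun i => r * \sum_(j < q.+1) g i j)%N) //.
rewrite -big_distrr /= mulnA mulnn; congr (_ * _)%N.
under eq_bigr => i _ do rewrite -big_mkcond /=.
rewrite (sum_ends q (fun i => ker_dim M i.+1)); congr (_ + 2 * _)%N.
by rewrite [RHS]big_ord_recl ker_dim0.
Qed.

(** A variable z with z^j = 0 turns ker T^j into ker (T + z), and commutes with
    the adjunction of x and y. *)
Lemma ker_dim_xytensor q r M j : (0 < q)%N -> (0 < r)%N ->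
  ker_dim (xytensor (q * r) r M) j =
  (r ^ 2 * (ker_dim (jtensor q M) j + 2 * \sum_(c < q) ker_dim (jtensor c M) j))%N.
Proof.
move=> q0 r0; rewrite -ker_dim_jtensor1 (similar_ker_dim _ (add_shiftC _ _ _))
  ker_dim_xytensor1 //.
rewrite ker_dim_jtensorC; congr (_ * (_ + 2 * _))%N.
by apply: eq_bigr => c _; rewrite ker_dim_jtensorC.
Qed.

Lemma op_dim_jtensor c M : op_dim (jtensor c M) = (c * op_dim M)%N.
Proof. by rewrite op_dim_add_shift card_ord. Qed.

Lemma op_dim_xytensor q r M : op_dim (xytensor q r M) = (q ^ 2 * op_dim M)%N.
Proof. by rewrite op_dim_add_shift card_prod card_ord mulnn. Qed.

End Shifts.

(** * Frobenius powers *)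

Section Frobenius.
Variable F : fieldType.
Implicit Type M : opspace F.

Section Binomial.
Variables (V : vectType F) (f g h : 'End(V)).
Hypothesis fgC : forall v, f (g v) = g (f v).
Hypothesis hE : forall v, h v = f v + g v.

Lemma iter_binomial n v : iter n h v =
  \sum_(i < n.+1) iter (n - i) f (iter i g v) *+ 'C(n, i).
Proof.
elim: n => [|n IH]; first by rewrite big_ord_recl big_ord0 addr0.
rewrite iterS hE {}IH !linear_sum /=.
have gf m x : g (iter m f x) = iter m f (g x).
  by elim: m => [//|m IHm] /=; rewrite -fgC IHm.
rewrite [RHS]big_ord_recl [X in X + _ = _]big_ord_recl /= !bin0 !subn0.
rewrite linearMn -addrA; congr (_ + _).
have E : \sum_(i < n) f (iter (n - bump 0 i) f (iter (bump 0 i) g v) *+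
  'C(n, bump 0 i)) =
    \sum_(i < n.+1) iter (n - i) f (g (iter i g v)) *+ 'C(n, i.+1).
  rewrite big_ord_recr /= bin_small // mulr0n addr0; apply: eq_bigr => i _.
  by rewrite linearMn /= -iterS subnSK //.
rewrite [X in X + _ = _]E -big_split /=; apply: eq_bigr => i _.
by rewrite /bump /= add1n binS subSS mulrnDr linearMn /= gf.
Qed.

(** The inner binomial coefficients are divisible by p. *)
Lemma iter_prime_add p v : p \in [pchar F] ->
  iter p h v = iter p f v + iter p g v.
Proof.
move=> pF; have pp := pcharf_prime pF; rewrite iter_binomial.
case: p pp pF => // p pp pF; rewrite big_ord_recl big_ord_recr /=.
rewrite bin0 mulr1n big1 ?add0r => [|i _].
  by rewrite /bump /= add1n subnn binn mulr1n.
have /dvdnP[m ->] : (p.+1 %| 'C(p.+1, bump 0 i))%N.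
  by apply: prime_dvd_bin => //; rewrite /bump /= add1n ltnS ltn_ord.
by rewrite mulnC mulrnA -(scaler_nat p.+1) (pcharf0 pF) scale0r mul0rn.
Qed.
End Binomial.

Lemma iter_frob_add (V : vectType F) (f g h : 'End(V)) p k v :
  (forall v, f (g v) = g (f v)) -> (forall v, h v = f v + g v) ->
  p \in [pchar F] -> iter (p ^ k) h v = iter (p ^ k) f v + iter (p ^ k) g v.
Proof.
move=> fg hE pF; elim: k v => [|k IH] v; first by rewrite expn0 /= hE.
have E (t : 'End(V)) x : iter (p ^ k.+1) t x = iter p (endo_pow t (p ^ k)) x.
  by rewrite expnS mulnC; apply/esym; exact: (@iter_op_powerE F (OpSpace t)).
rewrite !E; apply: iter_prime_add => // x; last by rewrite !endo_powE IH.
have fgi m y : f (iter m g y) = iter m g (f y).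
  by elim: m => [//|m IHm] /=; rewrite fg IHm.
have fgii m n y : iter m f (iter n g y) = iter n g (iter m f y).
  by elim: m => [//|m IHm] /=; rewrite IHm fgi.
by rewrite !endo_powE fgii.
Qed.

Fixpoint iter_prev (I : Type) (prev : I -> option I) n i : option I :=
  if n is n'.+1 then if prev i is Some j then iter_prev prev n' j else None
  else Some i.

Definition shift_op (I : finType) (prev : I -> option I) (V : vectType F) :=
  op (add_shift prev (OpSpace (0 : 'End(V)))).

Lemma shift_opE (I : finType) (prev : I -> option I) (V : vectType F)
    (v : {ffun I -> V}) i :
  shift_op prev V v i = if prev i is Some j then v j else 0.
Proof. by rewrite /shift_op add_shiftE /= lfunE add0r. Qed.

Lemma iter_shift_op (I : finType) (prev : I -> option I) (V : vectType F) n
    (v : {ffun I -> V}) i :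
  iter n (shift_op prev V) v i = if iter_prev prev n i is Some j then v j else 0.
Proof.
elim: n i => [//|n IH] i; rewrite iterS shift_opE /=.
by case: (prev i) => [j|//]; rewrite IH.
Qed.

(** T and the shift commute. *)
Lemma add_shift_frob (I : finType) (prev : I -> option I) M p k v i :
  p \in [pchar F] -> iter (p ^ k) (op (add_shift prev M)) v i =
  iter (p ^ k) (op M) (v i) + if iter_prev prev (p ^ k) i is Some j then v j else 0.
Proof.
move=> pF; pose L := op (add_shift (fun=> None) M) : 'End({ffun I -> sp M}).
have LE (w : {ffun I -> sp M}) j : L w j = op M (w j) by rewrite add_shiftE addr0.
have iL n (w : {ffun I -> sp M}) j : iter n L w j = iter n (op M) (w j).
  by elim: n => [//|n IH] /=; rewrite LE IH.
rewrite (@iter_frob_add {ffun I -> sp M} L (shift_op prev (sp M)) _ p k v) //.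
- by rewrite ffunE iL iter_shift_op.
- move=> w; apply/ffunP => j; rewrite LE !shift_opE.
  by case: (prev j) => [l|]; rewrite ?LE // linear0.
- by move=> w; apply/ffunP => j; rewrite ffunE add_shiftE LE shift_opE.
Qed.

Lemma option_ext (T : Type) (a b : option T) :
  (forall x, a = Some x <-> b = Some x) -> a = b.
Proof.
case: a => [x|] H; first by apply/esym/H.
by case: b H => // y /(_ y)[_ ->].
Qed.

Lemma iter_prev1 c r n (i : 'I_c) : iter_prev (@prev1 c r) n i = prev1 (r * n) i.
Proof.
elim: n i => [|n IH] i; first by apply/esym/prev1_some; rewrite muln0 addn0.
rewrite /= mulnS; case E: (prev1 r i) => [j|]; last first.
  by move/prev1_none: E => E; apply/esym/prev1_none; lia.
rewrite IH; move/prev1_some: E => E; apply: option_ext => l.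
by rewrite !prev1_some E; split=> [->|]; lia.
Qed.

Lemma iter_prev2 q r n (i : 'I_q * 'I_q) : iter_prev (@prev2 q r) n i = prev2 (r * n) i.
Proof.
elim: n i => [|n IH] [i1 i2]; first by apply/esym/prev2_some; rewrite muln0 !addn0.
rewrite /= mulnS; case E: (prev2 r (i1, i2)) => [[j1 j2]|]; last first.
  by move/prev2_none: E => /= E; apply/esym/prev2_none => /=; lia.
rewrite IH; move/prev2_some: E => /= -[E1 E2]; apply: option_ext => -[l1 l2].
by rewrite !prev2_some /= E1 E2; split=> -[]; lia.
Qed.

Lemma similar_add_shift_frob (I : finType) (prev prev' : I -> option I) M p k :
  p \in [pchar F] -> iter_prev prev (p ^ k) =1 prev' ->
  similar (op_power (add_shift prev M) (p ^ k)) (add_shift prev' (op_power M (p ^ k))).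
Proof.
move=> pF pE; apply: similar_eq => v; apply/ffunP => i.
by rewrite endo_powE add_shift_frob // pE (@add_shiftE _ _ _ (op_power M _)) op_powerE.
Qed.

(** A Frobenius power of T + z^r is an operator of the same kind. *)
Lemma prev1_frob c r M p k : p \in [pchar F] ->
  similar (op_power (add_shift (@prev1 c r) M) (p ^ k))
    (add_shift (@prev1 c (r * p ^ k)) (op_power M (p ^ k))).
Proof. by move=> pF; apply: similar_add_shift_frob => // i; exact: iter_prev1. Qed.

Lemma xytensor_frob q r M p k : p \in [pchar F] ->
  similar (op_power (xytensor q r M) (p ^ k))
    (xytensor q (r * p ^ k) (op_power M (p ^ k))).
Proof. by move=> pF; apply: similar_add_shift_frob => // i; exact: iter_prev2. Qed.

Definition nilp M n := forall v, iter n (op M) v = 0.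

Lemma nilp_le M n m : nilp M n -> (n <= m)%N -> nilp M m.
Proof.
by move=> Mn nm v; rewrite -(subnKC nm) addnC iterD Mn;
  elim: (m - n)%N => //= l ->; rewrite linear0.
Qed.

Lemma nilp_jtensor c M p k : p \in [pchar F] -> (c <= p ^ k)%N ->
  nilp M (p ^ k) -> nilp (jtensor c M) (p ^ k).
Proof.
move=> pF ck Mk v; apply/ffunP => i; rewrite add_shift_frob // Mk iter_prev1 mul1n.
by rewrite (prev1_none _ i).2 ?addr0 ?ffunE //; apply: leq_trans ck.
Qed.

Lemma nilp_xytensor q r M p k : p \in [pchar F] -> (q <= r * p ^ k)%N ->
  nilp M (p ^ k) -> nilp (xytensor q r M) (p ^ k).
Proof.
move=> pF ck Mk v; apply/ffunP => -[i j]; rewrite add_shift_frob // Mk iter_prev2.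
rewrite (prev2_none _ (i, j)).2 ?addr0 ?ffunE //=.
by rewrite gtn_min (leq_trans (ltn_ord i)).
Qed.

(** The hypotheses say that the space is free over k[A]/(A^Q) and over
    k[B]/(B^Q), so that ker A^b is the image of A^(Q-b). Then A^b maps ker A^b +
    ker B^j onto A^b B^(Q-j) V = B^(Q-j) (ker A^(Q-b)), and the rank formula on
    both sides relates the two intersections of kernels. *)
Lemma reflection_commuting (V : vectType F) (A B : 'End(V)) Q N b j :
  (forall v, A (B v) = B (A v)) -> \dim {:V} = (Q * N)%N ->
  (forall v, iter Q A v = 0) -> (forall v, iter Q B v = 0) ->
  (forall i, (i <= Q)%N -> \dim (lker (endo_pow A i)) = (i * N)%N) ->
  (forall i, (i <= Q)%N -> \dim (lker (endo_pow B i)) = (i * N)%N) ->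
  (b <= Q)%N -> (j <= Q)%N ->
  (\dim (lker (endo_pow A b) :&: lker (endo_pow B j)) + Q * N =
   b * N + j * N + \dim (lker (endo_pow A (Q - b)) :&: lker (endo_pow B (Q - j))))%N.
Proof.
move=> AB dV A0 B0 dA dB bQ jQ.
have ker_im (T : 'End(V)) i : (forall v, iter Q T v = 0) ->
    (forall i, (i <= Q)%N -> \dim (lker (endo_pow T i)) = (i * N)%N) ->
    (i <= Q)%N -> lker (endo_pow T i) = limg (endo_pow T (Q - i)).
  move=> T0 dT iQ; apply/esym/eqP; rewrite eqEdim; apply/andP; split.
    apply/subvP => v /memv_imgP[w _ ->].
    by rewrite memv_ker !endo_powE -iterD subnKC // T0.
  have := limg_ker_dim (endo_pow T (Q - i)) fullv.
  rewrite capfv dV dT ?leq_subr // dT // => E.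
  have : ((Q - i) * N + i * N = Q * N)%N by rewrite -mulnDl subnK.
  by lia.
have kA := ker_im A b A0 dA bQ.
have ABi m n v : iter m A (iter n B v) = iter n B (iter m A v).
  have ABn x : A (iter n B x) = iter n B (A x).
    by elim: n => [//|n IH] /=; rewrite AB IH.
  by elim: m => [//|m IH] /=; rewrite IH ABn.
set K := lker (endo_pow A b); set L := lker (endo_pow B j).
set K' := lker (endo_pow A (Q - b)); set L' := lker (endo_pow B (Q - j)).
have sum := dimv_sum_cap K L.
have := limg_ker_dim (endo_pow A b) (K + L).
rewrite (capv_idPr _) ?addvSl //.
have -> : (endo_pow A b @: (K + L) = endo_pow B (Q - j) @: K')%VS.
  rewrite limgD; have -> : (endo_pow A b @: K = 0)%VS.
    by apply/eqP; rewrite -subv0; apply/subvP => v /memv_imgP[w];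
      rewrite memv_ker memv0 => wK ->.
  rewrite add0v /L /K' (ker_im B j B0 dB jQ) (ker_im A (Q - b)%N A0 dA) ?leq_subr //.
  rewrite subKn // -!limg_comp; congr lfun_img; apply/lfunP => v.
  by rewrite !comp_lfunE !endo_powE ABi.
have dK : \dim K = (b * N)%N := dA b bQ.
have dL : \dim L = (j * N)%N := dB j jQ.
have dK' : \dim K' = ((Q - b) * N)%N := dA _ (leq_subr b Q).
have E2 : (\dim (K' :&: L') + \dim (endo_pow B (Q - j) @: K') = \dim K')%N.
  exact: limg_ker_dim.
move=> E1; move: E1 E2 sum; rewrite dK dK' dL.
have : ((Q - b) * N + b * N = Q * N)%N by rewrite -mulnDl subnK.
move: (\dim _) (\dim _) (\dim _) (\dim _) ((Q - b) * N)%N (b * N)%N (j * N)%N (Q * N)%N.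
by move=> *; lia.
Qed.

End Frobenius.

(** * Reflection *)

Section Reflection.
Variable F : fieldType.
Implicit Type M : opspace F.

(** Entries out of range are read as 0, so that indices can be computed in nat.
    *)
Definition entry (V : zmodType) c (v : {ffun 'I_c -> V}) (n : nat) : V :=
  if insub n is Some j then v j else 0.

Lemma entry_ord (V : zmodType) c (v : {ffun 'I_c -> V}) (i : 'I_c) : entry v i = v i.
Proof. by rewrite /entry valK. Qed.

Lemma entry_out (V : zmodType) c (v : {ffun 'I_c -> V}) n : (c <= n)%N -> entry v n = 0.
Proof. by rewrite /entry => cn; case: insubP => // i; rewrite ltnNge cn. Qed.

Lemma entry_ffun (V : zmodType) c (f : nat -> V) n :
  entry [ffun i : 'I_c => f i] n = if (n < c)%N then f n else 0.
Proof.
rewrite /entry; case: insubP => [i -> ni|/negPf->//].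
by rewrite ffunE -ni.
Qed.

Lemma prev1_entry (V : zmodType) c r (v : {ffun 'I_c -> V}) (i : 'I_c) :
  (if prev1 r i is Some j then v j else 0) = if (r <= i)%N then entry v (i - r) else 0.
Proof. by rewrite /prev1; case: ifP. Qed.

Lemma jtensorE c M (v : sp (jtensor c M)) (i : 'I_c) : op (jtensor c M) v i =
  op M (v i) + if (1 <= i)%N then entry v (i - 1) else 0.
Proof. by rewrite add_shiftE prev1_entry. Qed.

Lemma entry_jtensor c M (v : sp (jtensor c M)) n : entry (op (jtensor c M) v) n =
  if (n < c)%N then op M (entry v n) + if (1 <= n)%N then entry v (n - 1) else 0 else 0.
Proof.
case: ltnP => nc; last by rewrite entry_out.
by rewrite (entry_ord _ (Ordinal nc)) jtensorE -(entry_ord _ (Ordinal nc)).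
Qed.

Definition zshift Q M := shift_op (@prev1 Q 1) (sp M).

Lemma iter_zshift Q M b (v : {ffun 'I_Q -> sp M}) (i : 'I_Q) :
  iter b (zshift Q M) v i = if (b <= i)%N then entry v (i - b) else 0.
Proof. by rewrite iter_shift_op iter_prev1 mul1n prev1_entry. Qed.

(** Multiplication by z^(Q-b) identifies M[z]/(z^b) with the kernel of z^b on
    M[z]/(z^Q), and it commutes with T + z. *)
Lemma ker_dim_jtensor_cap Q b j M : (b <= Q)%N ->
  ker_dim (jtensor b M) j =
  \dim (lker (endo_pow (zshift Q M) b) :&: lker (endo_pow (op (jtensor Q M)) j)).
Proof.
move=> bQ; have [|f fE] := @linear_hom _ {ffun 'I_b -> sp M} {ffun 'I_Q -> sp M}
    (fun v => [ffun i : 'I_Q => if (Q - b <= i)%N then entry v (i - (Q - b)) else 0]).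
  move=> a u v; apply/ffunP => i; rewrite !ffunE; case: ifP => _.
    by rewrite /entry; case: insubP => [l _ _|_]; rewrite ?ffunE ?scaler0 ?addr0.
  by rewrite scaler0 addr0.
have facc (v : sp (jtensor b M)) n : entry (f v) n =
    if (n < Q)%N then if (Q - b <= n)%N then entry v (n - (Q - b)) else 0 else 0.
  by rewrite fE (@entry_ffun (sp M) Q
    (fun i => if (Q - b <= i)%N then entry v (i - (Q - b)) else 0)).
have fB (v : sp (jtensor b M)) : f (op (jtensor b M) v) = op (jtensor Q M) (f v).
  apply/ffunP => i; rewrite jtensorE facc !fE !ffunE; have iQ := ltn_ord i.
  rewrite entry_jtensor.
  case: (leqP (Q - b) i) => ib; last first.
    rewrite linear0 add0r; case: ifP => // i1.
    by rewrite (_ : (Q - b <= i - 1)%N = false) ?if_same //; lia.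
  rewrite (_ : (i - (Q - b) < b)%N = true); last lia.
  congr (_ + _); case: (leqP 1 (i - (Q - b))) => i1.
    rewrite (_ : (1 <= i)%N = true); last lia.
    rewrite (_ : (i - 1 < Q)%N = true); last lia.
    rewrite (_ : (Q - b <= i - 1)%N = true); last lia.
    by congr entry; lia.
  case: (leqP 1 i) => // i0.
  by rewrite (_ : (Q - b <= i - 1)%N = false) ?if_same //; lia.
have fBi : forall n (v : sp (jtensor b M)), f (iter n (op (jtensor b M)) v) =
  iter n (op (jtensor Q M)) (f v).
  by elim=> [//|n IH] v /=; rewrite fB IH.
have finj (v : sp (jtensor b M)) : f v = 0 -> v = 0.
  rewrite fE => /ffunP v0; apply/ffunP => i.
  have iQ : (i + (Q - b) < Q)%N by have := ltn_ord i; lia.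
  have := v0 (Ordinal iQ); rewrite !ffunE /= leq_addl addnK entry_ord.
  by [].
apply: (dimv_bij (f := f)).
- by move=> v _; apply: finj.
- move=> v; rewrite memv_cap !memv_ker !endo_powE => /eqP v0.
  rewrite -(fBi j v) v0 linear0 eqxx andbT; apply/eqP/ffunP => i.
  rewrite iter_zshift facc [RHS]ffunE; case: ifP => // bi.
  case: ifP => // _; rewrite (_ : (Q - b <= i - b)%N = false) //.
  by have := ltn_ord i; lia.
move=> w; rewrite memv_cap !memv_ker !endo_powE => /andP[/eqP/ffunP w0 /eqP wj].
pose v : sp (jtensor b M) := [ffun i : 'I_b => entry w (i + (Q - b))%N].
have fv : f v = w.
  rewrite fE; apply/ffunP => i; rewrite ffunE /v.
  rewrite (@entry_ffun (sp M) b (fun i => entry w (i + (Q - b))%N));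
    have iQ := ltn_ord i.
  case: ifP => ib.
    rewrite (_ : (i - (Q - b) < b)%N = true); last lia.
    by rewrite subnK // entry_ord.
  have ibQ : (i + b < Q)%N by lia.
  have := w0 (Ordinal ibQ); rewrite iter_zshift /= leq_addl addnK entry_ord ffunE.
  by [].
exists v => //; rewrite memv_ker endo_powE; apply/eqP/finj.
by rewrite fBi fv.
Qed.

(** On M[z]/(z^Q) both z and T + z have Q-th power 0, and the kernels of their
    powers have the dimensions of a free module; the kernels in the statement
    are intersections of kernels of powers of z and T + z. *)
Lemma reflection p k M b j : p \in [pchar F] -> nilp M (p ^ k) ->
  (b <= p ^ k)%N -> (j <= p ^ k)%N ->
  (ker_dim (jtensor b M) j + p ^ k * op_dim M =
   b * op_dim M + j * op_dim M + ker_dim (jtensor (p ^ k - b) M) (p ^ k - j))%N.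
Proof.
move=> pF Mk bQ jQ; set Q := (p ^ k)%N.
have nQ c : (c <= Q)%N -> ker_dim (jtensor c M) Q = (c * op_dim M)%N.
  by move=> cQ; rewrite ker_dim_nilp ?op_dim_jtensor //; apply: nilp_jtensor.
have z0 v : iter Q (zshift Q M) v = 0.
  apply/ffunP => i; rewrite iter_zshift ffunE.
  by case: leqP => // /(leq_ltn_trans)/(_ (ltn_ord i)); rewrite ltnn.
have B0 v : iter Q (op (jtensor Q M)) v = 0 by apply: nilp_jtensor.
rewrite !(ker_dim_jtensor_cap (Q := Q)) ?leq_subr //.
apply: reflection_commuting => //.
- have BE (v : {ffun 'I_Q -> sp M}) i := @add_shiftE F 'I_Q (@prev1 Q 1) M v i.
  move=> v; apply/ffunP => i; rewrite BE /zshift !shift_opE.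
  case: (prev1 1 i) => [l|]; last by rewrite linear0 addr0.
  by rewrite BE shift_opE.
- by rewrite -[LHS]/(op_dim (jtensor Q M)) op_dim_jtensor.
- move=> i iQ; rewrite -nQ // (ker_dim_jtensor_cap (Q := Q)) //.
  rewrite (_ : lker (endo_pow (op (jtensor Q M)) Q) = fullv) ?capvf //.
  by apply/vspaceP => v; rewrite memv_ker endo_powE B0 eqxx memvf.
move=> i iQ; rewrite -nQ // -ker_dim_jtensorC (ker_dim_jtensor_cap (Q := Q)) //.
rewrite (_ : lker (endo_pow (zshift Q M) Q) = fullv) ?capfv //.
by apply/vspaceP => v; rewrite memv_ker endo_powE z0 eqxx memvf.
Qed.

(** The difference of consecutive dimensions counts the Jordan blocks of size
    greater than i. So if T^Q = 0, a block of size s contributes an alternating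
    sum of s signs, which is 1 for s odd and 0 for s even. *)
Definition odd_blocks Q M : int :=
  \sum_(i < Q) (-1) ^+ i * ((ker_dim M i.+1)%:Z - (ker_dim M i)%:Z).

Lemma similar_odd_blocks Q M M' : similar M M' -> odd_blocks Q M = odd_blocks Q M'.
Proof. by move=> s; apply: eq_bigr => i _; rewrite !(similar_ker_dim _ s). Qed.

Lemma odd_blocks_stable Q Q' M : nilp M Q -> (Q <= Q')%N -> odd_blocks Q' M =
  odd_blocks Q M.
Proof.
move=> MQ QQ; rewrite /odd_blocks -(subnKC QQ) big_split_ord /= [X in _ + X]big1
  ?addr0 //.
move=> i _; rewrite !ker_dim_nilp ?subrr ?mulr0 //; apply: (nilp_le MQ); lia.
Qed.

(** As Q is even, reading the alternating sum backwards changes its signs, and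
    so does reflection, which exchanges the two ends of a difference. *)
Lemma odd_blocks_reflection k M b : 2 \in [pchar F] -> (0 < k)%N -> nilp M (2 ^ k) ->
  (b <= 2 ^ k)%N -> odd_blocks (2 ^ k) (jtensor (2 ^ k - b) M) =
    odd_blocks (2 ^ k) (jtensor b M).
Proof.
move=> pF k0 Mk bQ; rewrite /odd_blocks [RHS](reindex_inj rev_ord_inj) /=.
have Qe : odd (2 ^ k) = false by rewrite oddX; case: k k0 {Mk bQ}.
have s0 : \sum_(i < 2 ^ k) (-1) ^+ i * (op_dim M)%:Z = 0 :> int.
  rewrite -mulr_suml; case: k k0 {Mk bQ Qe} => // k _.
  rewrite expnS mul2n -addnn; elim: (2 ^ k)%N => [|n IH];
    first by rewrite big_ord0 mul0r.
  rewrite addSn addnS; do 2! rewrite big_ord_recr /=.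
  by rewrite -addrA mulrDl IH add0r exprS mulN1r addrN mul0r.
(* reflection adds dim M to each difference, which cancels in the alternating
   sum s0, Q being even *)
rewrite -[LHS]subr0 -[X in _ - X]s0 -sumrB; apply: eq_bigr => i _.
have iQ := ltn_ord i.
have r1 := @reflection 2 k M b (2 ^ k - i.+1) pF Mk bQ (leq_subr _ _).
have r2 := @reflection 2 k M b (2 ^ k - i) pF Mk bQ (leq_subr _ _).
rewrite !subKn // ?(ltnW iQ) // in r1 r2.
have -> : (-1) ^+ (2 ^ k - i.+1) = - (-1) ^+ i :> int.
  rewrite -signr_odd oddB // Qe /= -[RHS]mulN1r -exprS -[RHS]signr_odd.
  by [].
rewrite subnSK // mulNr -mulrN -!mulrBr; congr (_ * _).
have e3 : ((2 ^ k - i) * op_dim M = op_dim M + (2 ^ k - i.+1) * op_dim M)%N.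
  by rewrite -mulSn subnSK.
by lia.
Qed.

End Reflection.

(** * Jordan blocks of odd size *)

Section Jordan.
Variable F : fieldType.
Implicit Type M : opspace F.

Section Sum.
Variables M M' : opspace F.
Definition op_sum_fun (x : sp M * sp M') : sp M * sp M' := (op M x.1, op M' x.2).
Fact op_sum_linear : linear op_sum_fun.
Proof. by move=> a [u u'] [v v']; rewrite /op_sum_fun /= !linearP. Qed.
HB.instance Definition _ := GRing.isLinear.Build F (sp M * sp M')%type
  (sp M * sp M')%type _ op_sum_fun op_sum_linear.
Definition op_sum := OpSpace (linfun op_sum_fun).

Lemma op_sumE x : op op_sum x = (op M x.1, op M' x.2).
Proof. by rewrite lfunE. Qed.

Lemma iter_op_sum j x : iter j (op op_sum) x = (iter j (op M) x.1, iter j (op M') x.2).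
Proof. by elim: j => [|j IH]; [case: x|rewrite /= IH op_sumE]. Qed.

Lemma ker_dim_op_sum j : ker_dim op_sum j = (ker_dim M j + ker_dim M' j)%N.
Proof.
have [|f fE] := @linear_hom _ (sp M * sp M')%type (sp M) (fun x => x.1).
  by move=> a [u u'] [v v'].
have [|g gE] := @linear_hom _ (sp M * sp M')%type (sp M') (fun x => x.2).
  by move=> a [u u'] [v v'].
have kO x : (x \in lker (endo_pow (op op_sum) j)) =
    ((iter j (op M) x.1, iter j (op M') x.2) == 0).
  by rewrite (@mem_ker_pow F op_sum) iter_op_sum.
rewrite /ker_dim -(limg_ker_dim f) addnC; congr (_ + _)%N.
  rewrite (_ : lker (endo_pow (op M) j) = f @: lker (endo_pow (op op_sum) j))%VS //.
  apply/vspaceP => v; apply/idP/memv_imgP => [|[[x y]]].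
    rewrite (@mem_ker_pow F M) => /eqP v0; exists (v, 0); rewrite ?fE //.
    rewrite kO /= v0; apply/eqP; congr pair.
    by elim: (j) => //= n ->; rewrite linear0.
  by rewrite kO fE => /eqP[x0 _] ->; rewrite (@mem_ker_pow F M) x0.
apply: (dimv_bij (f := g)).
- by move=> [x y]; rewrite memv_cap memv_ker fE gE /= => /andP[_ /eqP->] ->.
- move=> [x y]; rewrite memv_cap kO gE => /andP[/eqP[_ y0] _].
  by rewrite (@mem_ker_pow F M') y0.
move=> w; rewrite (@mem_ker_pow F M') => /eqP w0; exists (0, w); rewrite ?gE //.
rewrite memv_cap memv_ker fE eqxx andbT kO /= w0.
by apply/eqP; congr pair; elim: (j) => //= n ->; rewrite linear0.
Qed.
End Sum.

Lemma add_shift_op_sum (I : finType) (prev : I -> option I) M M' :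
  similar (add_shift prev (op_sum M M'))
    (op_sum (add_shift prev M) (add_shift prev M')).
Proof.
have [|f fE] := @linear_hom _ {ffun I -> (sp M * sp M')%type}
   ({ffun I -> sp M} * {ffun I -> sp M'})%type
   (fun v => ([ffun i => (v i).1], [ffun i => (v i).2])).
  by move=> a u v; congr pair; apply/ffunP => i; rewrite !ffunE.
exists f; split.
- move=> u v; rewrite !fE => -[/ffunP E1 /ffunP E2]; apply/ffunP => i.
  have := E1 i; have := E2 i; rewrite !ffunE.
  by case: (u i) (v i) => [x y] [x' y'] /= -> ->.
- move=> [u v]; exists [ffun i => (u i, v i)]; rewrite fE; congr pair;
  by apply/ffunP => i; rewrite !ffunE.
move=> v; rewrite op_sumE !fE.
have E i := @add_shiftE F I prev (op_sum M M') v i.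
congr pair; apply/ffunP => i; rewrite ffunE E op_sumE add_shiftE /= ffunE;
  by case: (prev i) => [j|]; rewrite ?ffunE.
Qed.

Lemma odd_blocks_op_sum Q M M' : odd_blocks Q (op_sum M M') = odd_blocks Q M +
  odd_blocks Q M'.
Proof.
rewrite /odd_blocks -big_split /=; apply: eq_bigr => i _.
by rewrite -mulrDr !ker_dim_op_sum; congr (_ * _); lia.
Qed.

Definition zero_line : opspace F := OpSpace (0 : 'End(F^o)).
Definition jordan_block a := jtensor a zero_line.

Lemma op_dim_zero_line : op_dim zero_line = 1%N.
Proof. by rewrite /op_dim dimvf /dim /=. Qed.

Lemma ker_dim_zero_line j : ker_dim zero_line j = (0 < j)%N.
Proof.
case: j => [|j]; first exact: ker_dim0.
by rewrite ker_dim_nilp ?op_dim_zero_line // => v; rewrite /= lfunE.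
Qed.

Lemma nilp_zero_line n : (0 < n)%N -> nilp zero_line n.
Proof. by case: n => // n _ v; rewrite /= lfunE. Qed.

(** This is the restriction of T when T maps C to itself; the projection makes
    it total. *)
Definition op_restr M (C : {vspace sp M}) : opspace F :=
  OpSpace (linfun (vsproj C) \o (op M \o linfun (vsval : subvs_of C -> sp M)))%VF.

Lemma op_restrE M (C : {vspace sp M}) (c : subvs_of C) :
  (forall v, v \in C -> op M v \in C) -> vsval (op (op_restr C) c) = op M (vsval c).
Proof. by move=> CT; rewrite /= !comp_lfunE !lfunE /= vsprojK // CT // subvsP. Qed.

Lemma ker_dim_mono M i j : (i <= j)%N -> (ker_dim M i <= ker_dim M j)%N.
Proof.
move=> ij; apply: dimvS; apply/subvP => v; rewrite !mem_ker_pow => /eqP v0.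
rewrite -(subnK ij) iterD v0; apply/eqP.
by elim: (j - i)%N => //= n ->; rewrite linear0.
Qed.

Lemma ker_dim_jordan_block_gt0 a n : (0 < ker_dim (jordan_block a.+1) n.+1)%N.
Proof. by apply: leq_trans (ker_dim_mono _ (ltn0Sn n));
  rewrite ker_dim_jtensor1 ker_dim_zero_line. Qed.

(** Choose v with T^a v nonzero and T^(a+1) = 0, and a linear form l that does
    not vanish at T^a v. The vectors T^i v span a block of size a + 1, and the
    common kernel of the forms l T^i is an invariant complement. *)
Lemma jordan_split M n : nilp M n -> (0 < op_dim M)%N ->
  exists a (C : opspace F), [/\ (a < n)%N, (op_dim C < op_dim M)%N, nilp C n
    & similar (op_sum (jordan_block a.+1) C) M].
Proof.
move=> Mn dM; pose t := op M.
have [a [v [an va Ma]]] : exists a v, [/\ (a < n)%N, iter a t v != 0 & nilp M a.+1].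
  elim: n Mn => [|n IH] Mn.
    move: dM; rewrite /op_dim lt0n dimv_eq0 -subv0 => /subvPn[v _].
    by rewrite memv0; have /= -> := Mn v; rewrite eqxx.
  case: (boolP (fullv <= lker (endo_pow t n))%VS) => [/subvP full|/subvPn[v _]].
    have [|a [v [an va Ma]]] := IH.
      by move=> v; apply/eqP; rewrite -mem_ker_pow full ?memvf.
    by exists a, v; split=> //; apply: ltnW.
  by rewrite mem_ker_pow => vn; exists n, v.
have [l lv] : exists l : 'Hom(sp M, F^o), l (iter a t v) != 0.
  set w := iter a t v in va *.
  case: (pickP (fun i => coord (vbasis fullv) i w != 0)) => [i ci|c0].
    have [|l lE] := @linear_hom _ (sp M) F^o (coord (vbasis fullv) i).
      by move=> c x y; rewrite linearP.
    by exists l; rewrite lE.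
  case/eqP: va; rewrite (coord_vbasis (memvf w)) big1 // => i _.
  by have /negbFE/eqP-> := c0 i; rewrite scale0r.
(* L maps M to the block, and s maps the block to the span of the T^i v; both
   commute with the operators, and L s is injective *)
have [|L LE] := @linear_hom _ (sp M) {ffun 'I_a.+1 -> F^o}
    (fun w => [ffun i : 'I_a.+1 => l (iter (a - i) t w)]).
  move=> c x y; apply/ffunP => i; rewrite !ffunE -!(endo_powE t) !linearP.
  by [].
have [|s sE] := @linear_hom _ {ffun 'I_a.+1 -> F^o} (sp M)
    (fun u => \sum_i u i *: iter i t v).
  move=> c x y; rewrite scaler_sumr -big_split /=; apply: eq_bigr => i _.
  by rewrite !ffunE scalerA -scalerDl.
have delE (u : {ffun 'I_a.+1 -> F^o}) (i : 'I_a.+1) :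
    op (jordan_block a.+1) u i = if (1 <= i)%N then entry u (i - 1) else 0.
  by rewrite jtensorE /= lfunE add0r.
have Lt w : L (t w) = op (jordan_block a.+1) (L w).
  apply/ffunP => i; rewrite delE !LE ffunE.
  rewrite (@entry_ffun F^o a.+1 (fun i => l (iter (a - i) t w))) -iterSr.
  have ia := ltn_ord i; case: (leqP 1 i) => i1.
    rewrite (_ : (i - 1 < a.+1)%N = true); last lia.
    by rewrite (_ : (a - (i - 1) = (a - i).+1)%N) //; lia.
  have i0 : i = 0%N :> nat by lia.
  by rewrite i0 subn0 Ma linear0.
have st u : s (op (jordan_block a.+1) u) = t (s u).
  rewrite !sE linear_sum big_ord_recl delE /= scale0r add0r.
  rewrite [RHS]big_ord_recr /= [X in _ = _ + X]linearZ /= -/t.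
  rewrite -[t (iter a t v)]/(iter a.+1 t v) Ma scaler0 addr0.
  apply: eq_bigr => i _; rewrite linearZ /= delE /= /bump /= add1n subn1 /=.
  by congr (_ *: _); rewrite -(entry_ord u (widen_ord _ i)).
have Ls_inj u : L (s u) = 0 -> u = 0.
  move=> /ffunP Lu.
  suff H : forall m (i : 'I_a.+1), (i < m)%N -> u i = 0.
    by apply/ffunP => i; rewrite (H i.+1) ?ffunE.
  elim=> [//|m IH] i; rewrite ltnS => im.
  have := Lu i; rewrite LE !ffunE sE -(endo_powE t) linear_sum linear_sum
    (bigD1 i) //= big1.
    rewrite addr0 !linearZ /= endo_powE -iterD subnK -1?ltnS ?ltn_ord // => /eqP.
    by rewrite scaler_eq0 (negPf lv) orbF => /eqP.
  move=> j ji; rewrite !linearZ /= endo_powE -iterD.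
  case: (ltngtP i j) => ij.
  - suff -> : iter (a - i + j) t v = 0 by rewrite linear0 scaler0.
    by apply: (nilp_le Ma); have := ltn_ord i; lia.
  - by rewrite IH ?scale0r // (leq_trans ij).
  by case/eqP: ji; apply: val_inj.
pose C := lker L; pose Co := op_restr C.
have CT w : w \in C -> t w \in C.
  by rewrite !memv_ker Lt => /eqP->; rewrite linear0.
have [|f fE] := @linear_hom _ ({ffun 'I_a.+1 -> F^o} * subvs_of C)%type (sp M)
    (fun x => s x.1 + vsval x.2).
  by move=> c [x x'] [y y'] /=; rewrite !linearP /= scalerDr addrACA.
have fsim : similar (op_sum (jordan_block a.+1) Co) M.
  exists f; split.
  - suff f0 x : f x = 0 -> x = 0.
      by move=> x y xy; apply/eqP; rewrite -subr_eq0; apply/eqP/f0;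
        rewrite linearB /= xy subrr.
    case: x => u c; rewrite fE /= => E.
    have u0 : u = 0.
      apply: Ls_inj; have : L (s u + vsval c) = 0 by rewrite E linear0.
      by rewrite linearD /= (_ : L (vsval c) = 0) ?addr0 //; apply/eqP;
        rewrite -memv_ker subvsP.
    by move: E; rewrite u0 linear0 add0r => c0; congr pair; apply: val_inj.
  - move=> w.
    have iLs : lker (L \o s)%VF == 0%VS.
      apply/lker0P => x y; rewrite !comp_lfunE => xy; apply/eqP;
        rewrite -subr_eq0; apply/eqP/Ls_inj.
      by rewrite !linearB /= xy subrr.
    have [u uw] : exists u, L (s u) = L w.
      exists ((L \o s)^-1%VF (L w)); rewrite -comp_lfunE limg_lfunVK //.
      by rewrite lker0_limgf ?memvf.
    have wC : w - s u \in C by rewrite memv_ker linearB /= uw subrr.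
    by exists (u, vsproj C (w - s u)); rewrite fE /= vsprojK // addrC subrK.
  move=> [u c]; rewrite op_sumE !fE /= linearD /= -st; congr (_ + _).
  by rewrite -/(op Co) op_restrE.
have Cn : nilp Co n.
  have iC m (c : subvs_of C) : vsval (iter m (op Co) c) = iter m t (vsval c).
    by elim: m => [//|m IH]; rewrite !iterS -IH op_restrE.
  by move=> c; apply: val_inj; rewrite [LHS]iC Mn linear0.
exists a, Co; split=> //; rewrite -(ker_dim_nilp Mn) -(similar_ker_dim _ fsim).
rewrite ker_dim_op_sum [ker_dim Co n]ker_dim_nilp // -[X in (X < _)%N]add0n ltn_add2r.
by case: (n) an => // n' _; apply: ker_dim_jordan_block_gt0.
Qed.

Lemma odd_blocks_jtensorC Q a c M : odd_blocks Q (jtensor a (jtensor c M)) =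
  odd_blocks Q (jtensor c (jtensor a M)).
Proof. by apply: similar_odd_blocks; apply: add_shiftC. Qed.

Lemma odd_blocks_jtensor0 Q M : odd_blocks Q (jtensor 0 M) = 0.
Proof.
have kd00 j : ker_dim (jtensor 0 M) j = 0%N.
  by apply/eqP; rewrite -leqn0 (leq_trans (ker_dim_le _ _)) // op_dim_jtensor mul0n.
by rewrite /odd_blocks big1 // => i _; rewrite !kd00 subrr mulr0.
Qed.

Lemma odd_blocks_jtensor1 Q M : odd_blocks Q (jtensor 1 M) = odd_blocks Q M.
Proof. by apply: eq_bigr => i _; rewrite !(ker_dim_jtensorC 1) !ker_dim_jtensor1. Qed.

Lemma odd_blocks_zero_line Q : odd_blocks Q.+1 zero_line = 1.
Proof.
rewrite /odd_blocks big_ord_recl big1 ?addr0 => [|i _].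
  by rewrite expr0 mul1r !ker_dim_zero_line subr0.
by rewrite !ker_dim_zero_line subrr mulr0.
Qed.

Lemma nilp_jordan_block a p k : p \in [pchar F] -> (a <= p ^ k)%N ->
  nilp (jordan_block a) (p ^ k).
Proof.
move=> pF ak; apply: nilp_jtensor => //; apply: nilp_zero_line.
by rewrite expn_gt0 prime_gt0 // (pcharf_prime pF).
Qed.

(** By reflection a size between 2^(k-1) and 2^k can be replaced by its
    complement to 2^k, which has the same parity. As the tensor product is
    symmetric this applies to both sizes, and descends to k - 1. *)
Lemma odd_blocks_jtensor_jordan_block k a c : 2 \in [pchar F] -> (0 < k)%N ->
  (a <= 2 ^ k)%N -> (c <= 2 ^ k)%N ->
  odd_blocks (2 ^ k) (jtensor c (jordan_block a)) = (odd a && odd c)%:R.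
Proof.
move=> pF; case: k => // k _; elim: k a c => [|k IH] a c.
  (* for Q = 2 the sizes are 0, 1 and 2, and size 2 reflects to size 0 *)
  have red c' M : nilp M 2 -> (c' <= 2)%N ->
      odd_blocks 2 (jtensor c' M) = if c' == 1%N then odd_blocks 2 M else 0.
    move=> M2; case: c' => [|[|[|//]]] _.
    - by rewrite odd_blocks_jtensor0.
    - by rewrite odd_blocks_jtensor1.
    - by have := odd_blocks_reflection (k := 1) (b := 0) pF isT M2 isT;
      rewrite subn0 odd_blocks_jtensor0.
  move=> a2 c2; rewrite red //; last exact: (nilp_jordan_block (k := 1)).
  rewrite /jordan_block red //; last exact: nilp_zero_line.
  by rewrite odd_blocks_zero_line; case: a a2 => [|[|[|]]] //; case: c c2 => [|[|[|]]].
have pos : (2 ^ k.+1 <= 2 ^ k.+2)%N by rewrite leq_exp2l.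
have e2 : (2 ^ k.+2 = 2 ^ k.+1 + 2 ^ k.+1)%N by rewrite expnS mul2n addnn.
have fold c' M : nilp M (2 ^ k.+2) -> (c' <= 2 ^ k.+2)%N ->
    exists2 c'', (c'' <= 2 ^ k.+1)%N & odd c'' = odd c' /\
      odd_blocks (2 ^ k.+2) (jtensor c' M) = odd_blocks (2 ^ k.+2) (jtensor c'' M).
  move=> Mk ck; case: (leqP c' (2 ^ k.+1)) => ck'; first by exists c'.
  exists (2 ^ k.+2 - c')%N; first by rewrite e2; lia.
  by rewrite odd_blocks_reflection // oddB // oddX.
move=> ak ck; have [c' c'k [c'o ->]] :=
  fold c (jordan_block a) (nilp_jordan_block pF ak) ck.
rewrite -c'o /jordan_block odd_blocks_jtensorC -/(jordan_block c').
have nc' : nilp (jordan_block c') (2 ^ k.+2).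
  by apply: nilp_jordan_block => //; apply: leq_trans pos.
have [a' a'k [a'o ->]] := fold a (jordan_block c') nc' ak.
rewrite -a'o /jordan_block odd_blocks_jtensorC -/(jordan_block a')
  (odd_blocks_stable (Q := (2 ^ k.+1)%N)) ?IH //.
by apply: nilp_jtensor => //; apply: nilp_jordan_block.
Qed.

(** Both sides are additive, so the Jordan decomposition reduces this to one
    block. *)
Lemma odd_blocks_jtensor k c M : 2 \in [pchar F] -> (0 < k)%N -> nilp M (2 ^ k) ->
  (c <= 2 ^ k)%N -> odd_blocks (2 ^ k) (jtensor c M) =
    if odd c then odd_blocks (2 ^ k) M else 0.
Proof.
move=> pF k0 Mk ck; have [n] := ubnP (op_dim M); elim: n M Mk => // n IH M Mk.
rewrite ltnS => Mn; case: (posnP (op_dim M)) => [M0|M0].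
  have z Q M' : op_dim M' = 0%N -> odd_blocks Q M' = 0.
    move=> M'0; rewrite /odd_blocks big1 // => i _.
    have kd0' j : ker_dim M' j = 0%N by apply/eqP; rewrite -leqn0 -M'0 ker_dim_le.
    by rewrite !kd0' subrr mulr0.
  by rewrite !z ?if_same // op_dim_jtensor M0 muln0.
have [a [C [ak dC Cn MC]]] := jordan_split Mk M0.
have MC' := similar_add_shift (@prev1 c 1) MC.
rewrite -(similar_odd_blocks _ MC') -(similar_odd_blocks _ MC)
  (similar_odd_blocks _ (add_shift_op_sum _ _ _)) !odd_blocks_op_sum.
rewrite (IH C) ?(leq_trans dC) // -[add_shift _ _]/(jtensor c (jordan_block a.+1))
  odd_blocks_jtensor_jordan_block //.
have := @odd_blocks_jtensor_jordan_block k a.+1 1 pF k0 ak (leq_trans (ltn0Sn a) ak).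
by rewrite odd_blocks_jtensor1 andbT => ->; case: (odd c);
  rewrite ?andbT // andbF addr0.
Qed.

Lemma sum_odd_indices n (f : nat -> int) (x : int) :
  (forall c, (c < n.*2)%N -> f c = if odd c then x else 0) ->
  \sum_(c < n.*2) f c = x *+ n.
Proof.
elim: n => [|n IH] H; first by rewrite big_ord0.
rewrite doubleS; do 2 rewrite big_ord_recr /=.
rewrite IH => [|c cn]; last by apply: H; rewrite doubleS; lia.
rewrite (H n.*2) ?doubleS // (H n.*2.+1) ?doubleS //.
by rewrite /= odd_double /= addr0 mulrSr.
Qed.

(** Among the spaces M[z]/(z^c) with c <= 2^k only those with c odd have blocks
    of odd size; there are 2^(k-1) of them, and each counts twice. *)
Lemma odd_blocks_xytensor k r M : 2 \in [pchar F] -> (0 < k)%N -> (0 < r)%N ->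
  nilp M (2 ^ k) ->
  odd_blocks (2 ^ k) (xytensor (2 ^ k * r) r M) =
    (r ^ 2 * 2 ^ k)%:Z * odd_blocks (2 ^ k) M.
Proof.
move=> pF k0 r0 Mk; have q0 : (0 < 2 ^ k)%N by rewrite expn_gt0.
transitivity ((r ^ 2)%:Z * (odd_blocks (2 ^ k) (jtensor (2 ^ k) M) +
   2 * \sum_(c < 2 ^ k) odd_blocks (2 ^ k) (jtensor c M))).
  rewrite /odd_blocks [\sum_(c < _) \sum_(_ < _) _]exchange_big /= mulr_sumr
    -big_split mulr_sumr /=.
  apply: eq_bigr => i _; rewrite !ker_dim_xytensor // -mulr_sumr sumrB.
  rewrite ?PoszM ?PoszD ?PoszM.
  have E j : ((\sum_(c < 2 ^ k) ker_dim (jtensor c M) j)%N : int) =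
    \sum_(c < 2 ^ k) (ker_dim (jtensor c M) j : int).
    by elim/big_rec2: _ => // l x y _ <-; rewrite PoszD.
  by rewrite !E; ring.
have Qo : odd (2 ^ k) = false by rewrite oddX; case: k k0 {Mk q0}.
rewrite odd_blocks_jtensor // Qo add0r.
have -> : \sum_(c < 2 ^ k) odd_blocks (2 ^ k) (jtensor c M) =
  odd_blocks (2 ^ k) M *+ (2 ^ k.-1).
  have <- : ((2 ^ k.-1).*2 = 2 ^ k)%N by rewrite -mul2n -expnS prednK.
  apply: (sum_odd_indices (f := fun c => odd_blocks _ (jtensor c M))) => c ck.
  have e : ((2 ^ k.-1).*2 = 2 ^ k)%N by rewrite -mul2n -expnS prednK.
  by rewrite e in ck *; rewrite odd_blocks_jtensor // ltnW.
rewrite PoszM -mulrA; congr (_ * _).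
rewrite -(mulr_natl (odd_blocks _ _)) mulrA; congr (_ * _).
by rewrite -{2}(prednK k0) expnS PoszM; congr (_ * _); rewrite -natz.
Qed.

(** The difference 2 dim ker T - dim ker T^2 is the number of blocks of size
    one. The square of the operator is the same construction with exponent 2 r
    on T^2, so chains express both terms by the kernels of powers of T, where
    only even powers occur in the second. The difference is then the alternating
    sum that counts odd blocks of T. *)
Lemma xytensor_ker_dim12 k r M : 2 \in [pchar F] -> (0 < k)%N -> (0 < r)%N ->
  (2 * ker_dim (xytensor (2 ^ k * r) r M) 1)%:Z =
  (ker_dim (xytensor (2 ^ k * r) r M) 2)%:Z + (2 * r ^ 2)%:Z * odd_blocks (2 ^ k) M.
Proof.
move=> pF k0 r0; have q0 : (0 < 2 ^ k)%N by rewrite expn_gt0.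
have e : (2 ^ k = (2 ^ k.-1).*2)%N by rewrite -mul2n -expnS prednK.
rewrite -[X in _ = X%:Z + _]/(ker_dim _ (2 ^ 1 * 1)) -ker_dim_power
  (similar_ker_dim _ (xytensor_frob _ _ _ _ pF)).
rewrite expn1; have e2 : (2 ^ k * r = 2 ^ k.-1 * (r * 2))%N by rewrite e -muln2; lia.
rewrite [in X in _ = Posz X + _]e2.
rewrite !ker_dim_xytensor1 ?expn_gt0 ?muln_gt0 ?r0 //.
have s1 n : (-1) ^+ n.*2 = 1 :> int by rewrite -signr_odd odd_double.
have ooE n : odd_blocks n.*2 M =
  2 * \sum_(c < n.*2) (-1) ^+ c.+1 * (ker_dim M c)%:Z - (ker_dim M n.*2)%:Z.
  elim: n => [|n IH]; first by rewrite /odd_blocks !big_ord0 ker_dim0.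
  rewrite doubleS /odd_blocks; do 2 rewrite big_ord_recr /=.
  rewrite -/(odd_blocks n.*2 M) IH; do 2 rewrite big_ord_recr /=.
  by rewrite !exprS s1; ring.
rewrite e ooE ker_dim_power (mul2n (2 ^ k.-1)).
have E n (f : nat -> nat) : ((\sum_(c < n) f c)%N : int) = \sum_(c < n) (f c : int).
  by elim/big_rec2: _ => // l x y _ <-; rewrite PoszD.
have S n : \sum_(c < n.*2) (-1) ^+ c.+1 * (ker_dim M c)%:Z = 
   \sum_(c < n.*2) (ker_dim M c)%:Z - 2 * \sum_(c < n) (ker_dim M (2 * c))%:Z.
  elim: n => [|n IH]; first by rewrite !big_ord0 mulr0.
  rewrite doubleS big_ord_recr big_ord_recr big_ord_recr big_ord_recr big_ord_recr /=.
  by rewrite IH !exprS s1 -mul2n; ring.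
rewrite S -(E _ (ker_dim M)) -(E _ (fun c => ker_dim M (2 * c)%N)).
have -> : (\sum_(c < 2 ^ k.-1) ker_dim (op_power M 2) c =
  \sum_(c < 2 ^ k.-1) ker_dim M (2 * c))%N.
  by apply: eq_bigr => c _; rewrite ker_dim_power.
have -> : ((r * 2) ^ 2 = 4 * r ^ 2)%N by rewrite expnMn mulnC.
move: (\sum_(c < _) _)%N (\sum_(c < _) _)%N (ker_dim M _) (r ^ 2)%N => A B C R.
by rewrite !(PoszM, PoszD); ring.
Qed.

End Jordan.

(** * The operators of the forms Q and P *)

Section Numbers.
Variable F : fieldType.
Implicit Type M : opspace F.

(** The sum of the (x_(2i) x_(2i+1))^r, i < m, acting on k[x_0, ...,
    x_(2m-1)]/(x_i^q). *)
Definition hyperbolic_op q r m : opspace F := iter m (xytensor q r) (zero_line F).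

Lemma hyperbolic_op_frob q m p k : p \in [pchar F] ->
  similar (op_power (hyperbolic_op q 1 m) (p ^ k)) (hyperbolic_op q (p ^ k) m).
Proof.
move=> pF; elim: m => [|m IH].
  apply: similar_eq => v; rewrite endo_powE /= lfunE nilp_zero_line //.
  by rewrite expn_gt0 prime_gt0 // (pcharf_prime pF).
apply: similar_trans (xytensor_frob _ _ _ _ pF) _; rewrite mul1n.
exact: similar_add_shift.
Qed.

Lemma op_dim_hyperbolic_op q r m : op_dim (hyperbolic_op q r m) = (q ^ (2 * m))%N.
Proof.
elim: m => [|m IH]; first by rewrite op_dim_zero_line.
by rewrite /= op_dim_xytensor IH -expnD mulnS.
Qed.

Lemma nilp_hyperbolic_op q r m p k : p \in [pchar F] -> (q <= r * p ^ k)%N ->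
  nilp (hyperbolic_op q r m) (p ^ k).
Proof.
move=> pF qk; elim: m => [|m IH]; last exact: nilp_xytensor.
by apply: nilp_zero_line; rewrite expn_gt0 prime_gt0 // (pcharf_prime pF).
Qed.

(** Multiplication by z^s on the powers of z below n s has s chains of length n.
    *)
Lemma ker_dim_add_power c n s M : c = (n * s)%N -> (0 < n)%N -> (0 < s)%N ->
  ker_dim (add_shift (@prev1 c s) M) 1 = (s * ker_dim M n)%N.
Proof.
move=> ->; case: n => // n _ s0; rewrite ker_dim_prev1 // big_mkcond /=.
transitivity (\sum_(i < n.+1 * s) (fun j => if j == n then ker_dim M n.+1 else 0)
  (i %/ s))%N.
  apply: eq_bigr => i _ /=.
  have -> : (n.+1 * s <= i + s)%N = (i %/ s == n)%N.
    have ilt : (i %/ s < n.+1)%N by rewrite ltn_divLR.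
    rewrite eqn_leq -[X in X && _]ltnS ilt /= leq_divRL //.
    by move: (nat_of_ord i) => m; rewrite mulSn addnC leq_add2r.
  by case: eqP => [->|].
rewrite (sum_ord_muln _ (fun j => if j == n then ker_dim M n.+1 else 0)%N) //;
  congr (_ * _)%N.
rewrite big_ord_recr /= eqxx big1 // => i _.
by rewrite (ltn_eqF (ltn_ord i)).
Qed.

(** Multiplication by z^(2r) on the powers of z below 3r has r chains of length
    two and r of length one. *)
Lemma ker_dim_add_square3 c r M : c = (3 * r)%N -> (0 < r)%N ->
  ker_dim (add_shift (@prev1 c (2 * r)) M) 1 = (r * (ker_dim M 1 + ker_dim M 2))%N.
Proof.
move=> -> r0; rewrite ker_dim_prev1 ?muln_gt0 // big_mkcond /=.
rewrite (_ : 3 * r = r + (r + r))%N; last lia.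
rewrite big_split_ord big_split_ord /= big1 => [|i _]; last first.
  by case: ifP => //; have := ltn_ord i; lia.
rewrite add0n mulnDr; congr (_ + _)%N.
  rewrite -[in RHS](card_ord r) -sum_nat_const; apply: eq_bigr => i _.
  have ir := ltn_ord i; rewrite ifT; last lia.
  by rewrite divn_small //; lia.
rewrite -[in RHS](card_ord r) -sum_nat_const; apply: eq_bigr => i _.
have ir := ltn_ord i; rewrite ifT; last lia.
rewrite (_ : r + (r + i) = 1 * (2 * r) + i)%N; last lia.
by rewrite divnMDl ?muln_gt0 // divn_small //; lia.
Qed.

(** Here T^2 = 0, so ker T^2 is everything and the chains give a linear
    recursion for dim ker T. *)
Lemma ker_dim_hyperbolic_op_char2 r m : 2 \in [pchar F] -> (0 < r)%N ->
  (2 * ker_dim (hyperbolic_op (2 * r) r m) 1 = r ^ (2 * m) * (4 ^ m + 2 ^ m))%N.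
Proof.
move=> pF r0; elim: m => [|m IH]; first by rewrite ker_dim_zero_line.
rewrite /= ker_dim_xytensor1 // 2!big_ord_recr big_ord0 /= ker_dim0.
rewrite [ker_dim _ 2]ker_dim_nilp;
  last by apply: (nilp_hyperbolic_op (k := 1)) => //; rewrite expn1 mulnC.
rewrite op_dim_hyperbolic_op expnMn (expnM 2 2 m) !(mulnS 2 m) expnD !add0n.
transitivity (r ^ 2 * (2 * (r ^ (2 * m) * 4 ^ m) +
  2 * (2 * ker_dim (hyperbolic_op (2 * r) r m) 1)))%N.
  by rewrite -[(2 ^ 2)%N]/4%N; lia.
by rewrite IH !(expnS _ m); lia.
Qed.

(** The summand z^2 gives two chains of length 2^e, and Frobenius turns ker
    T^(2^e) into the kernel for r = 2^e. *)
Lemma ker_dim_Q_even m e : 2 \in [pchar F] ->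
  ker_dim (add_shift (@prev1 (2 ^ e.+1) 2) (hyperbolic_op (2 ^ e.+1) 1 m)) 1 =
  ((2 ^ e) ^ (2 * m) * (4 ^ m + 2 ^ m))%N.
Proof.
move=> pF; have r0 : (0 < 2 ^ e)%N by rewrite expn_gt0.
rewrite (ker_dim_add_power _ (expnSr 2 e)) // -ker_dim_hyperbolic_op_char2 //
  -expnS; congr (_ * _)%N.
rewrite -[X in ker_dim _ X]muln1 -ker_dim_power; apply: similar_ker_dim;
  exact: hyperbolic_op_frob.
Qed.

Lemma odd_blocks_hyperbolic_op k r m : 2 \in [pchar F] -> (0 < k)%N -> (0 < r)%N ->
  odd_blocks (2 ^ k) (hyperbolic_op (2 ^ k * r) r m) = ((r ^ 2 * 2 ^ k) ^ m)%:Z.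
Proof.
move=> pF k0 r0; elim: m => [|m IH].
  by rewrite /= -(prednK (_ : 0 < 2 ^ k)%N) ?expn_gt0 // odd_blocks_zero_line.
rewrite /= odd_blocks_xytensor // ?IH ?expnS -?PoszM //.
by apply: nilp_hyperbolic_op => //; rewrite mulnC.
Qed.

(** The number 2 dim ker T^(2^i) - dim ker T^(2^(i+1)) of blocks of size one of
    T^(2^i) is known from the blocks of odd size. The sum telescopes, and ends
    at T^(2^e) = 0. *)
Lemma ker_dim_Q_odd m e : 2 \in [pchar F] ->
  (2 ^ e * ker_dim (hyperbolic_op (2 ^ e) 1 m.+1) 1 =
   (2 ^ e) ^ (2 * m.+1) + (2 ^ e) ^ m.+1 * \sum_(i < e) 2 ^ (i * m.+1))%N.
Proof.
move=> pF; set q := (2 ^ e)%N.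
have step i : (i < e)%N -> (2 * ker_dim (hyperbolic_op q 1 m.+1) (2 ^ i) =
    ker_dim (hyperbolic_op q 1 m.+1) (2 ^ i.+1) + 2 * (2 ^ i) ^ 2 * (2 ^ i * q) ^ m)%N.
  move=> ie; have r0 : (0 < 2 ^ i)%N by rewrite expn_gt0.
  have kE j : ker_dim (hyperbolic_op q 1 m.+1) (2 ^ i * j) =
    ker_dim (hyperbolic_op q (2 ^ i) m.+1) j.
    by rewrite -ker_dim_power; apply: similar_ker_dim; exact: hyperbolic_op_frob.
  rewrite expnSr kE -{1}(muln1 (2 ^ i)%N) kE.
  have qE : q = (2 ^ (e - i) * 2 ^ i)%N by rewrite -expnD subnK // ltnW.
  have ei : (0 < e - i)%N by rewrite subn_gt0.
  have nu := @xytensor_ker_dim12 F (e - i) (2 ^ i) (hyperbolic_op q (2 ^ i) m) pF ei r0.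
  have o := odd_blocks_hyperbolic_op m pF ei r0; rewrite -qE in o nu; rewrite {}o in nu.
  move: nu; rewrite -PoszM -PoszD => -[->].
  by congr (_ + _ * _ ^ m)%N; rewrite qE; lia.
have IH j : (j <= e)%N -> (2 ^ j * ker_dim (hyperbolic_op q 1 m.+1) 1 =
    ker_dim (hyperbolic_op q 1 m.+1) (2 ^ j) +
      2 ^ j * q ^ m * \sum_(i < j) 2 ^ (i * m.+1))%N.
  elim: j => [|j IH] je; first by rewrite big_ord0 muln0 addn0 mul1n.
  rewrite expnS -mulnA IH 1?ltnW // mulnDr step // big_ord_recr /= -addnA;
    congr (_ + _)%N.
    by rewrite expnS.
  rewrite !mulnDr addnC !mulnA; congr (_ + _)%N.
  by rewrite (expnM 2 j m.+1) expnS expnMn; lia.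
rewrite IH // ker_dim_nilp; last by apply: nilp_hyperbolic_op => //; rewrite mul1n.
by rewrite op_dim_hyperbolic_op [X in (_ + X * _)%N](_ : _ = q ^ m.+1)%N // expnS.
Qed.

(** When T^3 = 0, reflection expresses all kernels on M[z]/(z^c), c <= 3, by
    those of T and T^2. *)
Lemma ker_dim_xytensor_char3 r M : 3 \in [pchar F] -> (0 < r)%N -> nilp M 3 ->
  ker_dim (xytensor (3 * r) r M) 1 =
    (r ^ 2 * (2 * (ker_dim M 1 + ker_dim M 2) + op_dim M))%N /\
  ker_dim (xytensor (3 * r) r M) 2 =
    (r ^ 2 * (2 * (ker_dim M 1 + ker_dim M 2) + 4 * op_dim M))%N.
Proof.
move=> pF r0 M3; split.
  rewrite ker_dim_xytensor1 // 3!big_ord_recr big_ord0 /= ker_dim0 ker_dim_nilp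
    //; congr (_ * _)%N; lia.
rewrite ker_dim_xytensor // 3!big_ord_recr big_ord0 /=.
have r1 := @reflection F 3 1 M 3 2 pF M3 isT isT.
have r2 := @reflection F 3 1 M 2 2 pF M3 isT isT.
rewrite /= expn1 !subSS !subn0 (ker_dim_jtensorC 0) ker_dim0 in r1.
rewrite /= expn1 !subSS !subn0 ker_dim_jtensor1 in r2.
rewrite (ker_dim_jtensorC 0) ker_dim0 (ker_dim_jtensorC 1) ker_dim_jtensor1;
  congr (_ * _)%N; lia.
Qed.

Lemma ker_dim_hyperbolic_op_char3 r m : 3 \in [pchar F] -> (0 < r)%N ->
  (ker_dim (hyperbolic_op (3 * r) r m) 1 + ker_dim (hyperbolic_op (3 * r) r m) 2 =
    r ^ (2 * m) * (9 ^ m + 4 ^ m))%N.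
Proof.
move=> pF r0; elim: m => [|m IH]; first by rewrite !ker_dim_zero_line.
have [|-> ->] := @ker_dim_xytensor_char3 r (hyperbolic_op (3 * r) r m) pF r0.
  by apply: (nilp_hyperbolic_op (k := 1)) => //; rewrite expn1 mulnC.
rewrite IH op_dim_hyperbolic_op expnMn (expnM 3 2 m) mulnS expnD !(expnS _ m).
by rewrite -[(3 ^ 2)%N]/9%N; lia.
Qed.

Lemma ker_dim_P_even m e : 3 \in [pchar F] ->
  (2 * ker_dim (add_shift (@prev1 (3 ^ e.+1) 3) (hyperbolic_op (3 ^ e.+1) 1 m.+1)) 1 =
  (3 ^ e) ^ (2 * m.+1) * (2 * 9 ^ m.+1 + 3 * 4 ^ m.+1))%N.
Proof.
move=> pF; have r0 : (0 < 3 ^ e)%N by rewrite expn_gt0.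
rewrite (ker_dim_add_power _ (expnSr 3 e)) //.
have -> : ker_dim (hyperbolic_op (3 ^ e.+1) 1 m.+1) (3 ^ e) =
  ker_dim (hyperbolic_op (3 ^ e.+1) (3 ^ e) m.+1) 1.
  by rewrite -[X in ker_dim _ X]muln1 -ker_dim_power; apply: similar_ker_dim;
    exact: hyperbolic_op_frob.
rewrite expnS; set r := (3 ^ e)%N in r0 *.
have [|-> _] := @ker_dim_xytensor_char3 r (hyperbolic_op (3 * r) r m) pF r0.
  by apply: (nilp_hyperbolic_op (k := 1)) => //; rewrite expn1 mulnC.
rewrite ker_dim_hyperbolic_op_char3 // op_dim_hyperbolic_op expnMn (expnM 3 2 m)
  mulnS expnD !(expnS _ m).
by rewrite -[(3 ^ 2)%N]/9%N; lia.
Qed.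

(** After the cube is removed as in the even case, the 3^e-th power of the
    remaining operator has the summand z^(2r) with z^(3r) = 0, r = 3^e. *)
Lemma ker_dim_P_odd m e : 3 \in [pchar F] ->
  ker_dim (add_shift (@prev1 (3 ^ e.+1) 3)
    (add_shift (@prev1 (3 ^ e.+1) 2) (hyperbolic_op (3 ^ e.+1) 1 m))) 1 =
  (3 * (3 ^ e) ^ (2 * m).+1 * (9 ^ m + 4 ^ m))%N.
Proof.
move=> pF; have r0 : (0 < 3 ^ e)%N by rewrite expn_gt0.
rewrite (ker_dim_add_power _ (expnSr 3 e)) //.
rewrite -[X in ker_dim _ X]muln1 -ker_dim_power
  (similar_ker_dim _ (prev1_frob _ _ _ _ pF)).
rewrite (similar_ker_dim _ (similar_add_shift _ (hyperbolic_op_frob _ _ _ pF)))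
  (ker_dim_add_square3 _ (expnS 3 e)) //.
by rewrite {1 2}(expnS 3 e) ker_dim_hyperbolic_op_char3 // expnS; lia.
Qed.

End Numbers.

Local Open Scope classical_set_scope.
Local Open Scope quotient_scope.

(** * Power series over a field *)

Section Series.
Variables (n : nat) (k : fieldType).
Local Notation S := (powser n k).
Implicit Types (f g h : S) (m a b : multinom n).

Definition ps_mon a : S := fun m => (m == a)%:R.
Definition mle a m := [forall i, a i <= m i]%N.

Lemma mnm_addK a m : mle a m -> mnm_add a (mnm_sub m a) = m.
Proof. by move=> /forallP am; apply/mnmP => i; rewrite mnmDE mnmBE subnKC. Qed.

Lemma mle_add a b : mle a (mnm_add a b).
Proof. by apply/forallP => i; rewrite mnmDE leq_addr. Qed.

Lemma mnm_addI a b : mnm_sub (mnm_add a b) a = b.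
Proof. by apply/mnmP => i; rewrite mnmBE mnmDE addKn. Qed.

Lemma ps_ext f g : (forall m, f m = g m) -> f = g.
Proof. by move=> fg; apply/funext. Qed.

Lemma ps_monE a g m : (ps_mon a * g) m = if mle a m then g (mnm_sub m a) else 0.
Proof.
rewrite [LHS]/(ps_mul _ _ m) /ps_mul; case: ifP => am; last first.
  rewrite big1 // => -[i j] /= /eqP mE; rewrite /ps_mon; case: eqP => ia;
    last by rewrite mul0r.
  by rewrite mE ia mle_add in am.
have i1 : (mdeg a < (mdeg m).+1)%N by rewrite ltnS -(mnm_addK am) mdegD leq_addr.
have i2 : (mdeg (mnm_sub m a) < (mdeg m).+1)%N by rewrite ltnS mdegB.
rewrite (bigD1 (BMultinom i1, BMultinom i2)) /=; last by rewrite mnm_addK.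
rewrite /ps_mon eqxx mul1r big1 ?addr0 // => -[i j] /= /andP[/eqP mE ne].
case: eqP => ia; last by rewrite mul0r.
case/eqP: ne; congr pair; apply: val_inj => //=.
rewrite -ia; transitivity (mnm_sub (mnm_add i j) i); first by rewrite mnm_addI.
by congr mnm_sub.
Qed.

Lemma ps_varE v g m : (ps_var k v * g) m =
  if (0 < m v)%N then g (mnm_sub m (mnm1 v)) else 0.
Proof.
rewrite -[ps_var k v]/(ps_mon (mnm1 v)) ps_monE (_ : mle _ _ = (0 < m v)%N) //.
apply/forallP/idP => [/(_ v)|mv i]; first by rewrite mnm1E eqxx.
by rewrite mnm1E; case: eqP => [<-|].
Qed.

Lemma ps_mon0 : ps_mon mnm0 = 1.
Proof. by apply: ps_ext => m; rewrite /ps_mon [RHS]/(ps_const _ _) /ps_const;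
  case: eqP. Qed.

Lemma ps_monD a b : ps_mon (mnm_add a b) = ps_mon a * ps_mon b.
Proof.
apply: ps_ext => m; rewrite ps_monE /ps_mon; case: ifP => am.
  by rewrite -{1}(mnm_addK am); congr (_%:R); congr nat_of_bool;
    apply/eqP/eqP => [/(congr1 (fun x => mnm_sub x a))|->//]; rewrite !mnm_addI.
by case: eqP => // mE; rewrite mE mle_add in am.
Qed.

Lemma ps_varXE v r g m : (ps_var k v ^+ r * g) m =
  if (r <= m v)%N then g (mnm_sub m (mnm_muln (mnm1 v) r)) else 0.
Proof.
have -> : ps_var k v ^+ r = ps_mon (mnm_muln (mnm1 v) r).
  elim: r => [|r IH].
    by rewrite expr0 -ps_mon0.
  by rewrite exprS IH -[ps_var k v]/(ps_mon (mnm1 v)) -ps_monD mulmS.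
rewrite ps_monE (_ : mle _ _ = (r <= m v)%N) //.
apply/forallP/idP => [/(_ v)|mv i]; first by rewrite mulmnE mnm1E eqxx mul1n.
by rewrite mulmnE mnm1E; case: eqP => [<-|]; rewrite ?mul1n.
Qed.

Lemma ps_constE c g m : (@ps_const n k c * g) m = c * g m.
Proof.
have -> : @ps_const n k c * g = ps_mul (fun m => c * ps_mon mnm0 m) g.
  congr (ps_mul _ g); apply: ps_ext => l; rewrite /ps_const /ps_mon.
  by case: eqP; rewrite ?mulr1 ?mulr0.
rewrite -[g in RHS]mul1r -ps_mon0.
rewrite [X in c * X]/(ps_mul (ps_mon mnm0) g m) /ps_mul mulr_sumr.
by apply: eq_bigr => ij _; rewrite mulrA.
Qed.

Lemma ps_const_monoid : monoid_morphism (@ps_const n k).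
Proof.
split=> // c d; apply: ps_ext => m; rewrite ps_constE /ps_const.
by case: eqP; rewrite ?mulr0.
Qed.
Lemma ps_const_zmod : zmod_morphism (@ps_const n k).
Proof.
move=> c d; apply: ps_ext => m; transitivity (ps_const c m - ps_const d m); last by [].
by rewrite /ps_const; case: (m == mnm0); rewrite ?subrr.
Qed.
HB.instance Definition _ :=
  GRing.isZmodMorphism.Build k S (@ps_const n k) ps_const_zmod.
HB.instance Definition _ :=
  GRing.isMonoidMorphism.Build k S (@ps_const n k) ps_const_monoid.

Lemma ps_oppE f m : (- f) m = - f m. Proof. by []. Qed.
Lemma ps_subE f g m : (f - g) m = f m - g m. Proof. by []. Qed.

Lemma ps_one0 : (1 : S) mnm0 = 1.
Proof. by rewrite -ps_mon0 /ps_mon eqxx. Qed.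

Lemma ps_sumE (I : Type) (r : seq I) (P : pred I) (F : I -> S) m :
  (\sum_(i <- r | P i) F i) m = \sum_(i <- r | P i) F i m.
Proof. by elim/big_rec2: _ => // i x y _ <-; rewrite ps_addE. Qed.

Lemma ps_charp p : p \in [pchar k] -> p \in [pchar S].
Proof.
move=> pk; rewrite inE (pcharf_prime pk) /=; apply/eqP.
by rewrite -(rmorph_nat (@ps_const n k)) (pcharf0 pk) rmorph0.
Qed.

Definition ord_ge D f := forall m, (mdeg m < D)%N -> f m = 0.

Lemma ord_geM D D' f g : ord_ge D f -> ord_ge D' g -> ord_ge (D + D') (f * g).
Proof.
move=> fD gD m mD; rewrite [LHS]/(ps_mul f g m) /ps_mul big1 // => -[i j] /= /eqP mE.
rewrite mE mdegD in mD; case: (ltnP (mdeg i) D) => iD; first by rewrite fD ?mul0r.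
by rewrite gD ?mulr0 //; rewrite -(ltn_add2l D) (leq_ltn_trans _ mD) // leq_add2r.
Qed.

Lemma ord_ge_trivial f : ord_ge 0 f. Proof. by []. Qed.
Lemma ord_geD D f g : ord_ge D f -> ord_ge D g -> ord_ge D (f + g).
Proof. by move=> fD gD m mD; rewrite ps_addE fD ?gD ?addr0. Qed.
Lemma ord_geN D f : ord_ge D f -> ord_ge D (- f).
Proof. by move=> fD m mD; rewrite ps_oppE fD ?oppr0. Qed.
Lemma ord_geB D f g : ord_ge D f -> ord_ge D g -> ord_ge D (f - g).
Proof. by move=> fD gD; apply: ord_geD => //; apply: ord_geN. Qed.
Lemma ord_geMl D f g : ord_ge D g -> ord_ge D (f * g).
Proof. by move=> gD; rewrite -[D]add0n; apply: ord_geM. Qed.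
Lemma ord_geMr D f g : ord_ge D f -> ord_ge D (f * g).
Proof. by rewrite mulrC; exact: ord_geMl. Qed.
Lemma ord_ge_sum D (I : Type) (r : seq I) (P : pred I) (F : I -> S) :
  (forall i, P i -> ord_ge D (F i)) -> ord_ge D (\sum_(i <- r | P i) F i).
Proof.
by move=> FD; elim/big_ind: _ => // f g; exact: ord_geD.
Qed.
Lemma ord_ge_le D D' f : (D <= D')%N -> ord_ge D' f -> ord_ge D f.
Proof. by move=> DD fD m mD; apply: fD; apply: leq_trans DD. Qed.
Lemma ord_geX D f i : ord_ge D f -> ord_ge (i * D) (f ^+ i).
Proof.
move=> fD; elim: i => [|i IH]; first by rewrite mul0n.
by rewrite exprS mulSn; apply: ord_geM.
Qed.
Lemma ord_ge_eq f g : (forall D, ord_ge D (f - g)) -> f = g.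
Proof.
move=> fg; apply: ps_ext => m; apply/eqP; rewrite -subr_eq0; apply/eqP.
exact: (fg (mdeg m).+1 m (ltnSn _)).
Qed.
Lemma ord_ge1P f : ord_ge 1 f <-> f mnm0 = 0.
Proof.
split=> [f1|f0 m]; first by apply: f1; rewrite mdeg0.
by rewrite ltnS leqn0 mdeg_eq0 => /eqP->.
Qed.
(** Power series are complete: the coefficients of degree D are those of all u N
    with N > D. *)
Lemma ord_ge_limit (u : nat -> S) : (forall N, ord_ge N (u N.+1 - u N)) ->
  exists f, forall N, ord_ge N (f - u N).
Proof.
move=> uN; exists (fun m => u (mdeg m).+1 m) => N m mN.
have H l N' : (N' <= l)%N -> ord_ge N' (u l - u N').
  elim: l => [|l IH]; first by rewrite leqn0 => /eqP->; rewrite subrr.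
  rewrite leq_eqVlt => /orP[/eqP<-|]; first by rewrite subrr.
  rewrite ltnS => Nl; rewrite -(subrK (u l) (u l.+1)) -addrA; apply: ord_geD;
    last exact: IH.
  exact: ord_ge_le (uN l).
have := H N (mdeg m).+1 mN m (ltnSn _).
rewrite ps_subE => /eqP; rewrite subr_eq0 => /eqP E.
by rewrite ps_subE /= E subrr.
Qed.

(** The inverse is a geometric series. *)
Lemma ps_unit f : f mnm0 != 0 -> exists g, f * g = 1.
Proof.
move=> f0; pose c := f mnm0; pose h := 1 - @ps_const n k c^-1 * f.
have h1 : ord_ge 1 h.
  by apply/ord_ge1P; rewrite /h ps_subE ps_one0 ps_constE mulVf // subrr.
have [|g gE] := @ord_ge_limit (fun N => \sum_(i < N) h ^+ i).
  by move=> N; rewrite big_ord_recr /= addrC addrK -[N in ord_ge N]muln1;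
    apply: ord_geX.
have hg : (1 - h) * g = 1.
  apply: ord_ge_eq => D; rewrite -(subrK (\sum_(i < D) h ^+ i) g) mulrDr.
  rewrite [X in _ + X - 1](_ : _ = 1 - h ^+ D); last first.
    by rewrite -(opprB h 1) mulNr -subrX1 opprB.
  rewrite -addrA [X in _ + X](_ : _ = - h ^+ D); last by rewrite addrAC subrr add0r.
  apply: ord_geB; first exact: ord_geMl.
  by rewrite -[D in ord_ge D]muln1; apply: ord_geX.
exists (@ps_const n k c^-1 * g); rewrite mulrCA mulrA -hg; congr (_ * _).
by rewrite /h opprB addrC subrK mulrC.
Qed.

Definition frob_ideal q : set S :=
  [set g | exists G : 'I_n -> S, g = \sum_i ps_var k i ^+ q * G i].

(** A monomial divisible by the q-th power of some variable is assigned to the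
    first such variable. *)
Lemma frob_idealP q g : frob_ideal q g <->
  (forall m, (forall i, m i < q)%N -> g m = 0).
Proof.
split=> [[G ->] m mq|g0].
  by rewrite ps_sumE big1 // => i _; rewrite ps_varXE leqNgt mq.
pose e i := mnm_muln (mnm1 i) q : multinom n.
have eE i j : e i j = if i == j then q else 0%N.
  by rewrite mulmnE mnm1E; case: eqP; rewrite ?mul1n ?mul0n.
exists (fun (i : 'I_n) m =>
  if [forall j : 'I_n, (j < i)%N ==> (m j < q)%N] then g (mnm_add m (e i)) else 0).
apply: ps_ext => m; rewrite ps_sumE.
case: (pickP (fun i : 'I_n => q <= m i)%N) => [i0 qi0|none]; last first.
  rewrite g0 => [|i]; last by rewrite ltnNge none.
  by rewrite big1 // => i _; rewrite ps_varXE none.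
case: (@arg_minnP _ i0 (fun i : 'I_n => (q <= m i)%N)
  (fun i : 'I_n => nat_of_ord i) qi0) => i qi imin.
rewrite (bigD1 i) //= ps_varXE qi ifT; last first.
  apply/forallP => j; apply/implyP => ji; rewrite mnmBE -/(e i) eE.
  case: eqP => [ij|_]; first by rewrite ij ltnn in ji.
  by rewrite subn0 ltnNge; apply: contraTN ji => /imin; rewrite -leqNgt.
rewrite big1 ?addr0 => [|j ji].
  congr g; apply/mnmP => j; rewrite mnmDE mnmBE -/(e i) eE.
  by case: eqP => [<-|_]; rewrite ?subnK ?subn0 ?addn0.
rewrite ps_varXE; case: ifP => // qj; rewrite ifF //.
apply/negP => /forallP/(_ i)/implyP H.
have ij : (i < j)%N by rewrite ltn_neqAle imin // andbT eq_sym.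
have := H ij; rewrite mnmBE -/(e j) eE (negPf ji) subn0 ltnNge.
by rewrite qi.
Qed.

Lemma frob_ideal_ideal q : is_ideal (frob_ideal q).
Proof.
split.
- by exists (fun=> 0); rewrite big1 // => i _; rewrite mulr0.
- move=> x y [G ->] [H ->]; exists (fun i => G i + H i).
  by rewrite -big_split; apply: eq_bigr => i _; rewrite mulrDr.
move=> a x [G ->]; exists (fun i => a * G i).
by rewrite mulr_sumr; apply: eq_bigr => i _; rewrite mulrCA.
Qed.

Lemma max_vars g : g mnm0 = 0 -> exists G : 'I_n -> S, g = \sum_i ps_var k i * G i.
Proof.
move=> g0; suff [G GE] : frob_ideal 1 g by exists G; rewrite GE;
  apply: eq_bigr => i _; rewrite expr1.
apply/frob_idealP => m m0; rewrite (_ : m = mnm0) //.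
by apply/mnmP => i; rewrite mnm0E; apply/eqP; rewrite -leqn0 -ltnS.
Qed.

End Series.

(** * The hypersurface ring and its ideals *)

Lemma supremum_nat (X : set nat) l :
  X l -> (forall m, X m -> (m <= l)%N) -> supremum 0%N X = l.
Proof.
move=> Xl Xm; have H : supremums X l.
  by split=> [m /Xm|m /(_ l Xl)].
rewrite /supremum ifF; last first.
  by apply/negbTE/set0P; exists l.
case: xgetP => [y _ Hy|/(_ l)]; last by [].
by apply: (@is_subset1_supremums _ nat X).
Qed.

Lemma expr_sum_pchar (R : comNzRingType) (I : Type) (r : seq I) (F : I -> R) p e :
  p \in [pchar R] ->
  (\sum_(i <- r) F i) ^+ (p ^ e) = \sum_(i <- r) F i ^+ (p ^ e).
Proof.
move=> pR; elim: e => [|e IH]; first by rewrite expr1; apply: eq_bigr => i _;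
  rewrite expr1.
rewrite expnSr exprM IH -(pFrobenius_autE pR) rmorph_sum /=.
by apply: eq_bigr => i _; rewrite pFrobenius_autE exprM.
Qed.

Section IdealGen.
Variable A : comNzRingType.

Lemma ideal_gen_sub (G I : set A) : is_ideal I -> G `<=` I -> ideal_gen G `<=` I.
Proof. by move=> II GI x; apply. Qed.

Lemma sub_ideal_gen (G : set A) : G `<=` ideal_gen G.
Proof. by move=> x Gx I [_]; apply. Qed.

Lemma ideal_genP (G I : set A) : is_ideal I -> G `<=` I ->
  I `<=` ideal_gen G -> ideal_gen G = I.
Proof. by move=> II GI IG; apply/seteqP; split=> //; apply: ideal_gen_sub. Qed.

Lemma ideal_gen1 (f x : A) : ideal_gen [set f] x <-> exists h, x = h * f.
Proof.
have -> : ideal_gen [set f] = [set x | exists h, x = h * f].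
  apply: ideal_genP => [|_ ->|_ [h ->]].
  - split; first by exists 0; rewrite mul0r.
      by move=> _ _ [g ->] [h ->]; exists (g + h); rewrite mulrDl.
    by move=> a _ [g ->]; exists (a * g); rewrite mulrA.
  - by exists 1; rewrite mul1r.
  by have [_ _ H] := ideal_gen_ideal [set f]; apply: H; apply: sub_ideal_gen.
by [].
Qed.

Lemma ideal_sum (I : set A) (J : Type) (r : seq J) (P : pred J) (F : J -> A) :
  is_ideal I -> (forall i, P i -> I (F i)) -> I (\sum_(i <- r | P i) F i).
Proof. by move=> [I0 ID _] IF; elim/big_ind: _. Qed.

Lemma quot_module_pi (G : set A) : exists th : A -> quot_module G,
  [/\ forall a b, th (a + b) = th a + th b, forall a b, th (a * b) = a *: th b,
    forall x, exists a, th a = x & forall a, th a = 0 <-> ideal_gen G a].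
Proof.
exists (\pi_(quot_module G)); split=> [a b|a b|x|a].
- exact: raddfD.
- exact/esym/quot_scale_pi.
- by exists (repr x); rewrite reprK.
rewrite -(raddf0 (\pi_(quot_module G))); split=> [/eqP|Ga].
  by rewrite -Quotient.idealrBE subr0 => /asboolP.
by apply/eqP; rewrite -Quotient.idealrBE subr0; apply/asboolP.
Qed.

End IdealGen.

Section ChainTransfer.
Variables (S M : Type) (th : S -> M).
Hypothesis th_onto : forall x, exists s, th s = x.

(** Taking preimages under a surjection is injective on sets, and taking images
    is so on saturated sets. *)
Lemma chain_lengths_onto (C : set (set M)) (C' : set (set S)) :
  (forall N, C N -> C' (th @^-1` N)) ->
  (forall I, C' I -> C (th @` I) /\ forall s s', th s = th s' -> I s -> I s') ->
  chain_lengths C = chain_lengths C'.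
Proof.
move=> CC' C'C; apply/seteqP; split=> l [c [cC cS]].
  exists (fun i => th @^-1` c i); split=> i il; first exact/CC'/cC.
  have [sub [x cx ncx]] : c i `<=` c i.+1 /\ exists2 x, c i.+1 x & ~ c i x.
    have [sub ne] := cS i il; split=> //; apply: contrapT => H; apply: ne => x cx.
    by apply: contrapT => ncx; apply: H; exists x.
  split=> [s /sub //|H]; have [s sx] := th_onto x.
  by apply: ncx; rewrite -sx; apply: (H s); rewrite /= sx.
exists (fun i => th @` c i); split=> i il; first by case: (C'C _ (cC i il)).
have [sub ne] := cS i il; split=> [_ [s cs <-]|H]; first by exists s => //; apply: sub.
apply: ne => s cs; have [|s' cs' ss'] := H (th s); first by exists s.
by have [_ sat] := C'C _ (cC i (ltnW il)); apply: sat cs'.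
Qed.
End ChainTransfer.

Section HyperRing.
Variables (n : nat) (k : fieldType) (f : powser n k) (f0 : f mnm0 = 0).
Local Notation S := (powser n k).
Local Notation A := (hypersurface f0).

(** The quotient ring is used through this map only. *)
Lemma hypersurface_pi : exists pi : {rmorphism S -> A},
  (forall x, exists s, pi s = x) /\ (forall s, pi s = 0 <-> exists h, s = h * f).
Proof.
pose Q := {ideal_quot (proper_ideal_pred (ps_nonunit f0))}.
pose p : {rmorphism S -> Q} := \pi_Q.
exists p; split=> [x|s]; first by exists (repr x); apply: reprK.
rewrite -ideal_gen1 -(rmorph0 p); split=> [/eqP|Ga].
  by rewrite -Quotient.idealrBE subr0 => /asboolP.
by apply/eqP; rewrite -Quotient.idealrBE subr0; apply/asboolP.
Qed.

End HyperRing.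

Section Local.
Variables (n : nat) (k : fieldType) (f : powser n k) (f0 : f mnm0 = 0).
Local Notation S := (powser n k).
Local Notation A := (hypersurface f0).
Variable pi : {rmorphism S -> A}.
Hypothesis pi_onto : forall x, exists s, pi s = x.
Hypothesis pi_ker : forall s, pi s = 0 <-> exists h, s = h * f.

Lemma pi_eq s s' : pi s = pi s' <-> exists h, s - s' = h * f.
Proof.
rewrite -pi_ker rmorphB; split=> [->|/eqP]; first exact: subrr.
by rewrite subr_eq0 => /eqP.
Qed.

Lemma image_ideal (I : set S) : is_ideal I -> is_ideal (pi @` I).
Proof.
move=> [I0 ID IM]; split; first by exists 0; rewrite ?rmorph0.
  move=> _ _ [s Is <-] [t It <-]; exists (s + t); rewrite ?rmorphD //; exact: ID.
move=> a _ [s Is <-]; have [t <-] := pi_onto a.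
by exists (t * s); rewrite ?rmorphM //; apply: IM.
Qed.

Let m : set S := [set s | s mnm0 = 0].

Lemma m_ideal : is_ideal m.
Proof.
split=> [//|x y x0 y0|a x x0]; rewrite /m /=.
  by rewrite ps_addE x0 y0 addr0.
by rewrite ps_mul0E x0 mulr0.
Qed.

Lemma proper_sub_m (J : set A) : is_ideal J -> ~ J 1 -> J `<=` pi @` m.
Proof.
move=> [J0 JD JM] J1 x Jx; have [s sx] := pi_onto x; exists s => //.
apply: contrapT => /eqP/ps_unit[g sg]; apply: J1.
by rewrite -(rmorph1 pi) -sg mulrC rmorphM sx; apply: JM.
Qed.

Lemma m_proper : ~ (pi @` m) 1.
Proof.
move=> [s s0]; rewrite -(rmorph1 pi) => /pi_eq[h].
move/(congr1 (fun g : S => g mnm0)); rewrite ps_mul0E f0 mulr0 ps_subE s0 ps_one0.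
by move/eqP; rewrite sub0r oppr_eq0 oner_eq0.
Qed.

(** A series with nonzero constant term is a unit, so this ideal contains all
    proper ideals. *)
Lemma max_idealE : @max_ideal A = pi @` m.
Proof.
have mm : is_maximal_ideal (pi @` m).
  split; [exact: image_ideal m_ideal|exact: m_proper|].
  by move=> J JI J1 mJ; apply/seteqP; split=> //; apply: proper_sub_m.
have [HI H1 Hm] := @getPex _ (@is_maximal_ideal A) (ex_intro _ _ mm).
apply/esym/Hm; [exact: image_ideal m_ideal|exact: m_proper|].
exact: proper_sub_m.
Qed.

(** The ideal (f, x_1^q, ..., x_n^q). *)
Definition frob_pre q : set S := [set s | exists h g, frob_ideal q g /\ s = h * f + g].

(** Taking q-th powers is additive, and the elements of the maximal ideal are
    combinations of the variables; so the q-th powers of the variables generate.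
    *)
Lemma frob_gensE p e : p \in [pchar k] ->
  ideal_gen (@frob_gens p A e) = pi @` frob_pre (p ^ e).
Proof.
move=> pk; have pS := ps_charp n pk; set q := (p ^ e)%N.
have pA : p \in [pchar A].
  by have := rmorph_pchar pi pS.
have piF : pi f = 0 by apply/pi_ker; exists 1; rewrite mul1r.
have [F0 FD FM] := frob_ideal_ideal n k q.
have frI : is_ideal (frob_pre q).
  split.
  - by exists 0, 0; rewrite mul0r addr0.
  - move=> _ _ [h [g [gF ->]]] [h' [g' [gF' ->]]].
    exists (h + h'), (g + g'); split; first exact: FD.
    by rewrite mulrDl addrACA.
  move=> a _ [h [g [gF ->]]]; exists (a * h), (a * g); split; first exact: FM.
  by rewrite mulrDr mulrA.
apply: ideal_genP; first exact: image_ideal.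
  move=> _ [a + <-]; rewrite max_idealE => -[s s0 <-].
  have [G GE] := max_vars s0.
  exists (s ^+ q); last by rewrite rmorphXn.
  exists 0, (s ^+ q); split; last by rewrite mul0r add0r.
  by exists (fun i => G i ^+ q); rewrite GE expr_sum_pchar //;
    apply: eq_bigr => i _; rewrite exprMn.
move=> _ [_ [h [_ [[G ->] ->]]] <-].
rewrite rmorphD rmorphM piF mulr0 add0r rmorph_sum.
apply: ideal_sum (ideal_gen_ideal _) _ => i _.
have [_ _ H] := ideal_gen_ideal (@frob_gens p A e).
rewrite rmorphM mulrC; apply: H; apply: sub_ideal_gen.
exists (pi (ps_var k i)); last by rewrite rmorphXn.
by rewrite max_idealE; exists (ps_var k i) => //; apply: ps_var0E.
Qed.

End Local.

(** * Hilbert-Kunz function and kernel dimension *)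

(** Take a subspace of maximal dimension inside P. *)
Lemma pred_vspace (k : fieldType) (V : vectType k) (P : V -> Prop) :
  P 0 -> (forall a u v, P u -> P v -> P (a *: u + v)) ->
  exists U : {vspace V}, forall v, v \in U <-> P v.
Proof.
move=> P0 PL.
pose Q d := `[< exists U : {vspace V}, \dim U = d /\ forall v, v \in U -> P v >].
have Q0 : exists d, Q d.
  exists 0%N; apply/asboolP; exists 0%VS; split=> [|v]; first exact: dimv0.
  by rewrite memv0 => /eqP->.
have Qb d : Q d -> (d <= \dim {:V})%N.
  by move=> /asboolP[U [<- _]]; apply/dimvS/subvf.
case: (ex_maxnP Q0 Qb) => d /asboolP[U [dU UP]] dmax.
exists U => v; split=> [/UP //|Pv].
have Q' : Q (\dim (U + <[v]>)).
  apply/asboolP; exists (U + <[v]>)%VS;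
    split=> // w /memv_addP[u uU [x /vlineP[a ->] ->]].
  by rewrite addrC; apply: PL => //; apply: UP.
have : (U + <[v]>)%VS = U.
  by apply/esym/eqP; rewrite eqEdim addvSl /= dU dmax.
by move=> <-; apply: (subvP (addvSr _ _)); apply: memv_line.
Qed.

Section Length.
Variables (n : nat) (k : fieldType) (f : powser n k) (f0 : f mnm0 = 0).
Local Notation S := (powser n k).
Local Notation A := (hypersurface f0).
(* rho presents k[[x_1, ..., x_n]]/(x_1^q, ..., x_n^q) as a finite dimensional
   space, on which op M is multiplication by f *)
Variables (q : nat) (M : opspace k) (rho : S -> sp M).
Hypothesis rhoD : forall s t, rho (s + t) = rho s + rho t.
Hypothesis rhoZ : forall c s, rho (ps_const c * s) = c *: rho s.
Hypothesis rho_onto : forall v, exists s, rho s = v.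
Hypothesis rho_ker : forall s, rho s = 0 <-> frob_ideal q s.
Hypothesis rhoM : forall s, rho (f * s) = op M (rho s).

Lemma rho0 : rho 0 = 0.
Proof. by apply: (@addrI _ (rho 0)); rewrite -rhoD !addr0. Qed.

Lemma rhoB s t : rho (s - t) = rho s - rho t.
Proof. by apply: (@addIr _ (rho t)); rewrite -rhoD !subrK. Qed.

Lemma frob_pre_rho s : frob_pre f q s <-> exists v, rho s = op M v.
Proof.
split=> [[h [g [/rho_ker gF ->]]]|[v sv]].
  by exists (rho h); rewrite rhoD gF addr0 mulrC rhoM.
have [h hv] := rho_onto v; exists h, (s - h * f); split; last by rewrite addrC subrK.
by apply/rho_ker; rewrite rhoB mulrC rhoM hv sv subrr.
Qed.

Let C' (I : set S) := is_ideal I /\ frob_pre f q `<=` I.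

Lemma ideal_vspace I : C' I -> exists U : {vspace sp M},
  forall s, (rho s \in U) <-> I s.
Proof.
move=> [[I0 ID IM] FI].
have [||U HU] := @pred_vspace k (sp M) (fun v => exists2 s, I s & rho s = v).
- by exists 0; rewrite ?rho0.
- move=> a _ _ [s Is <-] [t It <-]; exists (ps_const a * s + t).
    by apply: ID => //; apply: IM.
  by rewrite rhoD rhoZ.
exists U => s; rewrite HU; split=> [[t It ts]|Is]; last by exists s.
rewrite -(subrK t s); apply: ID => //; apply: FI.
exists 0, (s - t); split; last by rewrite mul0r add0r.
by apply/rho_ker; rewrite rhoB ts subrr.
Qed.

(** The image of I under rho. *)
Definition vsp I : {vspace sp M} :=
  if pselect (C' I) is left H then sval (cid (ideal_vspace H)) else 0%VS.

Lemma vspP I s : C' I -> (rho s \in vsp I) <-> I s.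
Proof. by rewrite /vsp; case: pselect => // H _; case: cid => U /=. Qed.

Let Kpre : set S := frob_pre f q.

Lemma Kpre_C' : C' Kpre.
Proof.
split=> //; have [F0 FD FM] := frob_ideal_ideal n k q; split.
- by exists 0, 0; rewrite mul0r addr0.
- move=> _ _ [h [g [gF ->]]] [h' [g' [gF' ->]]].
  exists (h + h'), (g + g'); split; first exact: FD.
  by rewrite mulrDl addrACA.
move=> a _ [h [g [gF ->]]]; exists (a * h), (a * g); split; first exact: FM.
by rewrite mulrDr mulrA.
Qed.

Lemma vsp_Kpre : vsp Kpre = limg (op M).
Proof.
apply/vspaceP => v; have [s <-] := rho_onto v.
apply/idP/memv_imgP => [/(vspP _ Kpre_C')/frob_pre_rho[w ->]|[w _ sw]].
  by exists w; rewrite ?memvf.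
by apply/(vspP _ Kpre_C')/frob_pre_rho; exists w.
Qed.

Lemma ker_dim_limg : (ker_dim M 1 + \dim (limg (op M)) = op_dim M)%N.
Proof.
rewrite -[op_dim M](limg_ker_dim (op M)) capfv; congr (\dim _ + _)%N.
by apply/vspaceP => v; rewrite mem_ker_pow memv_ker.
Qed.

Lemma dim_vsp_lt I I' : C' I -> C' I' -> I `<` I' -> (\dim (vsp I) < \dim (vsp I'))%N.
Proof.
move=> CI CI' [sub ne].
have subU : (vsp I <= vsp I')%VS.
  by apply/subvP => v; have [s <-] := rho_onto v; move=> /(vspP _ CI)/sub/(vspP _ CI').
rewrite ltn_neqAle dimvS // andbT; apply/eqP => E; apply: ne => s /(vspP _ CI').
by have /eqP <- : (vsp I == vsp I')%VS; [rewrite eqEdim subU E leqnn|move/(vspP _ CI)].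
Qed.

(** A monomial of maximal degree outside I is multiplied into I by each
    variable, so that only its multiples by constants are new. *)
Lemma ideal_step I : C' I -> (\dim (vsp I) < op_dim M)%N ->
  exists I', [/\ C' I', I `<` I' & \dim (vsp I') = (\dim (vsp I)).+1].
Proof.
move=> CI dI; have [II FI] := CI; have [I0 ID IM] := II.
have I1 : ~ I 1.
  move=> I1; move: dI; rewrite ltnNge; apply/negP/negPn; rewrite /op_dim dimvS //.
  apply/subvP => v _; have [s <-] := rho_onto v; apply/(vspP _ CI).
  by rewrite -[s]mulr1; apply: IM.
pose P d := `[< exists a : multinom n, mdeg a = d /\ ~ I (ps_mon k a) >].
have P0 : exists d, P d.
  by exists 0%N; apply/asboolP; exists mnm0; rewrite mdeg0 ps_mon0.
have Pb d : P d -> (d <= n * q)%N.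
  move=> /asboolP[a [<- Ia]]; rewrite leqNgt; apply/negP => ad; apply: Ia.
  apply: FI; exists 0, (ps_mon k a); split; last by rewrite mul0r add0r.
  apply/frob_idealP => m mq; rewrite /ps_mon; case: eqP => // ma.
  move: ad; rewrite ltnNge mdegE -ma -[X in (X * q)%N](card_ord n) -sum_nat_const
    => /negP[].
  by apply: leq_sum => i _; apply: ltnW.
case: (ex_maxnP P0 Pb) => d /asboolP[a [ad Ia]] dmax.
have Ix i : I (ps_var k i * ps_mon k a).
  apply: contrapT => nI; have : P d.+1.
    apply/asboolP; exists (mnm_add (mnm1 i) a); rewrite mdegD mdeg1 ad; split=> //.
    by rewrite ps_monD.
  by move/dmax; rewrite ltnn.
pose I' : set S := [set s | exists c, I (s - ps_const c * ps_mon k a)].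
have II' s : I s -> I' s by move=> Is; exists 0; rewrite rmorph0 mul0r subr0.
have Ia' : I' (ps_mon k a) by exists 1; rewrite rmorph1 mul1r subrr.
have CI' : C' I'.
  split; last by move=> s /FI/II'.
  split; first exact: II'.
    move=> s t [c Ic] [c' Ic']; exists (c + c').
    by rewrite rmorphD mulrDl opprD addrACA; apply: ID.
  move=> g s [c Ic]; exists (g mnm0 * c).
  have -> : g * s - ps_const (g mnm0 * c) * ps_mon k a =
     g * (s - ps_const c * ps_mon k a) +
     ps_const c * ((g - ps_const (g mnm0)) * ps_mon k a).
    by rewrite rmorphM; ring.
  apply: ID; first exact: IM.
  have [|G GE] := @max_vars n k (g - ps_const (g mnm0)).
    by rewrite ps_subE /ps_const eqxx subrr.
  apply: (IM); rewrite GE mulr_suml; apply: ideal_sum => // i _.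
  by rewrite mulrAC mulrC; apply: IM.
have IsI' : I `<` I' by split=> // /(_ _ Ia').
exists I'; split=> //; apply/eqP; rewrite eqn_leq (dim_vsp_lt CI CI' IsI') andbT.
have sub : (vsp I' <= vsp I + <[rho (ps_mon k a)]>)%VS.
  apply/subvP => v; have [s <-] := rho_onto v; move=> /(vspP _ CI')[c Ic].
  rewrite -(subrK (ps_const c * ps_mon k a) s) rhoD rhoZ.
  by apply: memv_add; [apply/(vspP _ CI)|rewrite memvZ // memv_line].
apply: leq_trans (dimvS sub) _.
have := dimv_sum_cap (vsp I) <[rho (ps_mon k a)]>; rewrite dim_vline.
by case: (_ != 0); lia.
Qed.

(** The ideals correspond to subspaces that contain the image of f, and chains
    can be refined to steps of dimension one. So the supremum is the dimension
    of the cokernel of f, which is that of its kernel. *)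
Lemma sup_ideal_chains : supremum 0%N (chain_lengths C') = ker_dim M 1.
Proof.
have dK : (\dim (vsp Kpre) + ker_dim M 1 = op_dim M)%N by rewrite vsp_Kpre addnC
  ker_dim_limg.
apply: supremum_nat.
  have H l : (l <= ker_dim M 1)%N -> exists c : nat -> set S,
     [/\ forall i, (i <= l)%N -> C' (c i), forall i, (i < l)%N -> c i `<` c i.+1
       & \dim (vsp (c l)) = (\dim (vsp Kpre) + l)%N].
    elim: l => [|l IH] ll.
      by exists (fun=> Kpre); split=> // [i _|]; [exact: Kpre_C'|rewrite addn0].
    have [c [cC cS cd]] := IH (ltnW ll).
    have [|I [CI sI dI]] := @ideal_step (c l) (cC l (leqnn l)); first by lia.
    exists (fun i => if (i <= l)%N then c i else I); split.
    - by move=> i _; case: ifP => // il; apply: cC.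
    - move=> i; rewrite ltnS => il; rewrite il;
      case: (ltngtP i l) il => // [il _|-> _] //.
        exact: cS.
    by rewrite ltnn dI cd addnS.
  by have [c [cC cS _]] := H _ (leqnn _); exists c.
move=> l [c [cC cS]].
have H i : (i <= l)%N -> (\dim (vsp Kpre) + i <= \dim (vsp (c i)))%N.
  elim: i => [|i IH] il.
    rewrite addn0; apply: dimvS; apply/subvP => v; have [s <-] := rho_onto v.
    by move=> /(vspP _ Kpre_C'); have := cC 0%N il => C0 Ks; apply/(vspP _ C0);
      case: C0 => _; apply.
  rewrite addnS; apply: leq_ltn_trans (IH (ltnW il)) _.
  by apply: dim_vsp_lt; [apply: cC; apply: ltnW|apply: cC|apply: cS].
have := leq_trans (H l (leqnn l)) (dimvS (subvf (vsp (c l)))).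
by rewrite -/(op_dim M); lia.
Qed.

Lemma HK_ker_dim p e : p \in [pchar k] -> q = (p ^ e)%N -> HK p A e = ker_dim M 1.
Proof.
move=> pk qE; rewrite -sup_ideal_chains /HK /module_length; congr supremum.
have [pi [pi_onto pi_ker]] := hypersurface_pi f0.
have [th [thD thM th_onto th_ker]] := quot_module_pi (@frob_gens p A e).
have gE := frob_gensE pi_onto pi_ker e pk; rewrite -qE in gE.
have t0 s : th (pi s) = 0 <-> Kpre s.
  rewrite th_ker gE; split=> [[t [h [g [gF tE]]]]|Ks]; last by exists s.
  move/(pi_eq pi_ker) => [h' h'E]; exists (h - h'), g; split=> //.
  by rewrite mulrBl -h'E tE; ring.
have thB a b : th (a - b) = th a - th b.
  by apply: (@addIr _ (th b)); rewrite -thD !subrK.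
have th00 : th 0 = 0 by apply: (@addrI _ (th 0)); rewrite -thD !addr0.
apply: (@chain_lengths_onto _ _ (th \o pi)).
- by move=> x; have [a <-] := th_onto x; have [s <-] := pi_onto a; exists s.
- move=> N [N0 ND NM]; split; last by move=> s /t0 s0; rewrite /preimage /= s0.
  split; rewrite /preimage /=; first by rewrite rmorph0 th00.
    by move=> s t Ns Nt; rewrite rmorphD thD; apply: ND.
  by move=> a s Ns; rewrite rmorphM thM; apply: NM.
move=> I [[I0 ID IM] FI]; split.
  split; first by exists 0 => //=; rewrite rmorph0 th00.
    move=> _ _ [s Is <-] [t It <-]; exists (s + t); first exact: ID.
    by rewrite /= rmorphD thD.
  move=> a _ [s Is <-]; have [t <-] := pi_onto a; exists (t * s); first exact: IM.
  by rewrite /= rmorphM thM.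
move=> s s' /= E Is; rewrite -(subrK s s'); apply: ID => //; apply: FI; apply/t0.
by rewrite rmorphB thB E subrr.
Qed.

End Length.

(** * Multiplication by sums of monomials in separate variables *)

Section Model.
Variables (n : nat) (k : fieldType) (q : nat).
Local Notation S := (powser n k).
Implicit Types (vs : pred 'I_n) (g h : S) (m : multinom n).

Definition mnm_pow (v : 'I_n) a : multinom n := mnm_muln (mnm1 v) a.

Lemma mnm_powE v a i : mnm_pow v a i = if v == i then a else 0%N.
Proof. by rewrite mulmnE mnm1E; case: eqP; rewrite ?mul1n ?mul0n. Qed.

(** Restricted to multi-indices not involving v, this is the coefficient of v^a.
    *)
Definition coef_shift v a g : S := fun m => g (mnm_add m (mnm_pow v a)).

Arguments coef_shift : simpl never.

(** The exponents of the monomials in the variables of vs that are not divisible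
    by a q-th power. *)
Definition box vs m := forall i, if vs i then is_true (m i < q)%N else m i = 0%N.

(** This says that h does not involve v, in a form which is evidently stable
    under sums and products. *)
Definition indep_of v h := forall a g, coef_shift v a (h * g) = h * coef_shift v a g.

(** The map rho takes a series to its class modulo the q-th powers of the
    variables of vs and the first powers of the others; h, a series in the
    variables of vs, acts on the classes by op N. *)
Record model vs (N : opspace k) (h : S) (rho : S -> sp N) : Prop := Model {
  mD : forall s t, rho (s + t) = rho s + rho t;
  mZ : forall c s, rho (ps_const c * s) = c *: rho s;
  m_onto : forall v, exists s, rho s = v;
  m_ker : forall s, rho s = 0 <-> (forall m, box vs m -> s m = 0);
  mM : forall s, rho (h * s) = op N (rho s);
  m_indep : forall v, ~~ vs v -> indep_of v h }.

Lemma model_eq vs vs' N h rho : vs =1 vs' -> model vs (N := N) h rho ->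
  model vs' (N := N) h rho.
Proof.
move=> E [D Zc on ker M fr]; split=> //.
- move=> s; rewrite ker; split=> H m mb; apply: H => i; have := mb i; by rewrite E.
- by move=> v; rewrite -E; apply: fr.
Qed.

Section Ker.
Variables (vs : pred 'I_n) (N : opspace k) (h : S) (rho : S -> sp N).
Hypothesis H : model vs h rho.

Lemma model_eqP s t : rho s = rho t <-> (forall m, box vs m -> s m = t m).
Proof.
have B : rho (s - t) = rho s - rho t.
  by apply: (@addIr _ (rho t)); rewrite -(mD H) !subrK.
split=> [st m mb|st].
  have /(m_ker H)/(_ m mb) : rho (s - t) = 0 by rewrite B st subrr.
  by rewrite ps_subE => /eqP; rewrite subr_eq0 => /eqP.
apply/eqP; rewrite -subr_eq0 -B; apply/eqP/(m_ker H) => m mb.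
by rewrite ps_subE st ?subrr.
Qed.
End Ker.

Lemma coef_shiftD v a s t : coef_shift v a (s + t) = coef_shift v a s +
  coef_shift v a t.
Proof. by []. Qed.

Lemma coef_shiftZ v a c s : coef_shift v a (ps_const c * s) =
  ps_const c * coef_shift v a s.
Proof. by apply: ps_ext => m; rewrite /coef_shift !ps_constE. Qed.

Lemma indep_ofD v h h' : indep_of v h -> indep_of v h' -> indep_of v (h + h').
Proof. by move=> fh fh' a g; rewrite !mulrDl coef_shiftD fh fh'. Qed.

Lemma indep_ofM v h h' : indep_of v h -> indep_of v h' -> indep_of v (h * h').
Proof. by move=> fh fh' a g; rewrite -!mulrA fh fh'. Qed.

Lemma indep_of_var v w : v != w -> indep_of v (ps_var k w).
Proof.
move=> vw a g; apply: ps_ext => m;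
  rewrite /coef_shift !ps_varE mnmDE mnm_powE (negPf vw) addn0.
case: ifP => // m0; congr g; apply/mnmP => i; rewrite !(mnmBE, mnmDE) mnm_powE mnm1E.
case: (w =P i) => [<-|_]; first by rewrite (negPf vw) !addn0.
by case: (v == i); rewrite /=; lia.
Qed.

Lemma indep_ofX v h r : indep_of v h -> indep_of v (h ^+ r).
Proof.
move=> fh; elim: r => [|r IH]; first by move=> a g; rewrite !mul1r.
by rewrite exprS; apply: indep_ofM.
Qed.

Definition const_coef (g : S) : k^o := g mnm0.

Lemma model_zero : model pred0 (N := zero_line k) 0 const_coef.
Proof.
split=> //.
- by move=> c s; rewrite /const_coef ps_constE.
- by move=> v; exists (ps_const v); rewrite /const_coef /ps_const eqxx.
- move=> s; split=> [s0 m mb|]; last by apply=> i; rewrite mnm0E.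
  by rewrite (_ : m = mnm0) //; apply/mnmP => i; rewrite mnm0E (mb i).
- by move=> s; rewrite mul0r /= lfunE.
by move=> v _ a g; rewrite !mul0r.
Qed.

Section Step1.
Variables (vs : pred 'I_n) (N : opspace k) (h : S) (rho : S -> sp N).
Hypothesis H : model vs h rho.
Variables (v : 'I_n) (r : nat).
Hypotheses (vvs : ~~ vs v) (r0 : (0 < r)%N).

(** The classes of the coefficients of v^a, a < q. *)
Definition coefs1 (g : S) : {ffun 'I_q -> sp N} :=
  [ffun a : 'I_q => rho (coef_shift v a g)].

Lemma box_v m : box vs m -> m v = 0%N.
Proof. by move=> /(_ v); rewrite (negPf vvs). Qed.

Lemma model_add_power : model (predU1 v vs) (N := add_shift (@prev1 q r) N)
  (h + ps_var k v ^+ r) coefs1.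
Proof.
split.
- by move=> s t; apply/ffunP => a; rewrite !ffunE coef_shiftD (mD H).
- by move=> c s; apply/ffunP => a; rewrite !ffunE coef_shiftZ (mZ H).
- move=> w; have /choice[G GE] : forall a : 'I_q, exists s, rho s = w a.
    by move=> a; apply: (m_onto H).
  exists (fun m => if insub (m v) is Some a then G a (mnm_sub m (mnm_pow v (m v)))
    else 0).
  apply/ffunP => a; rewrite ffunE -GE; apply/(model_eqP H) => m /box_v mv.
  rewrite /coef_shift mnmDE mnm_powE eqxx mv add0n valK; congr (G a); apply/mnmP => i.
  by rewrite mnmBE mnmDE addnK.
- move=> s; split=> [/ffunP s0 m mb|s0].
    have mq : (m v < q)%N by have := mb v; rewrite /= eqxx.
    have := s0 (Ordinal mq); rewrite !ffunE =>
      /(m_ker H)/(_ (mnm_sub m (mnm_pow v (m v)))).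
    have e : mnm_add (mnm_sub m (mnm_pow v (m v))) (mnm_pow v (m v)) = m.
      by apply/mnmP => i; rewrite mnmDE mnmBE mnm_powE; case: eqP => [->|_];
        rewrite ?subnK ?subn0 ?addn0.
    rewrite /coef_shift /= e; apply=> i; rewrite mnmBE mnm_powE; have := mb i;
      rewrite /= eq_sym.
    case: (v =P i) => [<-|_] /=; first by rewrite (negPf vvs) subnn.
    by rewrite subn0.
  apply/ffunP => a; rewrite !ffunE; apply/(m_ker H) => m mb; apply: s0 => i /=.
  rewrite mnmDE mnm_powE eq_sym; case: (v =P i) => [<-|_] /=;
    last by rewrite addn0; apply: mb.
  by rewrite (box_v mb) add0n.
- move=> s; apply/ffunP => a; rewrite ffunE add_shiftE mulrDl coef_shiftD (mD H).
  rewrite (m_indep H) // (mM H) ffunE; congr (_ + _).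
  case E: (prev1 r a) => [b|].
    move/prev1_some: E => E; rewrite ffunE; apply/(model_eqP H) => m /box_v mv.
    rewrite /coef_shift ps_varXE mnmDE mnm_powE eqxx mv add0n E leq_addl; congr s.
    by apply/mnmP => i; rewrite -/(mnm_pow v r) !(mnmBE, mnmDE) !mnm_powE;
      case: (v == i); lia.
  move/prev1_none: E => E; apply/(m_ker H) => m /box_v mv.
  by rewrite /coef_shift ps_varXE mnmDE mnm_powE eqxx mv add0n leqNgt E.
move=> w; rewrite /= negb_or => /andP[wv wvs]; apply: indep_ofD;
  first exact: (m_indep H).
exact/indep_ofX/indep_of_var.
Qed.
End Step1.

Section Step2.
Variables (vs : pred 'I_n) (N : opspace k) (h : S) (rho : S -> sp N).
Hypothesis H : model vs h rho.
Variables (v w : 'I_n).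
Hypotheses (vvs : ~~ vs v) (wvs : ~~ vs w) (vw : v != w).

Definition coefs2 (g : S) : {ffun 'I_q * 'I_q -> sp N} :=
  [ffun ab : 'I_q * 'I_q => rho (coef_shift v ab.1 (coef_shift w ab.2 g))].

Lemma model_add_product : model (predU1 v (predU1 w vs)) (N := xytensor q 1 N)
  (h + ps_var k v * ps_var k w) coefs2.
Proof.
have wv : (w == v) = false by rewrite eq_sym (negPf vw).
split.
- by move=> s t; apply/ffunP => a; rewrite !ffunE !coef_shiftD (mD H).
- by move=> c s; apply/ffunP => a; rewrite !ffunE !coef_shiftZ (mZ H).
- move=> u; have /choice[G GE] : forall a : 'I_q * 'I_q, exists s, rho s = u a.
    by move=> a; apply: (m_onto H).
  exists (fun m => if insub (m v) is Some a then if insub (m w) is Some b then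
     G (a, b) (mnm_sub (mnm_sub m (mnm_pow v (m v))) (mnm_pow w (m w))) else 0 else 0).
  apply/ffunP => -[a b]; rewrite ffunE -GE; apply/(model_eqP H) => m mb.
  have mv := box_v vvs mb; have mw := box_v wvs mb.
  rewrite /coef_shift /= !mnmDE !mnm_powE !eqxx (negPf vw) wv mv mw !add0n !addn0
    !valK; congr (G _).
  apply/mnmP => i; rewrite !(mnmBE, mnmDE) !mnm_powE.
  by case: (v =P i) => [<-|_]; rewrite ?wv; lia.
- move=> s; split=> [/ffunP s0 m mb|s0].
    have mv : (m v < q)%N by have := mb v; rewrite /= eqxx.
    have mw : (m w < q)%N by have := mb w; rewrite /= eqxx orbT.
    have := s0 (Ordinal mv, Ordinal mw); rewrite !ffunE.
    move=> /(m_ker H)/(_ (mnm_sub (mnm_sub m (mnm_pow v (m v))) (mnm_pow w (m w)))).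
    rewrite /coef_shift /= (_ : mnm_add _ _ = m); last first.
      apply/mnmP => i; rewrite !(mnmBE, mnmDE) !mnm_powE.
      by case: (v =P i) => [<-|_]; [rewrite wv; lia|case: (w =P i) => [<-|_]; lia].
    apply=> i; rewrite !mnmBE !mnm_powE; have := mb i; rewrite /= ![i == _]eq_sym.
    case: (v =P i) => [<-|_] /=; first by rewrite (negPf vvs) subnn.
    case: (w =P i) => [<-|_] /=; first by rewrite (negPf wvs) subn0 subnn.
    by rewrite !subn0.
  apply/ffunP => -[a b]; rewrite !ffunE; apply/(m_ker H) => m mb; apply: s0 => i /=.
  rewrite !mnmDE !mnm_powE ![i == _]eq_sym; have := mb i.
  case: (v =P i) => [<-|_] /=; first by rewrite (negPf vvs) wv => ->;
    rewrite addn0 add0n.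
  case: (w =P i) => [<-|_] /=; first by rewrite (negPf wvs) => ->; rewrite addn0 add0n.
  by rewrite !addn0.
- move=> s; apply/ffunP => -[a b];
  rewrite ffunE add_shiftE mulrDl /= (coef_shiftD w) (coef_shiftD v) (mD H).
  rewrite (m_indep H wvs) (m_indep H vvs) (mM H) ffunE /=; congr (_ + _).
  case E: (prev2 1 (a, b)) => [[a' b']|].
    move/prev2_some: E => /= -[E1 E2]; rewrite ffunE /=; apply/(model_eqP H) => m mb.
    have mv := box_v vvs mb; have mw := box_v wvs mb.
    rewrite /coef_shift -mulrA !ps_varE !(mnmDE, mnmBE) !mnm_powE !mnm1E !eqxx
      (negPf vw) wv mv mw.
    rewrite !addn0 !add0n subn0 E1 E2 !addn1 /=; congr s.
    apply/mnmP => i; rewrite !(mnmBE, mnmDE) !mnm_powE !mnm1E.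
    by case: (v =P i) => [<-|_]; [rewrite wv; lia|case: (w =P i) => [<-|_]; lia].
  move/prev2_none: E => /= E; apply/(m_ker H) => m mb.
  have mv := box_v vvs mb; have mw := box_v wvs mb.
  rewrite /coef_shift -mulrA !ps_varE !(mnmDE, mnmBE) !mnm_powE !mnm1E !eqxx
    (negPf vw) wv mv mw.
  by rewrite !addn0 !add0n subn0; case: ifP => // a0; case: ifP => // b0; lia.
move=> u; rewrite /= !negb_or => /and3P[uv uw uvs]; apply: indep_ofD;
  first exact: (m_indep H).
by apply: indep_ofM; apply: indep_of_var.
Qed.
End Step2.

Lemma model_full vs N h rho : model vs (N := N) h rho -> vs =1 predT ->
  forall s, rho s = 0 <-> frob_ideal q s.
Proof.
move=> H vsT s; rewrite (m_ker H) frob_idealP.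
by split=> E m mq; apply: E => i; have := mq i; rewrite vsT.
Qed.

End Model.

Section Hyperbolic.
Variables (k : fieldType) (d q : nat).
Local Notation x := (fun i : nat => ps_var k (inord i : 'I_d.+1)).

Lemma model_hyperbolic m : (m.*2 <= d.+1)%N ->
  exists rho, @model d.+1 k q (fun i : 'I_d.+1 => i < m.*2)%N (hyperbolic_op k q 1 m)
    (@hyperbolic k d m) rho.
Proof.
elim: m => [|m IH] md.
  exists (@const_coef _ _); rewrite /hyperbolic big_geq //.
  exact: (model_eq _ (model_zero _ _ _)).
have [|rho H] := IH; first by apply: leq_trans md; rewrite doubleS; lia.
have l1 : (m.*2 < d.+1)%N by rewrite doubleS in md; lia.
have l2 : (m.*2.+1 < d.+1)%N by rewrite doubleS in md; lia.
have := model_add_product H (v := inord m.*2) (w := inord m.*2.+1).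
rewrite -!val_eqE /= !inordK // ltnn ltnNge leqnSn => /(_ isT isT) H2.
exists (coefs2 q rho (inord m.*2) (inord m.*2.+1)).
rewrite /hyperbolic big_nat_recr //=; apply: model_eq (H2 _).
  by move=> i /=; rewrite -!val_eqE /= !inordK // doubleS; lia.
by lia.
Qed.

Lemma pred_top (vs : pred 'I_d.+1) (v : nat) : (v <= d)%N ->
  (forall i : 'I_d.+1, (i < v)%N -> vs i) -> (forall i : 'I_d.+1, (v < i)%N -> vs i) ->
  predU1 (inord v) vs =1 predT.
Proof.
move=> vd lo hi i /=; rewrite -val_eqE /= inordK ?ltnS //.
by case: ltngtP => // [/lo|/hi] ->; rewrite ?orbT.
Qed.

End Hyperbolic.

Lemma HK_model n (k : fieldType) (f : powser n k) (f0 : f mnm0 = 0) p e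
    (N : opspace k) (vs : pred 'I_n) (rho : powser n k -> sp N) :
  p \in [pchar k] -> model (p ^ e) vs f rho -> vs =1 predT ->
  HK p (hypersurface f0) e = ker_dim N 1.
Proof.
move=> pk H vT; apply: (HK_ker_dim f0 (mD H) (mZ H) (m_onto H) _ (mM H) pk erefl).
exact: model_full H vT.
Qed.

Lemma double_half_even d : ~~ odd d -> (d./2).*2 = d.
Proof. by move=> de; rewrite -[RHS]odd_double_half (negPf de). Qed.

Lemma double_half_odd d : odd d -> (d./2).*2.+1 = d.
Proof. by move=> de; rewrite -[RHS]odd_double_half de. Qed.

Lemma HK_R2_even d e : ~~ odd d ->
  HK 2 (R2 d) e.+1 = ((2 ^ e) ^ d * (4 ^ d./2 + 2 ^ d./2))%N.
Proof.
move=> de; have d2 := double_half_even de.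
have p2 : 2 \in [pchar 'F_2] by apply: pchar_Fp.
have [|rho H] := @model_hyperbolic 'F_2 d (2 ^ e.+1) d./2; first by rewrite d2.
have nd : ~~ ((inord d : 'I_d.+1) < d./2.*2)%N by rewrite d2 inordK // ltnn.
have H1 := model_add_power H (v := inord d) (r := 2) nd isT.
have fE : @Qd 'F_2 d = @hyperbolic 'F_2 d d./2 + ps_var 'F_2 (inord d) ^+ 2.
  by rewrite /Qd (negPf de).
rewrite -fE in H1; rewrite (HK_model (Qd0E 'F_2 d) p2 H1).
  by rewrite ker_dim_Q_even // mul2n d2.
by apply: pred_top => // i /=; rewrite ?d2 // ltnNge -ltnS ltn_ord.
Qed.

Lemma HK_R2_odd d e : odd d ->
  (2 ^ e * HK 2 (R2 d) e =
   (2 ^ e) ^ d.+1 + (2 ^ e) ^ (d./2).+1 * \sum_(i < e) 2 ^ (i * (d./2).+1))%N.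
Proof.
move=> dodd; have d2 := double_half_odd dodd.
have p2 : 2 \in [pchar 'F_2] by apply: pchar_Fp.
have [|rho H] := @model_hyperbolic 'F_2 d (2 ^ e) (d./2).+1;
  first by rewrite doubleS d2.
have fE : @Qd 'F_2 d = @hyperbolic 'F_2 d (d./2).+1.
  by rewrite /Qd dodd; congr hyperbolic; rewrite -[in LHS]d2 -doubleS doubleK.
rewrite -fE in H; rewrite (HK_model (Qd0E 'F_2 d) p2 H).
  by rewrite ker_dim_Q_odd // mul2n doubleS d2.
by move=> i; rewrite doubleS d2 ltn_ord.
Qed.

Lemma HK_S3_even d e : ~~ odd d -> (2 <= d)%N ->
  (2 * HK 3 (S3 d) e.+1 = (3 ^ e) ^ d * (2 * 9 ^ d./2 + 3 * 4 ^ d./2))%N.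
Proof.
move=> de dd; have d2 := double_half_even de.
have p3 : 3 \in [pchar 'F_3] by apply: pchar_Fp.
have [|rho H] := @model_hyperbolic 'F_3 d (3 ^ e.+1) d./2; first by rewrite d2.
have nd : ~~ ((inord d : 'I_d.+1) < d./2.*2)%N by rewrite d2 inordK // ltnn.
have H1 := model_add_power H (v := inord d) (r := 3) nd isT.
have fE : @Pd 'F_3 d = @hyperbolic 'F_3 d d./2 + ps_var 'F_3 (inord d) ^+ 3.
  by rewrite /Pd (negPf de).
rewrite -fE in H1; rewrite (HK_model (Pd0E 'F_3 d) p3 H1).
  have dE : d./2 = (d./2).-1.+1 by rewrite prednK // half_gt0.
  by rewrite dE ker_dim_P_even // -dE mul2n d2.
by apply: pred_top => // i /=; rewrite ?d2 // ltnNge -ltnS ltn_ord.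
Qed.

Lemma HK_S3_odd d e : odd d ->
  HK 3 (S3 d) e.+1 = (3 * (3 ^ e) ^ d * (9 ^ d./2 + 4 ^ d./2))%N.
Proof.
move=> dodd; have d2 := double_half_odd dodd.
have p3 : 3 \in [pchar 'F_3] by apply: pchar_Fp.
have [|rho H] := @model_hyperbolic 'F_3 d (3 ^ e.+1) d./2; first by lia.
have dm : d.-1 = d./2.*2 by lia.
have nd : ~~ ((inord d.-1 : 'I_d.+1) < d./2.*2)%N by rewrite inordK dm ?ltnn //; lia.
have H1 := model_add_power H (v := inord d.-1) (r := 2) nd isT.
have nd1 : ~~ (predU1 (inord d.-1) (fun i : 'I_d.+1 => (i < d./2.*2)%N) (inord d)).
  rewrite /= -val_eqE /= !inordK //; lia.
have H2 := model_add_power H1 (v := inord d) (r := 3) nd1 isT.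
have fE : @Pd 'F_3 d = @hyperbolic 'F_3 d d./2 + ps_var 'F_3 (inord d.-1) ^+ 2 +
  ps_var 'F_3 (inord d) ^+ 3.
  by rewrite /Pd dodd.
rewrite -fE in H2; rewrite (HK_model (Pd0E 'F_3 d) p3 H2).
  by rewrite ker_dim_P_odd // mul2n d2.
move=> i /=; rewrite -!val_eqE /= !inordK //; last lia.
by have := ltn_ord i; lia.
Qed.

(** * Substitution of power series *)

Section Subst.
Variables (n l : nat) (k : fieldType) (a : 'I_n -> powser l k).
Hypothesis a0 : forall i, a i mnm0 = 0.
Local Notation S := (powser n k).
Local Notation S' := (powser l k).

Let mm : mpoly n k -> S' := mmap (@ps_const l k) a.

Let mmB p q : mm (p - q) = mm p - mm q. Proof. exact: rmorphB. Qed.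
Let mmM p q : mm (p * q) = mm p * mm q. Proof. exact: rmorphM. Qed.

Lemma ord_ge_mmap1 (m : multinom n) : ord_ge (mdeg m) (mmap1 a m).
Proof.
rewrite mdegE /mmap1; elim/big_rec2: _ => [|i D g _ gD]; first exact: ord_ge_trivial.
by apply: ord_geM => //; rewrite -[X in ord_ge X _]muln1; apply: ord_geX;
  apply/ord_ge1P.
Qed.

Lemma ord_ge_mmap p N : (forall m, (mdeg m < N)%N -> mcoeff m p = 0) -> ord_ge N (mm p).
Proof.
move=> pN; rewrite /mm /mmap big_seq; apply: ord_ge_sum => m mp; apply: ord_geMl.
apply: (ord_ge_le _ (@ord_ge_mmap1 m)); rewrite leqNgt; apply/negP => /pN.
by apply/eqP; rewrite -mcoeff_msupp.
Qed.

(** The a i having no constant term, the coefficients of degree at most D of the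
    result only depend on those of g. *)
Definition ps_subst (g : S) : S' := fun m => mm (ps_trunc (mdeg m).+1 g) m.

Lemma ps_subst_mmap g p N : (forall m, (mdeg m < N)%N -> g m = mcoeff m p) ->
  ord_ge N (ps_subst g - mm p).
Proof.
move=> gp m mN; rewrite ps_subE /ps_subst -ps_subE -mmB;
  apply: ord_ge_mmap (ltnSn _) => i im.
rewrite raddfB /= mcoeff_trunc // gp ?subrr //.
by apply: leq_trans mN.
Qed.

Lemma ps_subst_eq g h : (forall N, ord_ge N (h - mm (ps_trunc N g))) -> ps_subst g = h.
Proof.
move=> H; apply: ord_ge_eq => N;
  rewrite -(subrK (mm (ps_trunc N g)) (ps_subst g)) -addrA.
apply: ord_geD; last by rewrite -opprB; apply: ord_geN.
by apply: ps_subst_mmap => m mN; rewrite mcoeff_trunc.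
Qed.

Lemma ps_subst_trunc g N : ord_ge N (ps_subst g - mm (ps_trunc N g)).
Proof. by apply: ps_subst_mmap => m mN; rewrite mcoeff_trunc. Qed.

Lemma ord_ge_mm_congr p q N : (forall m, (mdeg m < N)%N -> mcoeff m p = mcoeff m q) ->
  ord_ge N (mm p - mm q).
Proof.
by move=> pq; rewrite -mmB; apply: ord_ge_mmap => m mN; rewrite raddfB /= pq ?subrr.
Qed.

Lemma ps_substB f g : ps_subst (f - g) = ps_subst f - ps_subst g.
Proof.
apply: ps_subst_eq => N; set F := ps_trunc N f; set G := ps_trunc N g.
have -> : ps_subst f - ps_subst g - mm (ps_trunc N (f - g)) =
  (ps_subst f - mm F) - (ps_subst g - mm G) + (mm (F - G) - mm (ps_trunc N (f - g))).
  by rewrite (mmB F G); ring.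
apply: ord_geD; first by apply: ord_geB; apply: ps_subst_trunc.
by apply: ord_ge_mm_congr => m mN; rewrite raddfB /= !mcoeff_trunc.
Qed.

Lemma ps_substM f g : ps_subst (f * g) = ps_subst f * ps_subst g.
Proof.
apply: ps_subst_eq => N; set F := ps_trunc N f; set G := ps_trunc N g.
have -> : ps_subst f * ps_subst g - mm (ps_trunc N (f * g)) =
  (ps_subst f - mm F) * ps_subst g + mm F * (ps_subst g - mm G) +
  (mm (F * G) - mm (ps_trunc N (f * g))).
  by rewrite (mmM F G); ring.
apply: ord_geD; first by apply: ord_geD; [apply: ord_geMr|apply: ord_geMl];
  apply: ps_subst_trunc.
apply: ord_ge_mm_congr => m mN; rewrite mcoeff_trunc //.
by rewrite -ps_mul_trunc.
Qed.

Lemma ps_subst_const c : ps_subst (ps_const c) = ps_const c.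
Proof.
apply: ps_subst_eq => N; rewrite -(mmapC a (@ps_const l k) c).
by apply: ord_ge_mm_congr => m mN; rewrite mcoeff_trunc // mcoeffC /ps_const;
  case: eqP; rewrite ?mulr1 ?mulr0.
Qed.

Lemma ps_subst_var i : ps_subst (ps_var k i) = a i.
Proof.
apply: ps_subst_eq => N.
have -> : a i = mm (mpolyX k (mnm1 i)) by rewrite /mm mmapX mmap1U.
by apply: ord_ge_mm_congr => m mN; rewrite mcoeff_trunc // mcoeffX eq_sym.
Qed.

Lemma ord_ge_subst N g : ord_ge N g -> ord_ge N (ps_subst g).
Proof.
move=> gN; rewrite -[ps_subst g]subr0 -[X in _ - X](raddf0 (mmap (@ps_const l k) a)).
by apply: ps_subst_mmap => m mN; rewrite gN // mcoeff0.
Qed.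

Lemma substitution : exists phi : {rmorphism S -> S'},
  [/\ forall i, phi (ps_var k i) = a i, forall c, phi (ps_const c) = ps_const c,
      forall N g, ord_ge N g -> ord_ge N (phi g) &
      forall g m, phi g m = \sum_(i : bmultinom n (mdeg m).+1) g i * mmap1 a i m].
Proof.
have s1 : ps_subst 1 = 1 by exact: (ps_subst_const 1).
pose phi := HB.pack_for {rmorphism S -> S'} ps_subst
  (GRing.isZmodMorphism.Build _ _ _ ps_substB)
  (GRing.isMonoidMorphism.Build _ _ _ (s1, ps_substM)).
exists phi; split=> [i|c|N g|g m].
- exact: ps_subst_var.
- exact: ps_subst_const.
- exact: ord_ge_subst.
rewrite [LHS]/(ps_subst g m) /ps_subst /ps_trunc
  [mm _](raddf_sum (mmap (@ps_const l k) a)) ps_sumE.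
apply: eq_bigr => i _; rewrite -ps_constE; congr (_ m).
by rewrite -[LHS]/(mm _) -mul_mpolyC mmM /mm mmapC mmapX.
Qed.

End Subst.

(** * Weierstrass division without a regular variable *)

Fixpoint dot (w s : seq nat) : nat :=
  if w is x :: w' then if s is y :: s' then (x * y + dot w' s')%N else 0%N else 0%N.

Lemma dotE N w s : size w = N -> size s = N ->
  dot w s = (\sum_(i < N) nth 0%N w i * nth 0%N s i)%N.
Proof.
elim: N w s => [|N IH] [|x w] [|y s] //=; first by rewrite big_ord0.
by move=> [wN] [sN]; rewrite big_ord_recl /= (IH w s).
Qed.

Lemma min_nat (P : nat -> Prop) : (exists i, P i) ->
  exists2 i, P i & forall j, P j -> (i <= j)%N.
Proof.
move=> [i Pi]; have Q : exists i, `[< P i >] by exists i; apply/asboolP.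
by case: (ex_minnP Q) => j /asboolP Pj jmin; exists j => // l Pl; apply/jmin/asboolP.
Qed.

(** Take s0 lexicographically least. Weights are chosen from the last one
    backwards, each exceeding the weight of the rest of s0, so that a larger
    entry cannot be compensated by what follows. *)
Lemma separating_weights_seq n (P : seq nat -> Prop) :
  (exists2 s, size s = n.+1 & P s) ->
  exists w s0, [/\ size w = n.+1, all (ltn 0) w, last 0%N w = 1%N, size s0 = n.+1
    & P s0 /\ forall s, size s = n.+1 -> P s -> s <> s0 -> (dot w s0 < dot w s)%N].
Proof.
elim: n P => [|n IH] P [s sn Ps].
  have [|i Pi imin] := @min_nat (fun i => P [:: i]).
    by case: s sn Ps => [|i [|]] // _ Pi; exists i.
  exists [:: 1%N], [:: i]; split=> //; split=> // -[|j [|]] //= _ Pj ji.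
  rewrite !mul1n !addn0 ltn_neqAle imin // andbT; apply/eqP => ij.
  by rewrite ij in ji.
have [|i [s1 s1n Ps1] imin] :=
  @min_nat (fun i => exists2 s', size s' = n.+1 & P (i :: s')).
  by case: s sn Ps => [|i s'] //= [s'n] Ps'; exists i, s'.
have [|w [s0 [wn w0 w1 s0n [Ps0 s0min]]]] := IH (fun s' => P (i :: s'));
  first by exists s1.
exists ((dot w s0).+1 :: w), (i :: s0); split=> //=; try by rewrite ?wn ?s0n.
  by case: w wn w1 {s0min w0} => [|y w].
split=> // -[|j s'] //= [s'n] Ps' ne.
case: (ltngtP i j) => ij.
- by rewrite -(subnKC ij) !mulSn; nia.
- by have := imin j; rewrite leqNgt ij => /(_ (ex_intro2 _ _ s' s'n Ps')).
by subst j; rewrite ltn_add2l; apply: s0min => // ss; apply: ne; rewrite ss.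
Qed.

Section Weights.
Variables (n : nat) (k : fieldType).

(** When each x_i is replaced by a power t^(w_i) of one variable, only the term
    at m0 contributes to the lowest order of f, so that f does not become 0. *)
Lemma separating_weights (f : powser n.+1 k) : f <> 0 ->
  exists (w : 'I_n.+1 -> nat) (m0 : multinom n.+1),
  [/\ forall i, (0 < w i)%N, w ord_max = 1%N, f m0 != 0
    & forall m, f m != 0 -> m != m0 ->
      (\sum_i w i * m0 i < \sum_i w i * m i)%N].
Proof.
move=> f0.
have [|w [s0 [wn w0 w1 s0n [[m0 <- fm0] s0min]]]] :=
    @separating_weights_seq n (fun s => exists2 m :
      multinom n.+1, tval (multinom_val m) = s & f m != 0).
  have [m fm] : exists m, f m != 0.
    by apply: contrapT => H; apply: f0; apply: ps_ext => m;
      apply/eqP/negPn/negP => fm; apply: H; exists m.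
  by exists (tval (multinom_val m)); [rewrite size_tuple|exists m].
have dE (m : multinom n.+1) : dot w (tval (multinom_val m)) =
  (\sum_(i < n.+1) nth 0 w i * m i)%N.
  rewrite (dotE wn) ?size_tuple //; apply: eq_bigr => i _; by rewrite (mnm_nth 0%N).
exists (fun i => nth 0%N w i), m0; split=> //.
- by move=> i; apply: (allP w0); rewrite mem_nth // wn.
- by rewrite /= -[in nth _ _ n](_ : (size w).-1 = n) ?nth_last // wn.
move=> m fm mm0; rewrite -!dE; apply: s0min; first by rewrite size_tuple.
  by exists m.
by move=> E; case/eqP: mm0; apply: val_inj; apply: val_inj.
Qed.
End Weights.

Section Univariate.
Variable k : fieldType.
Local Notation U := (powser 1 k).
Local Notation t := (ps_var k (ord0 : 'I_1)).
(** The exponent of the M-th power of the only variable. *)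
Definition uni M : multinom 1 := mnm_muln (mnm1 ord0) M.

Lemma mdeg_uni M : mdeg (uni M) = M.
Proof. by rewrite mdegMn mdeg1 mul1n. Qed.

Lemma uni_powE e M : (t ^+ e) (uni M) = (M == e)%:R.
Proof.
rewrite -[t ^+ e]mulr1 ps_varXE mulmnE mnm1E eqxx mul1n -(ps_mon0 1 k) /ps_mon.
case: leqP => eM; last by rewrite (ltn_eqF eM).
rewrite -mdeg_eq0 mdegE big_ord1 mnmBE !mulmnE !mnm1E eqxx !mul1n subn_eq0.
by rewrite eqn_leq eM andbT.
Qed.

Lemma uni_pow_mulE e g M : (t ^+ e * g) (uni M) =
  if (e <= M)%N then g (uni (M - e)) else 0.
Proof.
rewrite ps_varXE mulmnE mnm1E eqxx mul1n; case: ifP => // _; congr g.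
by apply/mnmP => i; rewrite mnmBE !mulmnE mulnBr.
Qed.
End Univariate.

Section Finite.
Variables (n : nat) (k : fieldType) (f : powser n.+1 k).
Hypothesis f0 : f <> 0.
Local Notation S := (powser n.+1 k).
Local Notation S0 := (powser n k).
Local Notation x := (ps_var k (ord_max : 'I_n.+1)).
Local Notation xw i := (ps_var k (widen_ord (leqnSn n) i)).

(** Let x be the last variable and a_i = x_i - x^(w_i) for separating weights w.
    Modulo the a_i all series become series in x, and f becomes x^W times a
    unit, W being the weight of its term of least weight. So x^W lies in (f,
    a_1, ..., a_n), and the powers of x below W span the quotient. *)
Lemma weierstrass_division : exists (a : 'I_n -> S) W,
  (forall i, a i mnm0 = 0) /\
  forall g, exists (b : 'I_W -> k) h (r : 'I_n -> S),
    g = \sum_(i < W) ps_const (b i) * x ^+ i + h * f + \sum_i a i * r i.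
Proof.
have [w [m0 [w0 wmax fm0 m0min]]] := separating_weights f0.
pose a i : S := xw i - x ^+ w (widen_ord (leqnSn n) i).
pose W := (\sum_i w i * m0 i)%N.
have a00 i : a i mnm0 = 0.
  rewrite /a ps_subE ps_var0E -[w _]prednK // exprS ps_mul0E ps_var0E mul0r.
  by rewrite subrr.
(* modulo the a i, every variable is a multiple of x *)
have E1 (g : S) : exists g' (r : 'I_n -> S),
    g = ps_const (g mnm0) + x * g' + \sum_i a i * r i.
  have [|G GE] := @max_vars _ _ (g - ps_const (g mnm0)).
    by rewrite ps_subE /ps_const eqxx subrr.
  exists (G ord_max + \sum_i x ^+ (w (widen_ord (leqnSn n) i)).-1 * G
    (widen_ord (leqnSn n) i)).
  exists (fun i => G (widen_ord (leqnSn n) i)).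
  rewrite -[LHS](subrK (ps_const (g mnm0))) GE addrC -addrA; congr (_ + _).
  rewrite big_ord_recr /= mulrDr mulr_sumr -addrA addrC; congr (_ + _).
  rewrite -big_split; apply: eq_bigr => i _ /=.
  by rewrite mulrA -exprS prednK // /a; ring.
have Es s (g : S) : exists (b : 'I_s -> k) g' (r : 'I_n -> S),
    g = \sum_(i < s) ps_const (b i) * x ^+ i + x ^+ s * g' + \sum_i a i * r i.
  elim: s => [|s [b [g' [r gE]]]].
    exists (fun=> 0), g, (fun=> 0); rewrite big_ord0 add0r expr0 mul1r.
    by rewrite big1 ?addr0 // => i _; rewrite mulr0.
  have [g'' [r' g'E]] := E1 g'.
  exists (fun i => if insub (nat_of_ord i) is Some j then b j else g' mnm0), g''.
  exists (fun i => r i + x ^+ s * r' i).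
  rewrite big_ord_recr /= insubF ?ltnn // {1}gE {1}g'E.
  under [X in _ = X + _ + _ + _]eq_bigr => i _ do rewrite valK.
  have -> : \sum_i a i * (r i + x ^+ s * r' i) =
      \sum_i a i * r i + x ^+ s * \sum_i a i * r' i.
    by rewrite mulr_sumr -big_split; apply: eq_bigr => i _ /=; ring.
  by rewrite exprSr; ring.
(* eps sends x_i to t^(w i): it kills all a i, and x to t *)
have tw0 i : (ps_var k (ord0 : 'I_1) ^+ w i) mnm0 = 0.
  by rewrite -(prednK (w0 i)) exprS ps_mul0E ps_var0E mul0r.
have [eps [eV eC eO eE]] :=
  @substitution n.+1 1 k (fun i => ps_var k (ord0 : 'I_1) ^+ w i) tw0.
have epsf M : (M <= W)%N -> eps f (uni M) = if M == W then f m0 else 0.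
  move=> MW; rewrite eE mdeg_uni.
  have mE (i : multinom n.+1) : mmap1 (fun i => ps_var k ord0 ^+ w i) i =
    ps_var k ord0 ^+ (\sum_j w j * i j) :> powser 1 k.
    rewrite /mmap1; elim/big_rec2: _ => // j y z _ ->.
    by rewrite exprD exprM.
  under eq_bigr => i _ do rewrite mE uni_powE.
  case: eqP => MWE.
    subst M; have m0W : (mdeg m0 < W.+1)%N.
      by rewrite ltnS mdegE; apply: leq_sum => i _; rewrite leq_pmull.
    rewrite (bigD1 (BMultinom m0W)) //= -/W eqxx mulr1 big1 ?addr0 // => i ne.
    case: (eqVneq (f i) 0) => [->|fi]; first by rewrite mul0r.
    by rewrite (ltn_eqF (m0min i fi _)) ?mulr0.
  rewrite big1 // => i _; case: (eqVneq (f i) 0) => [->|fi]; first by rewrite mul0r.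
  case: (eqVneq (i : multinom n.+1) m0) => [->|im].
    by rewrite (introF eqP MWE) mulr0.
  by rewrite (ltn_eqF (leq_ltn_trans MW (m0min i fi im))) mulr0.
have [b [g' [r fE]]] := Es W f.
have ea i : eps (a i) = 0.
  by rewrite /a rmorphB rmorphXn !eV wmax expr1 subrr.
have ef : eps f = \sum_(i < W) ps_const (b i) * ps_var k ord0 ^+ i +
  ps_var k ord0 ^+ W * eps g'.
  rewrite fE !rmorphD !rmorph_sum /= [X in _ + X]big1 ?addr0 => [|i _];
    last by rewrite rmorphM ea mul0r.
  rewrite rmorphM rmorphXn eV wmax expr1; congr (_ + _).
  by apply: eq_bigr => i _; rewrite rmorphM rmorphXn eV wmax expr1 eC.
have b0 i : b i = 0.
  have := epsf i (ltnW (ltn_ord i));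
    rewrite (ltn_eqF (ltn_ord i)) ef ps_addE ps_sumE uni_pow_mulE.
  rewrite leqNgt ltn_ord addr0 (bigD1 i) //= ps_constE uni_powE eqxx mulr1 big1
    ?addr0 // => j ji.
  by rewrite ps_constE uni_powE val_eqE eq_sym (negPf ji) mulr0.
have g'0 : g' mnm0 != 0.
  have := epsf W (leqnn W); rewrite eqxx ef ps_addE ps_sumE uni_pow_mulE leqnn subnn.
  rewrite big1 ?add0r => [E|i _]; last by rewrite b0 rmorph0 mul0r.
  apply: contra fm0 => /eqP g'0; rewrite -E; apply/eqP.
  have /eO g1 : ord_ge 1 g' by apply/ord_ge1P.
  by apply: g1; rewrite mdeg_uni.
have [v g'v] := ps_unit g'0.
exists a, W; split=> // g; have [c [g1 [r1 gE]]] := Es W g.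
exists c, (v * g1), (fun i => r1 i - r i * v * g1).
have xW : x ^+ W = f * v - \sum_i a i * (r i * v).
  rewrite fE big1 => [|i _]; last by rewrite b0 rmorph0 mul0r.
  rewrite add0r mulrDl -mulrA g'v mulr1 mulr_suml.
  under [X in _ + X - _]eq_bigr => i _ do rewrite -mulrA.
  by rewrite addrK.
rewrite {1}gE -!addrA; congr (_ + _); rewrite xW mulrBl mulr_suml.
have -> : \sum_i a i * (r1 i - r i * v * g1) = \sum_i a i * r1 i -
  \sum_i a i * (r i * v) * g1.
  by rewrite -sumrB; apply: eq_bigr => i _; ring.
by ring.
Qed.

End Finite.

(** * Dimension of hypersurfaces: the upper bound *)

Section Incomparability.
Variables (B A : comNzRingType) (phi : {rmorphism B -> A}).

Lemma ideal_N (I : set A) x : is_ideal I -> I x -> I (- x).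
Proof. by move=> [_ _ IM] Ix; rewrite -mulN1r; apply: IM. Qed.

(** In a monic relation p(x) in P of least degree the constant term lies in Q,
    hence in P by hypothesis. So x times a monic polynomial in x lies in P, and
    x does, since the degree is least. *)
Lemma integral_incomparable (P Q : set A) (p : {poly B}) x :
  is_prime_ideal P -> is_prime_ideal Q -> P `<=` Q ->
  (forall b, Q (phi b) -> P (phi b)) ->
  p \is monic -> P (map_poly phi p).[x] -> Q x -> P x.
Proof.
move=> [PI P1 PP] [QI Q1 QP] PQ con; have [P0 PD PM] := PI; have [Q0 QD QM] := QI.
move=> + + Qx; have [m] := ubnP (size p); elim: m p => // m IH p.
rewrite ltnS => sp pm Ppx; have [p0|] := leqP (size p) 1.
  have p1 : p = 1.
    by move/monicP: pm; rewrite (size1_polyC p0) lead_coefC => ->.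
  by case: P1; move: Ppx; rewrite p1 rmorph1 hornerC.
elim/poly_ind: p sp pm Ppx => [|p c _]; first by rewrite size_poly0.
move=> sp pm Ppx sp1.
have sz : size (p * 'X + c%:P) = (size p).+1.
  rewrite size_MXaddC; case: ifP => // /andP[/eqP p0 _]; move: sp1.
  by rewrite p0 mul0r add0r size_polyC; case: (c != 0).
have pm' : p \is monic.
  have p0 : p != 0 by apply: contraTneq sp1 => p0; rewrite sz p0 size_poly0.
  have := pm; rewrite !monicE lead_coefDl ?lead_coefMX // size_mulX // size_polyC.
  by rewrite ltnS (leq_trans (leq_b1 _)) // size_poly_gt0.
rewrite rmorphD rmorphM /= map_polyX map_polyC /= !hornerE in Ppx.
have Pc : P (phi c).
  apply: con; rewrite -[phi c](addKr ((map_poly phi p).[x] * x)).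
  by apply: QD; [apply: ideal_N => //; apply: QM|apply: PQ].
have : P ((map_poly phi p).[x] * x).
  rewrite -[_ * x](addrK (phi c)); apply: PD => //; exact: ideal_N.
case/PP => // Px; apply: IH Px => //.
by rewrite sz in sp.
Qed.

(** The characteristic polynomial of multiplication by x works, by the
    determinant trick. *)
Lemma integral_of_finite (J : set A) W (e : 'I_W -> A) x : is_ideal J ->
  (forall g, exists c : 'I_W -> B, J (g - \sum_i phi (c i) * e i)) ->
  exists2 p : {poly B}, p \is monic & J (map_poly phi p).[x].
Proof.
move=> JI span; have [J0 JD JM] := JI.
have /choice[c cE] : forall j, exists c : 'I_W ->
  B, J (x * e j - \sum_i phi (c i) * e i).
  by move=> j; apply: span.
pose M : 'M[B]_W := \matrix_(j, i) c j i.
exists (char_poly M); first exact: char_poly_monic.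
pose N : 'M[A]_W := x%:M - map_mx phi M.
have detN : (map_poly phi (char_poly M)).[x] = \det N.
  rewrite map_char_poly /char_poly -horner_evalE -det_map_mx; congr (\det _).
  apply/matrixP => i j; rewrite !mxE /=.
  by rewrite /horner_eval hornerD hornerN hornerMn hornerX hornerC.
have Ne j : J (\sum_i N j i * e i).
  have -> : \sum_i N j i * e i = x * e j - \sum_i phi (c j i) * e i.
    under eq_bigr => i _ do rewrite !mxE mulrBl.
    rewrite sumrB; congr (_ - _); rewrite (bigD1 j) //= eqxx mulr1n big1 ?addr0 //.
    by move=> i ij; rewrite eq_sym (negPf ij) mul0r.
  exact: cE.
have det_e l : J (\det N * e l).
  have -> : \det N * e l = \sum_j (\adj N) l j * \sum_i N j i * e i.
    under eq_bigr => j _ do rewrite mulr_sumr.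
    rewrite exchange_big /= (eq_bigr (fun i => (\adj N *m N) l i * e i)); last first.
      by move=> i _; rewrite mxE mulr_suml; apply: eq_bigr => j _; rewrite mulrA.
    rewrite mul_adj_mx (bigD1 l) //= mxE eqxx mulr1n big1 ?addr0 // => i il.
    by rewrite mxE eq_sym (negPf il) mul0r.
  by apply: ideal_sum => // j _; apply: JM.
have [b bE] := span 1; rewrite detN -[\det N]mulr1 -[1](subrK (\sum_i phi (b i) * e i)).
rewrite mulrDr; apply: JD; first exact: JM.
rewrite mulr_sumr; apply: ideal_sum => // i _.
by rewrite mulrCA; apply: JM.
Qed.

Lemma prime_preimage (P : set A) : is_prime_ideal P -> is_prime_ideal (phi @^-1` P).
Proof.
move=> [[P0 PD PM] P1 PP]; split; rewrite /preimage /=.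
- split=> [|y z Py Pz|b y Py] /=; first by rewrite rmorph0.
    by rewrite rmorphD; apply: PD.
  by rewrite rmorphM; apply: PM.
- by rewrite rmorph1.
by move=> b c; rewrite rmorphM => /PP.
Qed.

End Incomparability.

Section Finite.
Variables (n : nat) (k : fieldType) (f : powser n.+1 k).
Hypothesis f0 : f <> 0.
Local Notation S := (powser n.+1 k).
Local Notation S0 := (powser n k).
Local Notation x := (ps_var k (ord_max : 'I_n.+1)).

(** The variables of the smaller ring go to the a_i of weierstrass_division.
    Dividing the coefficients of the remainder again and again leaves an error
    in the N-th power of (a_1, ..., a_n) after N steps, and the quotients
    converge. *)
Lemma finite_over_powser : exists (phi : {rmorphism S0 -> S}) W (e : 'I_W -> S),
  forall g : S, exists c : 'I_W -> S0, exists h, g - \sum_i phi (c i) * e i = h * f.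
Proof.
have [a [W [a0 span]]] := weierstrass_division f0.
have [phi [pV pC pO _]] := substitution a0.
exists phi, W, (fun i => x ^+ i).
(* IN N is the N-th power of the ideal of the a i *)
pose IN := fix IN N (r : S) := if N is N'.+1 then
  exists2 R : 'I_n -> S, (forall j, IN N' (R j)) & r = \sum_j a j * R j else True.
have INord N r : IN N r -> ord_ge N r.
  elim: N r => [|N IH] r; first by move=> _; exact: ord_ge_trivial.
  move=> [R RN ->]; apply: ord_ge_sum => j _; rewrite -[X in ord_ge X _]add1n;
    apply: ord_geM; last by apply: IH; apply: RN.
  exact/ord_ge1P.
have step N r : IN N r -> exists (B : 'I_W -> S0) h r',
    [/\ forall i, ord_ge N (B i), ord_ge N h, IN N.+1 r'
      & r = \sum_i phi (B i) * x ^+ i + h * f + r'].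
  elim: N r => [|N IH] r.
    move=> _; have [b [h [R rE]]] := span r.
    exists (fun i => ps_const (b i)), h, (\sum_i a i * R i).
    split; [by move=> i; exact: ord_ge_trivial|exact: ord_ge_trivial|by exists R|].
    by rewrite {1}rE; congr (_ + _ + _); apply: eq_bigr => i _; rewrite pC.
  move=> [R RN rE].
  have /choice[B HB] : forall j, exists B : 'I_W ->
    S0, exists h r', [/\ forall i, ord_ge N (B i), ord_ge N h, IN N.+1 r'
      & R j = \sum_i phi (B i) * x ^+ i + h * f + r'].
    by move=> j; apply: IH; apply: RN.
  have /choice[h Hh] := HB; have /choice[r' Hr] := Hh.
  exists (fun i => \sum_j ps_var k j * B j i), (\sum_j a j * h j), (\sum_j a j * r' j).
  split.
  - move=> i; apply: ord_ge_sum => j _; rewrite -[X in ord_ge X _]add1n; apply: ord_geM.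
      by apply/ord_ge1P; exact: ps_var0E.
    by case: (Hr j).
  - apply: ord_ge_sum => j _; rewrite -[X in ord_ge X _]add1n; apply: ord_geM;
    first exact/ord_ge1P.
    by case: (Hr j).
  - by exists r' => // j; case: (Hr j).
  rewrite rE (eq_bigr (fun j => a j * (\sum_i phi (B j i) * x ^+ i) +
    a j * h j * f + a j * r' j)); last first.
    by move=> j _; case: (Hr j) => _ _ _ {1}->; ring.
  rewrite !big_split /= mulr_suml; congr (_ + _ + _).
  under [RHS]eq_bigr => i _ do rewrite rmorph_sum mulr_suml.
  rewrite [RHS]exchange_big; apply: eq_bigr => j _; rewrite mulr_sumr.
  by apply: eq_bigr => i _ /=; rewrite rmorphM pV mulrA.
(* F performs one division step, and rr N is the remainder after N of them *)
move=> g.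
have /choice[F HF] : forall Nr : nat * S, exists Bhr :
  ('I_W -> S0) * S * S, IN Nr.1 Nr.2 ->
    [/\ forall i, ord_ge Nr.1 (Bhr.1.1 i), ord_ge Nr.1 Bhr.1.2, IN Nr.1.+1 Bhr.2
      & Nr.2 = \sum_i phi (Bhr.1.1 i) * x ^+ i + Bhr.1.2 * f + Bhr.2].
  move=> [N r]; case: (pselect (IN N r)) => [/step[B [h [r' H]]]|nIN].
    by exists (B, h, r').
  by exists (fun=> 0, 0, 0).
pose rr := fix rr N := if N is N'.+1 then (F (N', rr N')).2 else g.
have rrN N : IN N (rr N).
  by elim: N => [|N IH] //; case: (HF (N, rr N) IH).
pose BB N i := (F (N, rr N)).1.1 i; pose hh N := (F (N, rr N)).1.2.
have BBo N i : ord_ge N (BB N i) by have [H _ _ _] := HF (N, rr N) (rrN N); apply: H.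
have hho N : ord_ge N (hh N) by case: (HF (N, rr N) (rrN N)).
have rrE N : rr N = \sum_i phi (BB N i) * x ^+ i + hh N * f + rr N.+1.
  by case: (HF (N, rr N) (rrN N)).
have /choice[c cE] : forall i, exists c, forall N, ord_ge N (c - \sum_(l < N) BB l i).
  by move=> i; apply: ord_ge_limit => N; rewrite big_ord_recr /= addrC addrK.
have [h hE] : exists h, forall N, ord_ge N (h - \sum_(l < N) hh l).
  by apply: ord_ge_limit => N; rewrite big_ord_recr /= addrC addrK.
exists c, h; apply: ord_ge_eq => N.
have gE : g = \sum_i phi (\sum_(l < N) BB l i) * x ^+ i +
  (\sum_(l < N) hh l) * f + rr N.
  elim: N => [|N IH].
    rewrite big_ord0 mul0r addr0 big1 ?add0r // => i _.
    by rewrite big_ord0 rmorph0 mul0r.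
  rewrite IH rrE big_ord_recr /= mulrDl !addrA; congr (_ + _).
  under [in RHS]eq_bigr => i _ do rewrite big_ord_recr rmorphD mulrDl.
  by rewrite big_split /=; ring.
rewrite {1}gE.
have -> : \sum_i phi (\sum_(l < N) BB l i) * x ^+ i + (\sum_(l < N) hh l) * f + rr N -
   \sum_i phi (c i) * x ^+ i - h * f =
   rr N - \sum_i phi (c i - \sum_(l < N) BB l i) * x ^+ i - (h - \sum_(l < N) hh l) * f.
  under [\sum_i phi (c i - _) * _]eq_bigr => i _ do rewrite rmorphB mulrBl.
  by rewrite sumrB; ring.
apply: ord_geB; last exact: ord_geMr.
apply: ord_geB; first by apply: INord; apply: rrN.
by apply: ord_ge_sum => i _; apply: ord_geMr; apply: pO.
Qed.

End Finite.

Definition primes_over (A : comNzRingType) (f : A) : set (set A) :=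
  [set P | is_prime_ideal P /\ P f].

(** Primes over f restrict to primes of the smaller ring, and strict inclusions
    stay strict as the extension is integral modulo f. *)
Lemma primes_over_chain_le n (k : fieldType) (f : powser n.+1 k) l : f <> 0 ->
  (forall m, chain_lengths (@is_prime_ideal (powser n k)) m -> (m <= n)%N) ->
  chain_lengths (primes_over f) l -> (l <= n)%N.
Proof.
move=> f0 IH [c [cP cS]]; have [phi [W [e span]]] := finite_over_powser f0.
apply: IH; exists (fun i => phi @^-1` c i); split=> i il.
  by apply: prime_preimage; case: (cP i il).
have [sub ne] := cS i il; have [Pp Pf] := cP i (ltnW il); have [Qp Qf] := cP i.+1 il.
split=> [y /sub //|con]; apply: ne => y Qy.
have PI : is_ideal (c i) by case: Pp.
have span' g : exists b : 'I_W -> powser n k, c i (g - \sum_j phi (b j) * e j).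
  have [b [h gE]] := span g; exists b; rewrite gE.
  by case: PI => _ _; apply.
have [p pm Pp'] := integral_of_finite y PI span'.
exact: (integral_incomparable Pp Qp sub con pm Pp').
Qed.

(** All primes of a chain but the first contain a common nonzero f. *)
Lemma powser_chain_le n (k : fieldType) m :
  chain_lengths (@is_prime_ideal (powser n k)) m -> (m <= n)%N.
Proof.
elim: n m => [|n IH] m [c [cP cS]]; case: m cP cS => // m cP cS.
  have [sub ne] := cS 0%N isT; case: ne => y c1y.
  have [yz|/ps_unit[z yz]] := eqVneq (y mnm0) 0.
    have -> : y = 0.
      by apply: ps_ext => l; rewrite (_ : l = mnm0) //; apply/mnmP => -[].
    by have [[]] := cP 0%N isT.
  have [[_ _ cM] c1 _] := cP 1%N isT; case: c1.
  by rewrite -yz mulrC; apply: cM.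
have [f [c1f cf]] : exists f, c 1%N f /\ f <> 0.
  have [sub ne] := cS 0%N isT; apply: contrapT => H; apply: ne => f c1f.
  have -> : f = 0 by apply: contrapT => f0; apply: H; exists f.
  by have [[]] := cP 0%N isT.
rewrite ltnS; apply: (primes_over_chain_le cf IH); exists (fun i => c i.+1).
split=> i il; last exact: cS.
split; first exact: cP.
have H : forall j, (j <= m)%N -> c j.+1 f.
  elim=> [//|j IHj] jm; have [sub _] := cS j.+1 jm.
  by apply: sub; apply: IHj; apply: ltnW.
exact: H.
Qed.

(** * Dimension of hypersurfaces: the lower bound *)

Section Domain.
Variables (n : nat) (k : fieldType).
Local Notation S := (powser n k).
Implicit Types (f g : S) (m : multinom n).

Lemma ps_least f : f <> 0 ->
  exists a, f a <> 0 /\ forall m, (m < a)%O -> f m = 0.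
Proof.
move=> f0; apply: contrapT => H; apply: f0; apply: ps_ext; apply: ltmwf => m IH.
by apply: contrapT => fm; apply: H; exists m.
Qed.

Lemma ps_mulE f g m : (f * g) m =
  \sum_(ij : bmultinom n (mdeg m).+1 * bmultinom n (mdeg m).+1
        | m == mnm_add ij.1 ij.2) f ij.1 * g ij.2.
Proof. by []. Qed.

(** The product of the least terms for a monomial order does not cancel. *)
Lemma ps_domain f g : f * g = 0 -> f = 0 \/ g = 0.
Proof.
move=> fg; apply: contrapT => /not_orP[/ps_least[a [fa fl]] /ps_least[b [gb gl]]].
pose c := mnm_add a b.
have ac : (mdeg a < (mdeg c).+1)%N by rewrite ltnS mdegD leq_addr.
have bc : (mdeg b < (mdeg c).+1)%N by rewrite ltnS mdegD leq_addl.
have : (f * g) c = 0 by rewrite fg.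
rewrite ps_mulE (bigD1 (BMultinom ac, BMultinom bc)) //= big1 =>
  [|[i j] /= /andP[/eqP cE ne]].
  by rewrite addr0 => /eqP; rewrite mulf_eq0 => /orP[] /eqP.
case: (ltP (i : multinom n) a) => [/fl->|ai]; first by rewrite mul0r.
case: (ltP (j : multinom n) b) => [/gl->|bj]; first by rewrite mulr0.
case/eqP: ne; have [ia|nia] := eqVneq (i : multinom n) a.
  have jb : (j : multinom n) = b.
    rewrite -[LHS](mnm_addI a) -[RHS](mnm_addI a); congr (mnm_sub _ _).
    by rewrite -[in LHS]ia -cE.
  by congr (_, _); apply: val_inj.
have ai' : (a < i)%O by rewrite lt_neqAle eq_sym nia.
by have := ltmc_le_add ai' bj; rewrite -cE ltxx.
Qed.

(** The variables v with J v are set to 0. *)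
Definition restr (J : pred 'I_n) f : S :=
  fun m => if [forall i, J i ==> (m i == 0%N)] then f m else 0.

Lemma restrM J f g : restr J (f * g) = restr J f * restr J g.
Proof.
apply: ps_ext => m; rewrite ps_mulE /restr; case: ifP => H.
  rewrite ps_mulE; apply: eq_bigr => -[i j] /= /eqP mE.
  have mv v : m v = (i v + j v)%N by rewrite -mnmDE -mE.
  rewrite !ifT //; apply/forallP => v; apply/implyP => Jv;
    by have := implyP (forallP H v) Jv; rewrite mv addn_eq0 => /andP[].
rewrite big1 // => -[i j] /= /eqP mE.
case: ifP => Hi; last by rewrite mul0r.
case: ifP => Hj; last by rewrite mulr0.
case/negP: (negbT H); apply/forallP => v; apply/implyP => Jv.
by rewrite mE mnmDE (eqP (implyP (forallP Hi v) Jv)) (eqP (implyP (forallP Hj v) Jv)).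
Qed.

(** Setting variables to 0 is multiplicative, with values in a domain. *)
Lemma restr_prime J : is_prime_ideal [set f | restr J f = 0].
Proof.
split; [split|..] => /=.
- by apply: ps_ext => m; rewrite /restr; case: ifP.
- move=> x y x0 y0; apply: ps_ext => m.
  have := congr1 (@^~ m) x0; have := congr1 (@^~ m) y0; rewrite /restr.
  by case: ifP => // _ ym xm; rewrite ps_addE ym xm addr0.
- by move=> a x x0; rewrite restrM x0 mulr0.
- move/(congr1 (@^~ mnm0)); rewrite /restr ifT; last first.
    by apply/forallP => i; rewrite mnm0E eqxx implybT.
  by rewrite ps_one0 => /eqP; rewrite oner_eq0.
by move=> a b; rewrite restrM => /ps_domain.
Qed.

Lemma restr_var (J : pred 'I_n) i : restr J (ps_var k i) =
  if J i then 0 else ps_var k i.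
Proof.
apply: ps_ext => m; rewrite /restr /ps_var; have [->|ne] := eqVneq m (mnm1 i);
  last first.
  by rewrite if_same; case: (J i); rewrite //= (negbTE ne).
rewrite (_ : [forall _, _] = ~~ J i); last first.
  apply/forallP/idP => [/(_ i)|Ji j]; first by rewrite mnm1E eqxx; case: (J i).
  by rewrite mnm1E; have [<-|_] := eqVneq i j; rewrite ?(negbTE Ji) ?implybT.
by case: (J i); rewrite //= eqxx.
Qed.

Lemma ps_var_neq0 (i : 'I_n) : ps_var k i <> 0.
Proof.
move/(congr1 (@^~ (mnm1 i))); rewrite /ps_var eqxx; by move/eqP; rewrite oner_eq0.
Qed.
End Domain.

Lemma hypersurface_primes n (k : fieldType) (f : powser n k) (f0 : f mnm0 = 0) :
  chain_lengths (@is_prime_ideal (hypersurface f0)) = chain_lengths (primes_over f).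
Proof.
have [pi [onto ker]] := hypersurface_pi f0.
have pi_f : pi f = 0 by apply/ker; exists 1; rewrite mul1r.
apply: (chain_lengths_onto onto) => [P PP|P [PP Pf]].
  split; first exact: (prime_preimage pi PP).
  by rewrite /preimage /= pi_f; case: PP => -[].
have sat s s' : pi s = pi s' -> P s -> P s'.
  move/esym/(pi_eq ker)=> [h hE]; have -> : s' = h * f + s by rewrite -hE subrK.
  have [[_ PD PM] _ _] := PP; move=> Ps; apply: PD => //; exact: PM.
split=> //; split; first by apply: (image_ideal onto); case: PP.
  move=> [s Ps]; rewrite -(rmorph1 pi) => /sat/(_ Ps); by case: PP.
move=> a b; have [s <-] := onto a; have [t <-] := onto b; rewrite -rmorphM.
move=> [r Pr] /sat/(_ Pr); have [_ _ H] := PP => /H[Ps|Pt]; [left|right].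
  by exists s.
by exists t.
Qed.

Section Parametrization.
Variables (k : fieldType) (d : nat).
Hypothesis d2 : (2 <= d)%N.
Local Notation S := (powser d.+1 k).
Local Notation x := (fun i : nat => ps_var k (inord i : 'I_d.+1)).

(** This expresses f = x_0 x_1 + g(x_2, ..., x_d) with g of order at least two:
    when all x_i with i >= 2 are multiples u b_i of one element u, g is a
    multiple of u^2, and W is the quotient. *)
Definition hyperbolic_like (f : S) := forall R : comNzRingType,
  exists W : R -> (nat -> R) -> R, forall (psi : {rmorphism S -> R}) u b,
    (forall i, (2 <= i <= d)%N -> psi (x i) = u * b i) ->
    psi f = psi (x 0%N) * psi (x 1%N) + u * (u * W u b).

Lemma hyperbolic_like_hyperbolic m : (0 < m)%N -> (m.*2 <= d.+1)%N ->
  hyperbolic_like (@hyperbolic k d m).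
Proof.
move=> m0 md R; exists (fun u b => \sum_(1 <= i < m) b i.*2 * b i.*2.+1).
move=> psi u b psiE; rewrite /hyperbolic big_ltn // rmorphD rmorphM /=; congr (_ + _).
rewrite rmorph_sum /= !mulr_sumr; apply: eq_big_nat => i /andP[i1 im].
by rewrite rmorphM !psiE; first (by ring); lia.
Qed.

Lemma hyperbolic_like_power f i r : (2 <= i <= d)%N ->
  hyperbolic_like f -> hyperbolic_like (f + x i ^+ r.+2).
Proof.
move=> id fl R; have [W WE] := fl R.
exists (fun u b => W u b + u ^+ r * b i ^+ r.+2) => psi u b psiE.
rewrite rmorphD rmorphXn (WE _ u b) // (psiE i id).
by rewrite !exprS exprMn; ring.
Qed.

Lemma hyperbolic_like_Q : hyperbolic_like (@Qd k d).
Proof.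
rewrite /Qd; case: ifP => od; first by apply: hyperbolic_like_hyperbolic; lia.
by apply: hyperbolic_like_power; [lia|apply: hyperbolic_like_hyperbolic; lia].
Qed.

Lemma hyperbolic_like_P : hyperbolic_like (@Pd k d).
Proof.
rewrite /Pd; case: ifP => od.
  apply: hyperbolic_like_power; first lia.
  by apply: hyperbolic_like_power; [lia|apply: hyperbolic_like_hyperbolic; lia].
by apply: hyperbolic_like_power; [lia|apply: hyperbolic_like_hyperbolic; lia].
Qed.

(** Setting all variables but x_0 and x_1 to 0 maps f to x_0 x_1. *)
Lemma hyperbolic_like_neq0 f : hyperbolic_like f -> f <> 0.
Proof.
move=> fl f0; have [W WE] := fl S.
pose a (i : 'I_d.+1) : S := if (i <= 1)%N then ps_var k i else 0.
have a0 i : a i mnm0 = 0 by rewrite /a; case: ifP => // _; apply: ps_var0E.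
have [phi [phiv _ _ _]] := @substitution d.+1 d.+1 k a a0.
have := WE phi 0 (fun=> 0) _; rewrite f0 rmorph0 !phiv /a !inordK; [|lia..].
rewrite !mul0r addr0 /= => H.
have /esym/ps_domain[] : 0 = x 0%N * x 1%N :> S.
  by apply: H => i id; rewrite phiv /a inordK ?ifF //; lia.
- exact: ps_var_neq0.
exact: ps_var_neq0.
Qed.

End Parametrization.

(** The substitution x_1 = u_0, x_i = u_0 u_(i-1) for i >= 2, x_0 = - g / u_0
    maps f to 0. Under it the primes generated by the last j variables u_i pull
    back to different primes: x_(d-j) is in the one for j + 1 but not in the one
    for j. *)
Lemma hyperbolic_like_chain (k : fieldType) d (f : powser d.+1 k) :
  (2 <= d)%N -> hyperbolic_like f -> chain_lengths (primes_over f) d.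
Proof.
case: d f => // n f n2 fl; pose E := powser n.+1 k.
have [W WE] := fl E.
pose u : 'I_n.+1 -> E := ps_var k.
pose b i : E := u (inord i.-1).
pose a (i : 'I_n.+2) : E := if i == 0%N :> nat then - (u ord0 * W (u ord0) b)
  else if i == 1%N :> nat then u ord0 else u ord0 * b i.
have u0 i : u i mnm0 = 0 by apply: ps_var0E.
have a0 i : a i mnm0 = 0.
  rewrite /a; case: ifP => _; first by rewrite ps_oppE ps_mul0E u0 mul0r oppr0.
  by case: ifP => _ //; rewrite ps_mul0E u0 mul0r.
have [psi [psiv _ _ _]] := @substitution n.+2 n.+1 k a a0.
have psif : psi f = 0.
  rewrite (WE psi (u ord0) b); last first.
    by move=> i id; rewrite psiv /a inordK ?ifF //; lia.
  by rewrite !psiv /a !inordK //=; ring.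
pose J j (i : 'I_n.+1) := (n.+1 - j <= i)%N.
exists (fun j => psi @^-1` [set g | restr (J j) g = 0]); split=> j jn.
  split; first exact: (prime_preimage psi (@restr_prime _ _ (J j))).
  rewrite /preimage /= psif.
  by have [[]] := @restr_prime n.+1 k (J j).
split.
  move=> g /= gj; apply: ps_ext => m; have := congr1 (@^~ m) gj; rewrite /restr.
  case: ifP => [H|H _]; last first.
    rewrite ifF //; apply/negbTE; move/negbT: H; apply: contra => /forallP H.
    apply/forallP => i; apply/implyP => Ji; apply: (implyP (H i)).
    by move: Ji; rewrite /J; lia.
  by case: ifP.
move=> H; pose i : 'I_n.+1 := inord (n - j).
have iE : i = (n - j)%N :> nat by rewrite inordK //; lia.
have uJ l : restr (J l) (u ord0 * u i) =
  (if J l ord0 then 0 else u ord0) * (if J l i then 0 else u i).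
  by rewrite restrM !restr_var.
pose y : powser n.+2 k := ps_var k (inord (n - j).+1).
have yE : psi y = if (n - j == 0)%N then u ord0 else u ord0 * u i.
  rewrite /y psiv /a inordK; last lia.
  by rewrite /= eqSS; case: ifP => // _; rewrite /b.
have := H y; rewrite /= yE; case: ifP => nj.
  rewrite !restr_var /J /= ifT; last lia.
  rewrite ifF; last lia.
  by move=> /(_ erefl); apply: ps_var_neq0.
rewrite !uJ; have [-> -> -> ->] : [/\ J j.+1 i = true, J j ord0 = false, J j i = false &
    J j.+1 ord0 = false] by rewrite /J iE /=; split; lia.
rewrite mulr0.
by move=> /(_ erefl) /ps_domain[]; apply: ps_var_neq0.
Qed.

Lemma krull_dim_hyperbolic_like (k : fieldType) d (f : powser d.+1 k)
    (f0 : f mnm0 = 0) :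
  (2 <= d)%N -> hyperbolic_like f -> krull_dim (hypersurface f0) = d.
Proof.
move=> d2 fl; rewrite /krull_dim hypersurface_primes; apply: supremum_nat.
  exact: hyperbolic_like_chain.
move=> m; apply: primes_over_chain_le; first exact: hyperbolic_like_neq0.
by move=> l; apply: powser_chain_le.
Qed.

Lemma krull_dim_R2 d : (2 <= d)%N -> krull_dim (R2 d) = d.
Proof. by move=> d2; apply: krull_dim_hyperbolic_like => //;
  apply: hyperbolic_like_Q. Qed.

Lemma krull_dim_S3 d : (2 <= d)%N -> krull_dim (S3 d) = d.
Proof. by move=> d2; apply: krull_dim_hyperbolic_like => //;
  apply: hyperbolic_like_P. Qed.

(** * Hilbert-Kunz multiplicities *)

Section Multiplicities.
Variable K : realType.

Lemma eHK_eventually p (A : comNzRingType) (c : K) : (0 < p)%N ->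
  (forall e, (HK p A e.+1)%:R = c * p%:R ^+ (e.+1 * krull_dim A)) ->
  eHK K p A = c.
Proof.
move=> p0 HKE; apply: (cvg_lim (@Rhausdorff K)); rewrite -cvg_shiftS.
apply: cvg_near_cst; apply: nearW => e; rewrite /= HKE mulfK //.
by rewrite expf_neq0 // pnatr_eq0 -lt0n.
Qed.

Lemma eHK_R2_even d : (2 <= d)%N -> ~~ odd d ->
  eHK K 2 (R2 d) = 1 + 2%:R ^+ d./2 / 4%:R ^+ d./2.
Proof.
move=> d2 od; apply: eHK_eventually => // e; rewrite krull_dim_R2 // HK_R2_even //.
have dE : d = (2 * d./2)%N by lia.
have -> : 2%:R ^+ (e.+1 * d) = 2%:R ^+ (e * d) * 4%:R ^+ d./2 :> K.
  by rewrite (natrX _ 2 2) -exprM -dE -exprD mulSn addnC.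
have n0 : 4%:R ^+ d./2 != 0 :> K by rewrite expf_neq0 ?pnatr_eq0.
by rewrite -expnM natrM natrD !natrX; field.
Qed.

Lemma eHK_S3_even d : (2 <= d)%N -> ~~ odd d ->
  eHK K 3 (S3 d) = 1 + 3%:R / 2%:R * (4%:R ^+ d./2 / 9%:R ^+ d./2).
Proof.
move=> d2 od; apply: eHK_eventually => // e; rewrite krull_dim_S3 //.
have dE : d = (2 * d./2)%N by lia.
have -> : 3%:R ^+ (e.+1 * d) = 3%:R ^+ (e * d) * 9%:R ^+ d./2 :> K.
  by rewrite (natrX _ 3 2) -exprM -dE -exprD mulSn addnC.
have n0 : 9%:R ^+ d./2 != 0 :> K by rewrite expf_neq0 ?pnatr_eq0.
have := congr1 (fun n : nat => n%:R : K) (HK_S3_even e od d2).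
rewrite /= -expnM !natrM natrD !natrM !natrX => H.
apply: (mulfI (_ : 2%:R != 0)); first by rewrite pnatr_eq0.
by rewrite H; field.
Qed.

Lemma eHK_S3_odd d : (2 <= d)%N -> odd d ->
  eHK K 3 (S3 d) = 1 + 4%:R ^+ d./2 / 9%:R ^+ d./2.
Proof.
move=> d2 od; apply: eHK_eventually => // e; rewrite krull_dim_S3 // HK_S3_odd //.
have dE : d = (2 * d./2).+1 by lia.
have -> : 3%:R ^+ (e.+1 * d) = 3%:R ^+ (e * d) * (3%:R * 9%:R ^+ d./2) :> K.
  by rewrite (natrX _ 3 2) -exprM -exprS -dE -exprD mulSn addnC.
have n0 : 9%:R ^+ d./2 != 0 :> K by rewrite expf_neq0 ?pnatr_eq0.
by rewrite -expnM !natrM natrD !natrX; field.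
Qed.

(** With M = (d+1)/2, the e-th term of the sequence is 1 + (1 - 2^(-eM)) / (2^M
    - 1). *)
Lemma eHK_R2_odd d : (2 <= d)%N -> odd d ->
  eHK K 2 (R2 d) = 1 + (2%:R ^+ d./2.+1 - 1)^-1.
Proof.
move=> d2 od; set M := d./2.+1; have dE : d.+1 = (2 * M)%N by lia.
have M1 : 0 < 2%:R ^+ M - 1 :> K.
  by rewrite subr_gt0 exprn_egt1 // ltr1n.
have z1 : `|(2%:R ^+ M)^-1 : K| < 1.
  by rewrite ger0_norm ?invr_ge0 ?exprn_ge0 // invf_lt1 ?exprn_gt0 // -subr_gt0.
apply: (cvg_lim (@Rhausdorff K)); rewrite krull_dim_R2 //.
rewrite (_ : (fun e => _) = fun e =>
    1 + (1 - (2%:R ^+ M)^-1 ^+ e) * (2%:R ^+ M - 1)^-1); last first.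
  apply/funext => e; have := congr1 (fun n : nat => n%:R : K) (HK_R2_odd e od).
  rewrite natrM natrD natrM natr_sum -/M dE.
  under eq_bigr do rewrite natrX mulnC exprM.
  have := subrX1 (2%:R ^+ M : K) e; set s := \sum_(i < e) _ => sE.
  rewrite !natrX => H.
  have q0 : 2%:R ^+ e != 0 :> K by rewrite expf_neq0 ?pnatr_eq0.
  have M0 : 2%:R ^+ M != 0 :> K by rewrite expf_neq0 ?pnatr_eq0.
  have t0 : (2%:R ^+ M) ^+ e != 0 :> K by rewrite expf_neq0.
  have tE : (2%:R ^+ e) ^+ M = (2%:R ^+ M) ^+ e :> K by rewrite exprAC.
  have pE : 2%:R ^+ e * 2%:R ^+ (e * d) = ((2%:R ^+ M) ^+ e) ^+ 2 :> K.
    by rewrite -exprD -mulnS dE -!exprM; congr (_ ^+ _); ring.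
  move: H; rewrite [(2 * M)%N]mulnC exprM tE exprVn.
  move: t0 pE sE; set t := (_ ^+ M) ^+ e; set q := 2%:R ^+ e in q0 *.
  move=> t0 pE sE H.
  have -> : (HK 2 (R2 d) e)%:R = (t ^+ 2 + t * s) / q :> K.
    by rewrite -H mulrC mulKf.
  have -> : 2%:R ^+ (e * d) = t ^+ 2 / q :> K by rewrite -pE mulrC mulKf.
  have -> : s = (t - 1) / (2%:R ^+ M - 1) by rewrite sE mulrC mulKf ?gt_eqF.
  by field; rewrite t0 gt_eqF.
set c := (2%:R ^+ M - 1)^-1; have -> : 1 + c = 1 + (1 - 0) * c by rewrite subr0 mul1r.
apply: cvgD; first exact: cvg_cst.
apply: cvgMl; apply: cvgB; [exact: cvg_cst|exact: cvg_expr].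
Qed.

End Multiplicities.

Lemma even_compare m : (3 * 8 ^ m < 2 * 9 ^ m)%N = (4 <= m)%N.
Proof.
have [m4|] := leqP 4 m; last by case: m => [|[|[|[|]]]].
rewrite -(subnKC m4); elim: (m - 4)%N => [//|j IH].
move: IH; rewrite addnS !expnS.
by set a := (8 ^ _)%N; set b := (9 ^ _)%N; clearbody a b; lia.
Qed.

Lemma odd_compare m : (2 * 8 ^ m < 9 ^ m + 4 ^ m)%N = (6 <= m)%N.
Proof.
have [m6|] := leqP 6 m; last by case: m => [|[|[|[|[|[|]]]]]].
suff : (2 * 8 ^ m < 9 ^ m)%N by lia.
rewrite -(subnKC m6); elim: (m - 6)%N => [|j IH].
  rewrite addn0; lia.
move: IH; rewrite addnS !expnS.
by set a := (8 ^ _)%N; set b := (9 ^ _)%N; clearbody a b; lia.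
Qed.

Theorem corollary3p14 (K : realType) (d : nat) (hd : (2 <= d)%N) :
  eHK K 3 (S3 d) < eHK K 2 (R2 d) <->
  (~~ odd d /\ (8 <= d)%N) \/ (odd d /\ (13 <= d)%N).
Proof.
have pos a : 0 < a.+1%:R ^+ d./2 :> K by rewrite exprn_gt0 // ltr0n.
have [od|od] := boolP (odd d).
  have -> : eHK K 3 (S3 d) < eHK K 2 (R2 d) = (2 * 8 ^ d./2 < 9 ^ d./2 + 4 ^ d./2)%N.
    rewrite eHK_S3_odd // eHK_R2_odd // ltrD2l.
    have M1 : 0 < 2%:R ^+ d./2.+1 - 1 :> K by rewrite subr_gt0 exprn_egt1 // ltr1n.
    rewrite ltr_pdivrMr // mulrC ltr_pdivlMr // mulrBr mulr1 ltrBlDr.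
    rewrite -!natrX -natrM -natrD ltr_nat expnS mulnCA -expnMn.
    by [].
  by rewrite odd_compare; split=> [|[[]|[]]] //; lia.
have -> : eHK K 3 (S3 d) < eHK K 2 (R2 d) = (3 * 8 ^ d./2 < 2 * 9 ^ d./2)%N.
  rewrite eHK_S3_even // eHK_R2_even // ltrD2l.
  rewrite mulrA ltr_pdivrMr // [X in _ < X]mulrAC ltr_pdivlMr //.
  rewrite -(ltr_nat K) !natrM !natrX (natrX _ 2 2) (natrX _ 2 3).
  rewrite -!exprM ![(_ * d./2)%N]mulnC !exprM.
  move: (pos 1%N); set a := 2%:R ^+ _; set b := 9%:R ^+ _ => a0.
  rewrite -(ltr_pM2l a0) -[RHS](ltr_pM2l (_ : 0 < 2%:R^-1)) ?invr_gt0 ?ltr0n //.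
  by congr (_ < _); field.
by rewrite even_compare; split=> [|[[]|[]]] //; lia.
Qed.
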